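(* Let $f:\mathbb{K}\to\mathbb{K}$ be a smooth function such that $f$ and all its derivatives are of at most polynomial growth at infinity, $f$ satisfies a global Lipschitz estimate (i.e. has bounded first derivative), and $f(0)=0$. Let $a,b\in\mathcal{G}(\mathbb{R})$ and $h\in\mathcal{G}(\mathbb{R}^2)$. Then the problem $$\partial_t^2u-\partial_x^2u=f(u)+h\ \text{ in }\mathcal{G}(\mathbb{R}^2),\qquad u|_{\{t=0\}}=a,\quad \partial_tu|_{\{t=0\}}=b\ \text{ in }\mathcal{G}(\mathbb{R})$$ has a unique solution $u\in\mathcal{G}(\mathbb{R}^2)$. Moreover, the solution depends continuously on the data with respect to the sharp topology, i.e. the map $(a,b,h)\mapsto u$ from $\mathcal{G}(\mathbb{R})\times\mathcal{G}(\mathbb{R})\times\mathcal{G}(\mathbb{R}^2)$ to $\mathcal{G}(\mathbb{R}^2)$ is continuous when all spaces carry their sharp topologies.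
   Context: Fix the scalar field $\mathbb{K}\in\{\mathbb{R},\mathbb{C}\}$; all functions are $\mathbb{K}$-valued, and if $\mathbb{K}=\mathbb{C}$, smoothness and derivatives of $f$ are meant in the real sense with $\mathbb{C}\cong\mathbb{R}^2$. Points of $\mathbb{R}^2$ are written $(x,t)$. Colombeau algebra: for open $\Omega\subset\mathbb{R}^n$ consider families $(u_\varepsilon)_{\varepsilon\in(0,1]}$ with $u_\varepsilon\in C^\infty(\Omega)$. The family is moderate, $(u_\varepsilon)\in\mathcal{E}_{\mathrm M}(\Omega)$, if for every compact $K\subset\Omega$ and every $\alpha\in\mathbb{N}_0^n$ there is $p\ge 0$ with $\sup_{x\in K}|\partial^\alpha u_\varepsilon(x)|=O(\varepsilon^{-p})$ as $\varepsilon\to 0$. It is null, $(u_\varepsilon)\in\mathcal{N}(\Omega)$, if for every compact $K\subset\Omega$, every $\alpha\in\mathbb{N}_0^n$ and every $q\ge 0$, $\sup_{x\in K}|\partial^\alpha u_\varepsilon(x)|=O(\varepsilon^{q})$ as $\varepsilon\to0$. Put $\mathcal{G}(\Omega)=\mathcal{E}_{\mathrm M}(\Omega)/\mathcal{N}(\Omega)$. Derivatives are defined on representatives. For $u\in\mathcal{G}(\mathbb{R}^2)$ with representative $(u_\varepsilon)$, the restriction $u|_{\{t=0\}}\in\mathcal{G}(\mathbb{R})$ is the class of $(u_\varepsilon(\cdot,0))_\varepsilon$. If $f$ is smooth and $f$ and all its derivatives are of at most polynomial growth at infinity, $f(u)$ is the (well-defined) class of $(f(u_\varepsilon))_\varepsilon$.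 Sharp topology: for compact $K\subset\Omega$, $m\in\mathbb{N}_0$ and $p\ge0$, let $V(K,m,p)\subset\mathcal{G}(\Omega)$ be the set of $u\in\mathcal{G}(\Omega)$ having a representative $(u_\varepsilon)$ with $\sup_{x\in K}\sup_{|\alpha|\le m}|\partial^\alpha u_\varepsilon(x)|=O(\varepsilon^{p})$ as $\varepsilon\to0$. The sets $V(K,m,p)$ form a base of neighborhoods of zero for a translation-invariant topology on $\mathcal{G}(\Omega)$, the sharp topology, which makes it a topological ring. *)

(* Defs.v *)
From HB Require Import structures.
From mathcomp Require Import all_boot all_order all_algebra.
From mathcomp Require Import generic_quotient ring_quotient complex.
From mathcomp Require Import all_classical all_reals all_analysis.

Set Implicit Arguments.
Unset Strict Implicit.
Unset Printing Implicit Defensive.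

Import Order.TTheory GRing.Theory Num.Theory.
Import numFieldNormedType.Exports.

Local Open Scope classical_set_scope.
Local Open Scope ring_scope.
Local Open Scope quotient_scope.

Section RcomplexNormed.
Variable R : realType.

Lemma Rcomplex_normrZ (l : R) (z : Rcomplex R) : `|l *: z| = `|l| * `|z|.
Proof.
case: z => a b; rewrite /Num.norm /= /Normc.normc /=.
by rewrite !exprMn -mulrDr sqrtrM ?sqr_ge0// sqrtr_sqr.
Qed.

HB.instance Definition _ :=
  PseudoMetric.copy (Rcomplex R) (pseudoMetric_normed (Rcomplex R)).
HB.instance Definition _ := isPointed.Build (Rcomplex R) 0.
HB.instance Definition _ :=
  NormedZmod_PseudoMetric_eq.Build R (Rcomplex R) erefl.
HB.instance Definition _ :=
  PseudoMetricNormedZmod_Lmodule_isNormedModule.Build R (Rcomplex R)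
    Rcomplex_normrZ.

End RcomplexNormed.

Variant scalars := RealScalars | ComplexScalars.

(* C is [Rcomplex R], i.e. [R[i]] as a real vector space normed by the modulus,
   so that derivatives of functions on or into C are real ones. *)
Definition scalar_field (R : realType) (k : scalars) : normedModType R :=
  match k with RealScalars => R | ComplexScalars => Rcomplex R end.

Section SmoothFunctions.
Context {R : realType}.
Implicit Types V W : normedModType R.

Definition iter_derive V W (s : seq V) (f : V -> W) : V -> W :=
  foldr (fun v g => 'D_v g) f s.

(* On a finite-dimensional [V] this is membership in C^oo(V, W). *)
Definition smooth V W (f : V -> W) : Prop :=
  forall (s : seq V) (x : V), differentiable (iter_derive s f) x.

(* [f] and all its derivatives are of at most polynomial growth. *)
Definition tempered V W (f : V -> W) : Prop :=
  smooth f /\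
  forall s : seq V, exists (N : nat) (C : R),
    forall z, `|iter_derive s f z| <= C * (1 + `|z|) ^+ N.

(* A word [s] of coordinate indices stands for the multi-index counting its
   letters, of order [size s]; for smooth [f] the order of the letters is
   irrelevant. *)
Definition coord_derive n V (s : seq 'I_n) (f : 'rV[R]_n -> V) :=
  iter_derive [seq delta_mx 0 i | i <- s] f.

End SmoothFunctions.

Section Theory.
Context {R : realType}.
Implicit Types U V W : normedModType R.

Lemma iter_derive_rcons V W (s : seq V) v (f : V -> W) :
  iter_derive (rcons s v) f = iter_derive s ('D_v f).
Proof. by rewrite /iter_derive foldr_rcons. Qed.

Lemma coord_derive_rcons n V (s : seq 'I_n) i (f : 'rV[R]_n -> V) :
  coord_derive (rcons s i) f = coord_derive s ('D_(delta_mx 0 i) f).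
Proof. by rewrite /coord_derive map_rcons iter_derive_rcons. Qed.

Lemma smooth_differentiable V W (f : V -> W) x : smooth f -> differentiable f x.
Proof. by move=> /(_ [::]). Qed.

Lemma smooth_derivable V W (f : V -> W) x v : smooth f -> derivable f x v.
Proof. by move=> sf; apply/diff_derivable/smooth_differentiable. Qed.

Lemma smooth_derive V W (f : V -> W) v : smooth f -> smooth ('D_v f).
Proof. by move=> sf s x; rewrite -iter_derive_rcons. Qed.

Lemma smoothP V W (f : V -> W) :
  (forall x, differentiable f x) -> (forall v, smooth ('D_v f)) -> smooth f.
Proof.
move=> f0 f1; elim/last_ind=> [|s v _] x; first exact: f0.
by rewrite iter_derive_rcons; exact: f1.
Qed.

Definition smoothn V W k (f : V -> W) := forall (s : seq V) (x : V),
  (size s <= k)%N -> differentiable (iter_derive s f) x.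

Lemma smoothnP V W (f : V -> W) : smooth f <-> forall k, smoothn k f.
Proof.
split=> [sf k s x _|sf s x]; first exact: sf.
exact: (sf (size s)).
Qed.

Lemma smoothn0 V W (f : V -> W) :
  smoothn 0 f <-> forall x, differentiable f x.
Proof.
split=> [sf x|sf [|//] x _]; last exact: sf.
exact: (sf [::]).
Qed.

Lemma smoothnS V W k (f : V -> W) :
  smoothn k.+1 f <->
  (forall x, differentiable f x) /\ (forall v, smoothn k ('D_v f)).
Proof.
split=> [sf|[f0 f1]].
  split=> [x|v s x sk]; first exact: (sf [::]).
  by rewrite -iter_derive_rcons; apply: sf; rewrite size_rcons.
move=> s x; case/lastP: s => [_|s v]; first exact: f0.
by rewrite size_rcons ltnS => sk; rewrite iter_derive_rcons; exact: f1.
Qed.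

Lemma smoothn_diff V W k (f : V -> W) x : smoothn k f -> differentiable f x.
Proof. by move=> /(_ [::] x); exact. Qed.

Lemma smoothnW V W k (f : V -> W) : smoothn k.+1 f -> smoothn k f.
Proof. by move=> sf s x sk; apply: sf; rewrite (leq_trans sk). Qed.

Lemma deriveDE V W (f g : V -> W) v : (forall x, differentiable f x) ->
  (forall x, differentiable g x) -> 'D_v (f + g) = 'D_v f + 'D_v g.
Proof.
move=> df dg; apply/funext => x; rewrite deriveD//; exact: diff_derivable.
Qed.

Lemma deriveNE V W (f : V -> W) v : (forall x, differentiable f x) ->
  'D_v (- f) = - 'D_v f.
Proof.
by move=> df; apply/funext => x; rewrite deriveN//; exact: diff_derivable.
Qed.

Lemma smoothnD V W k (f g : V -> W) :
  smoothn k f -> smoothn k g -> smoothn k (f + g).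
Proof.
elim: k f g => [|k IH] f g.
  by move=> /smoothn0 sf /smoothn0 sg; apply/smoothn0 => x; exact: differentiableD.
move=> /smoothnS[f0 f1] /smoothnS[g0 g1]; apply/smoothnS; split=> [x|v].
  exact: differentiableD.
by rewrite deriveDE//; exact: IH.
Qed.

Lemma smoothnN V W k (f : V -> W) : smoothn k f -> smoothn k (- f).
Proof.
elim: k f => [|k IH] f.
  by move=> /smoothn0 sf; apply/smoothn0 => x; exact: differentiableN.
move=> /smoothnS[f0 f1]; apply/smoothnS; split=> [x|v].
  exact: differentiableN.
by rewrite deriveNE//; exact: IH.
Qed.

Lemma smoothn_cst V W k (w : W) : smoothn k (cst w : V -> W).
Proof.
elim: k w => [|k IH] w.
  by apply/smoothn0 => x; exact: differentiable_cst.
apply/smoothnS; split=> [x|v]; first exact: differentiable_cst.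
suff -> : 'D_v (cst w : V -> W) = cst 0 by exact: IH.
by apply/funext => x; rewrite derive_cst.
Qed.

Lemma smooth0 V W : smooth (0 : V -> W).
Proof. by apply/smoothnP => k; exact: (smoothn_cst (0 : W)). Qed.

Lemma smoothB V W (f g : V -> W) : smooth f -> smooth g -> smooth (f - g).
Proof.
move=> /smoothnP sf /smoothnP sg; apply/smoothnP => k; apply: smoothnD => //.
exact: smoothnN.
Qed.

Lemma iter_deriveD V W (s : seq V) (f g : V -> W) : smooth f -> smooth g ->
  iter_derive s (f + g) = iter_derive s f + iter_derive s g.
Proof.
elim/last_ind: s f g => [//|s v IH] f g sf sg.
rewrite !iter_derive_rcons -IH ?deriveDE//; try exact: smooth_derive.
- by move=> x; exact: smooth_differentiable.
- by move=> x; exact: smooth_differentiable.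
Qed.

Lemma iter_deriveN V W (s : seq V) (f : V -> W) : smooth f ->
  iter_derive s (- f) = - iter_derive s f.
Proof.
elim/last_ind: s f => [//|s v IH] f sf.
rewrite !iter_derive_rcons -IH ?deriveNE//; last exact: smooth_derive.
by move=> x; exact: smooth_differentiable.
Qed.

Lemma iter_deriveB V W (s : seq V) (f g : V -> W) : smooth f -> smooth g ->
  iter_derive s (f - g) = iter_derive s f - iter_derive s g.
Proof.
move=> sf sg; rewrite iter_deriveD// ?iter_deriveN//.
by move/smoothnP : sg => sg; apply/smoothnP => k; apply: smoothnN; exact: sg.
Qed.

Lemma iter_derive0 V W (s : seq V) : iter_derive s (0 : V -> W) = 0.
Proof.
elim: s => [//|v s /= ->]; apply/funext => x.
by rewrite (_ : 0 = cst 0)// derive_cst.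
Qed.

Lemma scale_is_bilinear W :
  bilinear_for
    (GRing.Scale.Law.clone _ _ *:%R _) (GRing.Scale.Law.clone _ _ *:%R _)
    (fun (a : R) (w : W) => a *: w).
Proof.
split=> [w a b c|a b w c] /=; first by rewrite scalerDl scalerA.
by rewrite scalerDr !scalerA mulrC.
Qed.

Lemma is_diffZ_fun V W (a : V -> R) (f : V -> W) x :
  differentiable a x -> differentiable f x ->
  differentiable (fun y => a y *: f y) x /\
  forall v, 'D_v (fun y => a y *: f y) x = 'D_v a x *: f x + a x *: 'D_v f x.
Proof.
move=> da df.
pose bM := bilinear_isBilinear.Build R R W W _ _ _ (scale_is_bilinear W).
pose b : {bilinear R -> W -> W} := HB.pack (fun (c : R) (w : W) => c *: w) bM.
have bc : continuous (fun p : R * W => b p.1 p.2).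
  by move=> p; exact: scale_continuous.
have dp := differentiable_pair da df.
have db := differentiable_bilin (a x, f x) bc.
have d : differentiable (fun y => a y *: f y) x.
  exact: (@differentiable_comp _ _ _ _ (fun y => (a y, f y))
            (fun p => b p.1 p.2) x dp db).
split=> // v; rewrite !deriveE//.
have -> : (fun y => a y *: f y) = (fun p => b p.1 p.2) \o (fun y => (a y, f y)) by [].
rewrite diff_comp//.
have E1 := diff_bilin (a x, f x) bc.
have E2 := diff_pair da df.
rewrite -[LHS]/('d (fun p => b p.1 p.2) (a x, f x) ('d (fun y => (a y, f y)) x v)).
by rewrite E1 E2 /= addrC.
Qed.


Lemma smoothnZ V W k (a : V -> R) (f : V -> W) :
  smoothn k a -> smoothn k f -> smoothn k (fun x => a x *: f x).
Proof.
elim: k a f => [|k IH] a f.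
  move=> /smoothn0 sa /smoothn0 sf; apply/smoothn0 => x.
  by have [] := is_diffZ_fun (sa x) (sf x).
move=> sa sf; have [a0 a1] := (smoothnS k a).1 sa.
have [f0 f1] := (smoothnS k f).1 sf; apply/smoothnS; split=> [x|v].
  by have [] := is_diffZ_fun (a0 x) (f0 x).
have -> : 'D_v (fun x => a x *: f x) =
    (fun x => 'D_v a x *: f x) + (fun x => a x *: 'D_v f x).
  by apply/funext => x; have [_ ->] := is_diffZ_fun (a0 x) (f0 x).
by apply: smoothnD; apply: IH => //; exact: smoothnW.
Qed.

Lemma smoothn_sum V W k m (f : 'I_m -> V -> W) :
  (forall i, smoothn k (f i)) -> smoothn k (\sum_i f i).
Proof.
move=> sf; elim/big_ind: _ => //; first exact: (smoothn_cst (0 : W)).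
exact: smoothnD.
Qed.

Lemma deriveLin U V W (c : {linear V -> W}) (f : U -> V) x v :
  continuous c -> differentiable f x ->
  differentiable (c \o f) x /\ 'D_v (c \o f) x = c ('D_v f x).
Proof.
move=> cc df; have dc := linear_differentiable (f x) cc.
have d := differentiable_comp df dc; split=> //.
by rewrite !deriveE// diff_comp//= (diff_lin _ cc).
Qed.

Lemma smoothn_lin U V W k (c : {linear V -> W}) (f : U -> V) :
  continuous c -> smoothn k f -> smoothn k (c \o f).
Proof.
move=> cc; elim: k f => [|k IH] f.
  by move=> /smoothn0 sf; apply/smoothn0 => x; have [] := deriveLin 0 cc (sf x).
move=> /smoothnS[f0 f1]; apply/smoothnS; split=> [x|v].
  by have [] := deriveLin 0 cc (f0 x).
suff -> : 'D_v (c \o f) = c \o 'D_v f by exact: IH.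
by apply/funext => x; have [] := deriveLin v cc (f0 x).
Qed.

Definition coordinates V m (b : 'I_m -> V) (c : 'I_m -> {linear V -> R}) :=
  (forall i, continuous (c i)) /\ (forall z, z = \sum_i c i z *: b i).

Lemma chain_rule U V W m (b : 'I_m -> V) (c : 'I_m -> {linear V -> R})
    (g : V -> W) (f : U -> V) x v :
  coordinates b c -> differentiable f x -> differentiable g (f x) ->
  'D_v (g \o f) x = \sum_i c i ('D_v f x) *: 'D_(b i) g (f x).
Proof.
move=> [cc ce] df dg; rewrite deriveE; last exact: differentiable_comp.
rewrite diff_comp//= -(deriveE v df) [in LHS](ce ('D_v f x)) linear_sum.
by apply: eq_bigr => i _; rewrite linearZ/= -deriveE.
Qed.

Lemma smoothn_comp U V W m (b : 'I_m -> V) (c : 'I_m -> {linear V -> R})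
    k (g : V -> W) (f : U -> V) :
  coordinates b c -> smooth g -> smoothn k f -> smoothn k (g \o f).
Proof.
move=> bc; elim: k g f => [|k IH] g f sg.
  move=> /smoothn0 sf; apply/smoothn0 => x.
  by apply: differentiable_comp => //; exact: smooth_differentiable.
move=> sf; have [f0 f1] := (smoothnS k f).1 sf; apply/smoothnS; split=> [x|v].
  by apply: differentiable_comp => //; exact: smooth_differentiable.
have -> : 'D_v (g \o f) =
    \sum_i (fun x => (c i \o 'D_v f) x *: ('D_(b i) g \o f) x).
  apply/funext => x; rewrite fct_sumE (chain_rule v bc)//.
  exact: smooth_differentiable.
apply: smoothn_sum => i; apply: smoothnZ.
  by apply: smoothn_lin => //; exact: (proj1 bc).
by apply: IH; [exact: smooth_derive|exact: smoothnW].
Qed.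

Lemma smooth_comp U V W m (b : 'I_m -> V) (c : 'I_m -> {linear V -> R})
    (g : V -> W) (f : U -> V) :
  coordinates b c -> smooth g -> smooth f -> smooth (g \o f).
Proof.
move=> bc sg /smoothnP sf; apply/smoothnP => k.
by apply: smoothn_comp bc _ _.
Qed.

End Theory.

(* The parameter set (0, 1]. *)
Definition eps01 (R : realType) := {e : R | 0 < e <= 1}.

Section Nets.
Context {R : realType}.
Implicit Types U V W : normedModType R.

(* sup_{x in A} |u_e(x)| = O(e^q) as e -> 0 *)
Definition sup_bigO V W (A : set V) (u : eps01 R -> V -> W) (q : R) : Prop :=
  exists C eta : R, 0 < eta /\
    forall e : eps01 R, val e < eta -> forall x, A x -> `|u e x| <= C * val e `^ q.

Lemma eps01_gt0 (e : eps01 R) : 0 < val e.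
Proof. by case/andP: (valP e). Qed.

Lemma eps01_le1 (e : eps01 R) : val e <= 1.
Proof. by case/andP: (valP e). Qed.

Lemma eps01_powR_ge0 (e : eps01 R) q : 0 <= val e `^ q.
Proof. exact: powR_ge0. Qed.

Lemma eps01_powR_le (e : eps01 R) p q : q <= p -> val e `^ p <= val e `^ q.
Proof. by move=> qp; have := ger_powR (valP e) qp. Qed.

Lemma eps01_powRD (e : eps01 R) p q : val e `^ (p + q) = val e `^ p * val e `^ q.
Proof. by rewrite powRD ?(gt_eqF (eps01_gt0 e)) ?implybT. Qed.

Lemma sup_bigO_ge0 V W (A : set V) (u : eps01 R -> V -> W) q :
  sup_bigO A u q -> exists C eta : R, [/\ 0 <= C, 0 < eta &
    forall e : eps01 R, val e < eta -> forall x, A x ->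
      `|u e x| <= C * val e `^ q].
Proof.
move=> [C [eta [eta0 H]]]; exists `|C|, eta; split=> // e ee x Ax.
by rewrite (le_trans (H e ee x Ax))// ler_wpM2r ?eps01_powR_ge0// ler_norm.
Qed.

Lemma sup_bigOW V W (A : set V) (u : eps01 R -> V -> W) p q :
  q <= p -> sup_bigO A u p -> sup_bigO A u q.
Proof.
move=> qp /sup_bigO_ge0[C [eta [C0 eta0 H]]]; exists C, eta; split=> // e ee x Ax.
by rewrite (le_trans (H e ee x Ax))// ler_wpM2l// eps01_powR_le.
Qed.

Lemma sup_bigO_sub V W (A B : set V) (u : eps01 R -> V -> W) q :
  B `<=` A -> sup_bigO A u q -> sup_bigO B u q.
Proof.
move=> BA [C [eta [eta0 H]]]; exists C, eta; split=> // e ee x Bx.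
by apply: H => //; exact: BA.
Qed.

Lemma sup_bigO0 V W (A : set V) q : sup_bigO A (fun=> 0 : V -> W) q.
Proof. by exists 0, 1; split=> // e _ x _; rewrite normr0 mul0r. Qed.

Lemma sup_bigOD V W (A : set V) (u v : eps01 R -> V -> W) q :
  sup_bigO A u q -> sup_bigO A v q -> sup_bigO A (fun e => u e + v e) q.
Proof.
move=> [C [eta [eta0 H]]] [C' [eta' [eta0' H']]].
exists (C + C'), (Num.min eta eta'); split=> [|e]; first by rewrite lt_min eta0.
rewrite lt_min => /andP[e1 e2] x Ax; rewrite mulrDl (le_trans (ler_normD _ _))//.
by rewrite lerD ?H ?H'.
Qed.

Lemma sup_bigON V W (A : set V) (u : eps01 R -> V -> W) q :
  sup_bigO A u q -> sup_bigO A (fun e => - u e) q.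
Proof.
move=> [C [eta [eta0 H]]]; exists C, eta; split=> // e ee x Ax.
by rewrite normrN; exact: H.
Qed.

Lemma sup_bigOZ V W (A : set V) (a : eps01 R -> V -> R) (u : eps01 R -> V -> W) p q :
  sup_bigO A a p -> sup_bigO A u q ->
  sup_bigO A (fun e x => a e x *: u e x) (p + q).
Proof.
move=> /sup_bigO_ge0[C [eta [C0 eta0 H]]] /sup_bigO_ge0[C' [eta' [C0' eta0' H']]].
exists (C * C'), (Num.min eta eta'); split=> [|e]; first by rewrite lt_min eta0.
rewrite lt_min => /andP[e1 e2] x Ax; rewrite eps01_powRD mulrACA normrZ.
by rewrite ler_pM ?H ?H'.
Qed.

Lemma sup_bigO_lin V W U (A : set V) (c : {linear W -> U})
    (u : eps01 R -> V -> W) q : continuous c ->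
  sup_bigO A u q -> sup_bigO A (fun e => c \o u e) q.
Proof.
move=> cc /sup_bigO_ge0[C [eta [C0 eta0 H]]].
have [k k0 Hk] : exists2 k, 0 < k & forall x, `|c x| <= k * `|x|.
  by apply: linear_lipschitz; exact: cc.
exists (k * C), eta; split=> // e ee x Ax /=; rewrite (le_trans (Hk _))//.
by rewrite -mulrA ler_wpM2l ?(ltW k0)// H.
Qed.

Definition mod0 V W (u : eps01 R -> V -> W) := forall A, compact A ->
  exists2 p : R, 0 <= p & sup_bigO A u (- p).
Definition null0 V W (u : eps01 R -> V -> W) := forall A, compact A ->
  forall q : R, 0 <= q -> sup_bigO A u q.

Definition additive_class V W (Q : (eps01 R -> V -> W) -> Prop) :=
  Q (fun=> 0) /\ forall u v, Q u -> Q v -> Q (fun e => u e + v e).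

Lemma mod0_add V W : additive_class (@mod0 V W).
Proof.
split=> [A cA|u v mu mv A cA]; first by exists 0 => //; exact: sup_bigO0.
have [p p0 up] := mu A cA; have [q q0 vq] := mv A cA.
exists (Num.max p q); first by rewrite le_max p0.
apply: sup_bigOD; [apply: sup_bigOW up|apply: sup_bigOW vq];
  by rewrite lerN2 le_max lexx ?orbT.
Qed.

Lemma null0_add V W : additive_class (@null0 V W).
Proof.
split=> [A cA q q0|u v mu mv A cA q q0]; first exact: sup_bigO0.
by apply: sup_bigOD; [exact: mu|exact: mv].
Qed.

Lemma mod0Z V W (a : eps01 R -> V -> R) (u : eps01 R -> V -> W) :
  mod0 a -> mod0 u -> mod0 (fun e x => a e x *: u e x).
Proof.
move=> ma mu A cA; have [p p0 ap] := ma A cA; have [q q0 uq] := mu A cA.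
by exists (p + q); [exact: addr_ge0|rewrite opprD; exact: sup_bigOZ].
Qed.

Lemma mod0_null0Z V W (a : eps01 R -> V -> R) (u : eps01 R -> V -> W) :
  mod0 a -> null0 u -> null0 (fun e x => a e x *: u e x).
Proof.
move=> ma mu A cA q q0; have [p p0 ap] := ma A cA.
have -> : q = - p + (p + q) by rewrite addKr.
by apply: sup_bigOZ => //; apply: mu => //; exact: addr_ge0.
Qed.

Lemma null0_mod0Z V W (a : eps01 R -> V -> R) (u : eps01 R -> V -> W) :
  null0 a -> mod0 u -> null0 (fun e x => a e x *: u e x).
Proof.
move=> ma mu A cA q q0; have [p p0 ap] := mu A cA.
have -> : q = (p + q) + - p by rewrite addrAC subrr add0r.
by apply: sup_bigOZ => //; apply: ma => //; exact: addr_ge0.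
Qed.

Lemma mod0_lin V W U (c : {linear W -> U}) (u : eps01 R -> V -> W) :
  continuous c -> mod0 u -> mod0 (fun e => c \o u e).
Proof.
by move=> cc mu A cA; have [p p0 up] := mu A cA; exists p => //; exact: sup_bigO_lin.
Qed.

Lemma null0_lin V W U (c : {linear W -> U}) (u : eps01 R -> V -> W) :
  continuous c -> null0 u -> null0 (fun e => c \o u e).
Proof. by move=> cc mu A cA q q0; apply: sup_bigO_lin => //; exact: mu. Qed.

Section Orders.
Variable n : nat.
Local Notation net W := (eps01 R -> 'rV[R]_n -> W).

Definition upto k W (Q : net W -> Prop) (u : net W) := forall s : seq 'I_n,
  (size s <= k)%N -> Q (fun e => coord_derive s (u e)).

Lemma uptoS k W (Q : net W -> Prop) u : upto k.+1 Q u <->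
  Q u /\ forall i, upto k Q (fun e => 'D_(delta_mx 0 i) (u e)).
Proof.
split=> [H|[H0 H1] s].
  split=> [|i s sk]; first exact: (H [::]).
  have := H (rcons s i); rewrite size_rcons => /(_ sk).
  by under eq_fun do rewrite coord_derive_rcons.
case/lastP: s => [_|s i]; first exact: H0.
rewrite size_rcons ltnS => sk; under eq_fun do rewrite coord_derive_rcons.
exact: H1.
Qed.

Lemma uptoW k W (Q : net W -> Prop) u : upto k.+1 Q u -> upto k Q u.
Proof. by move=> H s sk; apply: H; rewrite (leq_trans sk). Qed.

Lemma upto0 k W (Q : net W -> Prop) u : upto k Q u -> Q u.
Proof. by move=> /(_ [::]); exact. Qed.

Lemma uptoD k W (Q : net W -> Prop) u v : additive_class Q ->
  (forall e, smooth (u e)) -> (forall e, smooth (v e)) ->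
  upto k Q u -> upto k Q v -> upto k Q (fun e => u e + v e).
Proof.
move=> [_ QD] su sv uu uv s sk.
under eq_fun do rewrite /coord_derive iter_deriveD//.
by apply: QD; [exact: uu|exact: uv].
Qed.

Lemma upto_sum k W (Q : net W -> Prop) m (u : 'I_m -> net W) :
  additive_class Q -> (forall i e, smooth (u i e)) ->
  (forall i, upto k Q (u i)) ->
  (forall e, smooth ((\sum_i u i) e)) /\ upto k Q (\sum_i u i).
Proof.
move=> QA su uu.
elim/big_ind: _ => [|f g [sf uf] [sg ug]|i _].
- split=> [e|s sk]; first exact: smooth0.
  rewrite /coord_derive; under eq_fun do rewrite iter_derive0.
  exact: (proj1 QA).
- split=> [e|]; last exact: uptoD.
  move: (sf e) (sg e) => /smoothnP sfe /smoothnP sge.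
  by apply/smoothnP => j; exact: smoothnD.
- by split=> [e|]; [exact: su|exact: uu].
Qed.

Lemma uptoZ k W (Qa : net R -> Prop) (Q Q' : net W -> Prop) a u :
  additive_class Q' -> (forall a u, Qa a -> Q u -> Q' (fun e x => a e x *: u e x)) ->
  (forall e, smooth (a e)) -> (forall e, smooth (u e)) ->
  upto k Qa a -> upto k Q u -> upto k Q' (fun e x => a e x *: u e x).
Proof.
move=> QA QM; elim: k a u => [|k IH] a u sa su ua uu.
  by case=> // _; apply: QM; [exact: (ua [::])|exact: (uu [::])].
have [a0 a1] := (uptoS k Qa a).1 ua; have [u0 u1] := (uptoS k Q u).1 uu.
apply/uptoS; split=> [|i]; first exact: QM.
have -> : (fun e => 'D_(delta_mx 0 i) (fun x => a e x *: u e x)) =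
    (fun e => (fun x => 'D_(delta_mx 0 i) (a e) x *: u e x) +
              (fun x => a e x *: 'D_(delta_mx 0 i) (u e) x)).
  apply/funext => e; apply/funext => x.
  by have [_ ->] := is_diffZ_fun (smooth_differentiable x (sa e))
    (smooth_differentiable x (su e)).
have sZ (b : net R) (v : net W) : (forall e, smooth (b e)) ->
    (forall e, smooth (v e)) -> forall e, smooth (fun x => b e x *: v e x).
  move=> sb sv e; apply/smoothnP => j.
  by move: (sb e) (sv e) => /smoothnP sbe /smoothnP sve; exact: smoothnZ.
apply: uptoD => //.
- by apply: sZ => // e; exact: smooth_derive.
- by apply: sZ => // e; exact: smooth_derive.
- by apply: IH => //; [move=> e; exact: smooth_derive|exact: uptoW].
- by apply: IH => //; [move=> e; exact: smooth_derive|exact: uptoW].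
Qed.

Lemma upto_lin k W U (Q : net W -> Prop) (Q' : net U -> Prop)
    (c : {linear W -> U}) u : continuous c ->
  (forall u, Q u -> Q' (fun e => c \o u e)) ->
  (forall e, smooth (u e)) -> upto k Q u -> upto k Q' (fun e => c \o u e).
Proof.
move=> cc QQ; elim: k u => [|k IH] u su uu.
  by case=> // _; apply: QQ; exact: (uu [::]).
have [u0 u1] := (uptoS k Q u).1 uu; apply/uptoS; split=> [|i]; first exact: QQ.
have -> : (fun e => 'D_(delta_mx 0 i) (c \o u e)) =
    (fun e => c \o 'D_(delta_mx 0 i) (u e)).
  apply/funext => e; apply/funext => x.
  by have [_ ->] := deriveLin (delta_mx 0 i) cc (smooth_differentiable x (su e)).
by apply: IH => // e; exact: smooth_derive.
Qed.

End Orders.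
End Nets.

Section Superposition.
Context {R : realType}.
Implicit Types U V W : normedModType R.

Lemma tempered_smooth V W (g : V -> W) : tempered g -> smooth g.
Proof. by case. Qed.

Lemma tempered_bound V W (g : V -> W) : tempered g ->
  exists (N : nat) (C : R), forall z, `|g z| <= C * (1 + `|z|) ^+ N.
Proof. by move=> [_ /(_ [::])]. Qed.

Lemma tempered_derive V W (g : V -> W) v : tempered g -> tempered ('D_v g).
Proof.
move=> [sg bg]; split=> [|s]; first exact: smooth_derive.
by rewrite -iter_derive_rcons; exact: bg.
Qed.

Lemma mod0_le U V W (u : eps01 R -> V -> W) (v : eps01 R -> V -> U) :
  (forall e x, `|v e x| <= `|u e x|) -> mod0 u -> mod0 v.
Proof.
move=> vu mu A cA; have [p p0 [C [eta [eta0 H]]]] := mu A cA.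
exists p => //; exists C, eta; split=> // e ee x Ax.
exact: le_trans (vu e x) (H e ee x Ax).
Qed.

Lemma null0_le U V W (u : eps01 R -> V -> W) (v : eps01 R -> V -> U) :
  (forall e x, `|v e x| <= `|u e x|) -> null0 u -> null0 v.
Proof.
move=> vu mu A cA q q0; have [C [eta [eta0 H]]] := mu A cA q q0.
exists C, eta; split=> // e ee x Ax.
exact: le_trans (vu e x) (H e ee x Ax).
Qed.

Lemma mod0_comp U V W (g : V -> W) (u : eps01 R -> U -> V) N (C : R) :
  (forall z, `|g z| <= C * (1 + `|z|) ^+ N) ->
  mod0 u -> mod0 (fun e => g \o u e).
Proof.
move=> gC mu A cA; have [p p0 /sup_bigO_ge0[C' [eta [C'0 eta0 H]]]] := mu A cA.
exists (p * N%:R); first by rewrite mulr_ge0.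
exists (`|C| * (1 + C') ^+ N), eta; split=> // e ee x Ax /=.
rewrite (le_trans (gC _))// -mulrA.
apply: (@le_trans _ _ (`|C| * (1 + `|u e x|) ^+ N)).
  by rewrite ler_wpM2r ?ler_norm// exprn_ge0// addr_ge0.
rewrite ler_wpM2l// -mulNr powRrM powR_mulrn ?powR_ge0// -exprMn.
rewrite lerXn2r ?nnegrE ?mulr_ge0 ?addr_ge0 ?powR_ge0//.
rewrite mulrDl mul1r lerD ?H//.
by rewrite -[leLHS](powRr0 (val e)) eps01_powR_le// oppr_le0.
Qed.

Section Coordinates.
Variables (K : normedModType R) (m : nat).
Variables (b : 'I_m -> K) (c : 'I_m -> {linear K -> R}).
Hypothesis bc : coordinates b c.

Lemma tempered_derive_bound W (g : K -> W) : tempered g ->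
  exists (N : nat) (C : R), 0 <= C /\
    forall y v, `|'D_v g y| <= C * (1 + `|y|) ^+ N * `|v|.
Proof.
move=> tg; have [cc ce] := bc.
have /choice[M HM] : forall i : 'I_m, exists k, 0 < k /\ forall x, `|c i x| <= k * `|x|.
  by move=> i; have [k k0 kP] := linear_lipschitz (cc i); exists k.
have /choice[NC HNC] : forall i : 'I_m, exists NC : nat * R,
    forall z, `|'D_(b i) g z| <= NC.2 * (1 + `|z|) ^+ NC.1.
  move=> i; have [N [C HC]] := tempered_bound (tempered_derive (b i) tg).
  by exists (N, C).
exists (\sum_i (NC i).1)%N, (\sum_i M i * `|(NC i).2|); split.
  by apply: sumr_ge0 => i _; rewrite mulr_ge0// ltW// (HM i).1.
move=> y v; have dg := smooth_differentiable y (tempered_smooth tg).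
rewrite deriveE// [v in 'd g y v]ce linear_sum.
rewrite (le_trans (ler_norm_sum _ _ _))// -mulrA mulr_suml.
apply: ler_sum => i _; rewrite linearZ normrZ -deriveE//.
rewrite [leRHS](_ : _ = (M i * `|v|) *
  (`|(NC i).2| * (1 + `|y|) ^+ (\sum_i (NC i).1)%N)); last first.
  by rewrite [_ * `|v|]mulrC mulrACA.
rewrite ler_pM ?(HM i).2//; apply: (le_trans (HNC i y)).
rewrite (le_trans (ler_wpM2r _ (ler_norm _))) ?exprn_ge0 ?addr_ge0//.
rewrite ler_wpM2l// ler_weXn2l ?lerDl// (bigD1 i)//= leq_addr//.
Qed.

Lemma tempered_increment (g : K -> K) : tempered g ->
  exists (N : nat) (C : R), forall z w,
    `|g z - g w| <= C * (1 + (`|z| + `|w|)) ^+ N * `|z - w|.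
Proof.
move=> tg; have [N [C [C0 HC]]] := tempered_derive_bound tg.
have [cc ce] := bc.
have /choice[M HM] : forall i : 'I_m, exists k, 0 < k /\ forall x, `|c i x| <= k * `|x|.
  by move=> i; have [k k0 kP] := linear_lipschitz (cc i); exists k.
exists N, ((\sum_i M i * `|b i|) * C) => z w.
rewrite [g z - g w]ce (le_trans (ler_norm_sum _ _ _))// -!mulrA mulr_suml.
apply: ler_sum => i _; rewrite normrZ -mulrA [leRHS]mulrCA mulrC ler_wpM2l//.
pose l (t : R) : K := w + t *: (z - w).
pose phi (t : R) : R := c i (g (l t)).
have dphi t : @is_derive R R R t 1 phi (c i ('D_(z - w) g (l t))).
  have dg := smooth_differentiable (l t) (tempered_smooth tg).
  have [dG <-] := deriveLin (z - w) (cc i) dg.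
  have E : (fun h : R => h^-1 *: ((phi \o shift t) (h *: (1 : R)) - phi t)) =
     (fun h : R => h^-1 *: (((c i \o g) \o shift (l t)) (h *: (z - w)) - (c i \o g) (l t))).
    apply/funext => h; rewrite /phi /l /=; congr (_ *: (c i (g _) - _)).
    by rewrite -[h *: 1]/(h * 1) mulr1 scalerDl addrCA.
  split; first by rewrite /derivable E; exact: diff_derivable.
  by rewrite /derive E.
have [t /[!in_itv]/= /andP[t0 t1]] : exists2 t, t \in `[0, 1]%R &
    phi 1 - phi 0 = c i ('D_(z - w) g (l t)) * (1 - 0).
  apply: MVT_segment => //; apply: continuous_subspaceT => t.
  by apply/differentiable_continuous/derivable1_diffP; have [] := dphi t.
have l1 : l 1 = z by rewrite /l scale1r addrC subrK.
have l0 : l 0 = w by rewrite /l scale0r addr0.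
rewrite subr0 mulr1 /phi l1 l0 -linearB => ->.
rewrite (le_trans ((HM i).2 _))// ler_wpM2l ?(ltW (HM i).1)//.
rewrite (le_trans (HC _ _))// -mulrA ler_wpM2l// ler_wpM2r//.
rewrite lerXn2r ?nnegrE ?addr_ge0// lerD2l.
rewrite (_ : l t = (1 - t) *: w + t *: z); last first.
  by rewrite /l scalerBr scalerBl scale1r addrA addrAC.
rewrite (le_trans (ler_normD _ _))// !normrZ addrC lerD//.
  by rewrite ger0_norm// ler_piMl.
by rewrite ger0_norm ?subr_ge0// ler_piMl// gerBl.
Qed.

Lemma null0_compB U (g : K -> K) (u v : eps01 R -> U -> K) : tempered g ->
  mod0 u -> mod0 v -> null0 (fun e => u e - v e) ->
  null0 (fun e => (g \o u e) - (g \o v e)).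
Proof.
move=> tg mu mv nuv; have [N [C HC]] := tempered_increment tg.
pose r (e : eps01 R) (x : U) : R := `|u e x| + `|v e x|.
have mr : mod0 r.
  apply: (proj2 (@mod0_add R U R) (fun e x => `|u e x|) (fun e x => `|v e x|)).
    by apply: mod0_le mu => e x; rewrite normr_id.
  by apply: mod0_le mv => e x; rewrite normr_id.
have ma : mod0 (fun e => (fun t : R => C * (1 + t) ^+ N) \o r e).
  apply: (@mod0_comp _ _ _ _ _ N `|C|) mr => t.
  rewrite normrM ler_wpM2l// normrX lerXn2r ?nnegrE ?addr_ge0//.
  by rewrite (le_trans (ler_normD _ _))// normr1.
apply: null0_le (mod0_null0Z ma nuv) => e x.
rewrite [leLHS](_ : _ = `|g (u e x) - g (v e x)|)// (le_trans (HC _ _))//.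
rewrite normrZ ler_wpM2r//; exact: ler_norm.
Qed.

Section Orders.
Variable n : nat.
Implicit Types u v w : eps01 R -> 'rV[R]_n -> K.

Lemma derive_comp_sum (W : normedModType R) (g : K -> W) u i :
  smooth g -> (forall e, smooth (u e)) ->
  (fun e => 'D_(delta_mx 0 i) (g \o u e)) =
  \sum_j (fun e x => (c j \o 'D_(delta_mx 0 i) (u e)) x *:
                     ('D_(b j) g \o u e) x).
Proof.
move=> sg su; apply/funext => e; apply/funext => x; rewrite !fct_sumE.
rewrite (chain_rule _ bc)//; exact: smooth_differentiable.
Qed.

Lemma smooth_scale (a : 'rV[R]_n -> R) (f : 'rV[R]_n -> K) :
  smooth a -> smooth f -> smooth (fun x => a x *: f x).
Proof.
by move=> /smoothnP sa /smoothnP sf; apply/smoothnP => k; exact: smoothnZ.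
Qed.

Lemma smooth_lin (a : {linear K -> R}) (f : 'rV[R]_n -> K) :
  continuous a -> smooth f -> smooth (a \o f).
Proof.
by move=> ca /smoothnP sf; apply/smoothnP => k; exact: smoothn_lin.
Qed.

Lemma upto_comp k (g : K -> K) u : tempered g -> (forall e, smooth (u e)) ->
  upto k (@mod0 R _ K) u -> upto k (@mod0 R _ K) (fun e => g \o u e).
Proof.
elim: k g => [|k IH] g tg su uu.
  case=> // _; have [N [C HC]] := tempered_bound tg.
  exact: mod0_comp HC (uu [::] _).
have [u0 u1] := (uptoS _ _ _).1 uu; apply/uptoS; split=> [|i].
  by have [N [C HC]] := tempered_bound tg; exact: mod0_comp HC u0.
rewrite derive_comp_sum//; last exact: tempered_smooth.
have sc j e : smooth (c j \o 'D_(delta_mx 0 i) (u e)).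
  by apply: smooth_lin; [exact: (proj1 bc)|exact: smooth_derive].
have sg j e : smooth ('D_(b j) g \o u e).
  by apply: (smooth_comp bc) => //; apply/smooth_derive/tempered_smooth.
have [|j e|j|//] := @upto_sum R n k K (@mod0 R _ K) m (fun j e x =>
  (c j \o 'D_(delta_mx 0 i) (u e)) x *: ('D_(b j) g \o u e) x).
- exact: mod0_add.
- exact: smooth_scale.
- apply: (@uptoZ R n k K (@mod0 R _ R) (@mod0 R _ K)) => //.
  + exact: mod0_add.
  + by move=> *; exact: mod0Z.
  + apply: (@upto_lin R n k K R (@mod0 R _ K)) => //.
    * exact: (proj1 bc).
    * by move=> w; apply: mod0_lin; exact: (proj1 bc).
    * by move=> e; exact: smooth_derive.
  + by apply: (IH ('D_(b j) g)); [exact: tempered_derive| |exact: uptoW].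
Qed.

Lemma upto_compB k (g : K -> K) u v : tempered g ->
  (forall e, smooth (u e)) -> (forall e, smooth (v e)) ->
  upto k (@mod0 R _ K) u -> upto k (@mod0 R _ K) v ->
  upto k (@null0 R _ K) (fun e => u e - v e) ->
  upto k (@null0 R _ K) (fun e => (g \o u e) - (g \o v e)).
Proof.
elim: k g => [|k IH] g tg su sv uu uv uuv.
  case=> // _; exact: null0_compB (uu [::] _) (uv [::] _) (uuv [::] _).
have [u0 u1] := (uptoS _ _ _).1 uu; have [v0 v1] := (uptoS _ _ _).1 uv.
have [uv0 uv1] := (uptoS _ _ _).1 uuv; apply/uptoS; split=> [|i].
  exact: null0_compB.
have sg := tempered_smooth tg.
have sgu w j : (forall e, smooth (w e)) -> forall e, smooth ('D_(b j) g \o w e).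
  by move=> sw e; apply: (smooth_comp bc) => //; exact: smooth_derive.
have sc w j : (forall e, smooth (w e)) ->
    forall e, smooth (c j \o 'D_(delta_mx 0 i) (w e)).
  by move=> sw e; apply: smooth_lin; [exact: (proj1 bc)|exact: smooth_derive].
have suv e : smooth (u e - v e) by exact: smoothB.
pose F j e x : K := (c j \o 'D_(delta_mx 0 i) (u e)) x *:
    (('D_(b j) g \o u e) - ('D_(b j) g \o v e)) x.
pose G j e x : K := (c j \o 'D_(delta_mx 0 i) (u e - v e)) x *:
    ('D_(b j) g \o v e) x.
have -> : (fun e => 'D_(delta_mx 0 i) ((g \o u e) - (g \o v e))) =
    (fun e => (\sum_j F j) e + (\sum_j G j) e).
  apply/funext => e; apply/funext => x.
  have E (H : 'I_m -> eps01 R -> 'rV[R]_n -> K) :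
    (\sum_j H j) e x = \sum_j H j e x by rewrite !fct_sumE.
  rewrite -[RHS]/((\sum_j F j) e x + (\sum_j G j) e x) !E.
  rewrite deriveB; [|exact: smooth_derivable (smooth_comp bc _ _)..].
  rewrite !(chain_rule _ bc); [|exact: smooth_differentiable..].
  rewrite -sumrB -big_split/=; apply: eq_bigr => j _; rewrite /F /G /=.
  rewrite deriveB; [|exact: smooth_derivable..].
  by rewrite (linearB (c j)) scalerBl -![(_ - _ : _ -> _) x]/(_ x - _ x) /= scalerBr addrA subrK.
have cu w j : upto k (@mod0 R _ K) (fun e => 'D_(delta_mx 0 i) (w e)) ->
    (forall e, smooth (w e)) ->
    upto k (@mod0 R _ R) (fun e => c j \o 'D_(delta_mx 0 i) (w e)).
  move=> uw sw; apply: (@upto_lin R n k K R (@mod0 R _ K)) => //.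
  - exact: (proj1 bc).
  - by move=> ?; apply: mod0_lin; exact: (proj1 bc).
  - by move=> e; exact: smooth_derive.
have sFj j e : smooth (F j e).
  by apply: smooth_scale; [exact: sc|apply: smoothB; exact: sgu].
have sGj j e : smooth (G j e).
  by apply: smooth_scale; [exact: (sc (fun e => u e - v e))|exact: sgu].
have uFj j : upto k (@null0 R _ K) (F j).
  apply: (@uptoZ R n k K (@mod0 R _ R) (@null0 R _ K)) => //.
  - exact: null0_add.
  - by move=> *; exact: mod0_null0Z.
  - exact: sc.
  - by move=> e; apply: smoothB; exact: sgu.
  - exact: cu.
  - by apply: (IH ('D_(b j) g)) => //; [exact: tempered_derive|exact: uptoW..].
have uGj j : upto k (@null0 R _ K) (G j).
  apply: (@uptoZ R n k K (@null0 R _ R) (@mod0 R _ K)) => //.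
  - exact: null0_add.
  - by move=> *; exact: null0_mod0Z.
  - exact: (sc (fun e => u e - v e)).
  - exact: sgu.
  - apply: (@upto_lin R n k K R (@null0 R _ K)) => //.
    + exact: (proj1 bc).
    + by move=> ?; apply: null0_lin; exact: (proj1 bc).
    + by move=> e; exact: smooth_derive.
  - by apply: (@upto_comp k ('D_(b j) g)) => //; [exact: tempered_derive|exact: uptoW].
have [sF uF] := @upto_sum R n k K (@null0 R _ K) m F (@null0_add _ _ _) sFj uFj.
have [sG uG] := @upto_sum R n k K (@null0 R _ K) m G (@null0_add _ _ _) sGj uGj.
by apply: uptoD => //; exact: null0_add.
Qed.

End Orders.

End Coordinates.
End Superposition.

Section Moderate.
Context {R : realType} (n : nat) (K : normedModType R).
Implicit Types u v : eps01 R -> 'rV[R]_n -> K.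

Definition moderate u : Prop :=
  (forall e, smooth (u e)) /\
  forall A : set 'rV[R]_n, compact A -> forall s : seq 'I_n,
    exists2 p : R, 0 <= p & sup_bigO A (fun e => coord_derive s (u e)) (- p).

Definition null u : Prop :=
  (forall e, smooth (u e)) /\
  forall A : set 'rV[R]_n, compact A -> forall s : seq 'I_n,
    forall q : R, 0 <= q -> sup_bigO A (fun e => coord_derive s (u e)) q.

Lemma moderateE u : moderate u <->
  (forall e, smooth (u e)) /\ forall k, upto k (@mod0 R _ K) u.
Proof.
split=> -[su mu]; split=> //.
- by move=> k s sk A cA; exact: mu.
- by move=> A cA s; exact: (mu (size s)).
Qed.

Lemma nullE u : null u <->
  (forall e, smooth (u e)) /\ forall k, upto k (@null0 R _ K) u.
Proof.
split=> -[su mu]; split=> //.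
- by move=> k s sk A cA q q0; exact: mu.
- by move=> A cA s q q0; exact: (mu (size s)).
Qed.

Definition moderate_pred : {pred eps01 R -> 'rV[R]_n -> K} :=
  [pred u | `[< moderate u >]].

Lemma coord_deriveB s u v : (forall e, smooth (u e)) ->
  (forall e, smooth (v e)) ->
  (fun e => coord_derive s ((u - v) e)) =
  (fun e => coord_derive s (u e) + - coord_derive s (v e)).
Proof. by move=> su sv; apply/funext => e; exact: iter_deriveB. Qed.

Lemma moderate_zmod_closed : zmod_closed moderate_pred.
Proof.
split=> [|u v /asboolP[su mu] /asboolP[sv mv]]; apply/asboolP.
  split=> [e|A cA s]; first exact: smooth0.
  exists 0 => //; rewrite /coord_derive.
  under [X in sup_bigO _ X]eq_fun do rewrite iter_derive0.
  exact: sup_bigO0.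
split=> [e|A cA s]; first exact: smoothB.
have [p p0 Op] := mu A cA s; have [q q0 Oq] := mv A cA s.
exists (Num.max p q); first by rewrite le_max p0.
rewrite coord_deriveB//; apply: sup_bigOD; last apply: sup_bigON.
  by apply: sup_bigOW Op; rewrite lerN2 le_max lexx.
by apply: sup_bigOW Oq; rewrite lerN2 le_max lexx orbT.
Qed.

HB.instance Definition _ :=
  GRing.isZmodClosed.Build _ moderate_pred moderate_zmod_closed.

Record moderate_net := ModerateNet {
  net_val :> eps01 R -> 'rV[R]_n -> K ;
  net_valP : net_val \in moderate_pred }.

HB.instance Definition _ := [isSub for net_val].
HB.instance Definition _ := [Choice of moderate_net by <:].
HB.instance Definition _ := [SubChoice_isSubZmodule of moderate_net by <:].

Lemma net_moderate (u : moderate_net) : moderate u.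
Proof. exact/asboolP/net_valP. Qed.

Definition null_pred : {pred moderate_net} := [pred u | `[< null (net_val u) >]].

Lemma null_zmod_closed : zmod_closed null_pred.
Proof.
split=> [|u v /asboolP[su mu] /asboolP[sv mv]]; apply/asboolP.
  split=> [e|A cA s q q0]; first exact: smooth0.
  rewrite /coord_derive.
  under [X in sup_bigO _ X]eq_fun do rewrite iter_derive0.
  exact: sup_bigO0.
split=> [e|A cA s q q0]; first exact: smoothB.
rewrite coord_deriveB//; apply: sup_bigOD; last apply: sup_bigON; first exact: mu.
exact: mv.
Qed.

HB.instance Definition _ :=
  GRing.isZmodClosed.Build _ null_pred null_zmod_closed.

(* The additive group E_M(R^n) / N(R^n); [\pi_(colombeau n K) u] is the class
   of the net [u]. *)
Definition colombeau := {ideal_quot null_pred}.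
HB.instance Definition _ := GRing.Zmodule.on colombeau.
HB.instance Definition _ := generic_quotient.Quotient.on colombeau.

End Moderate.

Section Operations.
Context {R : realType}.

Section Generic.
Context {n : nat} {K : normedModType R}.
Implicit Types (u v : moderate_net n K) (U : colombeau n K).

Lemma colombeau_eqP u v :
  \pi_(colombeau n K) u = \pi_(colombeau n K) v <-> null (net_val (u - v)).
Proof.
have H : (u - v \in @null_pred R n K) = (u == v %[mod colombeau n K]).
  exact: Quotient.idealrBE.
split=> [E|N].
  by have /asboolP : u - v \in @null_pred R n K by rewrite H; exact/eqP.
by apply/eqP; rewrite -H; exact/asboolP.
Qed.

Lemma pi_net0 : \pi_(colombeau n K) 0 = 0.
Proof. exact: (@pi_zeror _ _ _ _ _ {ideal_quot (@null_pred R n K)}). Qed.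

Lemma pi_netD u v : \pi_(colombeau n K) (u + v) =
  \pi_(colombeau n K) u + \pi_(colombeau n K) v.
Proof. exact: (@pi_addr _ _ _ _ _ {ideal_quot (@null_pred R n K)}). Qed.

Lemma pi_netN u : \pi_(colombeau n K) (- u) = - \pi_(colombeau n K) u.
Proof. exact: (@pi_oppr _ _ _ _ _ {ideal_quot (@null_pred R n K)}). Qed.

Lemma net_derive_subproof (i : 'I_n) u :
  (fun e => 'D_(delta_mx 0 i) (u e)) \in @moderate_pred R n K.
Proof.
apply/asboolP; have [su mu] := net_moderate u.
split=> [e|A cA s]; first exact: smooth_derive.
under [X in sup_bigO _ X]eq_fun do rewrite -coord_derive_rcons.
exact: mu.
Qed.

Definition net_derive i u : moderate_net n K :=
  ModerateNet (net_derive_subproof i u).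

(* Well defined on classes: see [colombeau_derive_pi]. *)
Definition colombeau_derive i U : colombeau n K :=
  \pi_(colombeau n K) (net_derive i (repr U)).

Lemma colombeau_derive_pi i u : colombeau_derive i (\pi_(colombeau n K) u) = \pi_(colombeau n K) (net_derive i u).
Proof.
apply/colombeau_eqP; have : \pi_(colombeau n K) (repr (\pi_(colombeau n K) u)) = \pi_(colombeau n K) u.
  by rewrite reprK.
move=> /colombeau_eqP; set v := repr _ => -[suv nuv].
have [su mu] := net_moderate u; have [sv mv] := net_moderate v.
have E e : 'D_(delta_mx 0 i) (v e) - 'D_(delta_mx 0 i) (u e) =
    'D_(delta_mx 0 i) (v e - u e).
  apply/funext => x; rewrite deriveB//; exact: smooth_derivable.
split=> [e|A cA s q q0].
  rewrite -[net_val _ e]/('D_(delta_mx 0 i) (v e) - 'D_(delta_mx 0 i) (u e)) E.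
  exact: smooth_derive (suv e).
have -> : (fun e => coord_derive s (net_val (net_derive i v - net_derive i u) e)) =
    (fun e => coord_derive (rcons s i) (net_val (v - u) e)).
  apply/funext => e; rewrite coord_derive_rcons.
  by rewrite -[net_val _ e]/('D_(delta_mx 0 i) (v e) - 'D_(delta_mx 0 i) (u e)) E.
exact: nuv.
Qed.

End Generic.

Section Trace.
Context {K : normedModType R}.
Implicit Types (u v : moderate_net 2 K) (U : colombeau 2 K).

(* A point (x, t) of R^2 is a row vector with x in column 0 and t in column 1,
   and a point of R is a 1 x 1 row vector: this is x |-> (x, 0). *)
Definition initial_point (x : 'rV[R]_1) : 'rV[R]_2 :=
  x 0 0 *: delta_mx 0 ord0.

Lemma initial_point_linear : linear initial_point.
Proof.
by move=> a x y; rewrite /initial_point !mxE scalerDl scalerA.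
Qed.
HB.instance Definition _ :=
  GRing.isLinear.Build R 'rV[R]_1 'rV[R]_2 _ initial_point initial_point_linear.

Lemma initial_point_continuous : continuous initial_point.
Proof.
move=> x; apply: (@continuous_comp _ _ _ (fun y : 'rV[R]_1 => y 0 0)
  (fun t : R => t *: (delta_mx 0 ord0 : 'rV[R]_2))).
  exact: coord_continuous.
exact: scalel_continuous.
Qed.

Lemma initial_point_delta (i : 'I_1) :
  initial_point (delta_mx 0 i) = delta_mx 0 ord0.
Proof. by rewrite /initial_point !mxE !ord1 !eqxx scale1r. Qed.

Lemma iter_derive_trace (s : seq 'rV[R]_1) (f : 'rV[R]_2 -> K) :
  iter_derive s (f \o initial_point) =
  iter_derive [seq initial_point y | y <- s] f \o initial_point.
Proof.
elim: s => [//|v s IH] /=; rewrite IH; apply/funext => x.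
set g := iter_derive _ f; rewrite /derive /=.
suff -> : (fun h : R => h^-1 *: (((g \o initial_point) \o shift x) (h *: v) -
      (g \o initial_point) x)) =
    (fun h : R => h^-1 *: ((g \o shift (initial_point x)) (h *: initial_point v) -
      g (initial_point x))) by [].
by apply/funext => h /=; rewrite initial_point_linear.
Qed.

Lemma smooth_trace (f : 'rV[R]_2 -> K) :
  smooth f -> smooth (f \o initial_point).
Proof.
move=> sf s x; rewrite iter_derive_trace; apply: differentiable_comp => //.
by apply: linear_differentiable; exact: initial_point_continuous.
Qed.

Lemma coord_derive_trace (s : seq 'I_1) (f : 'rV[R]_2 -> K) :
  coord_derive s (f \o initial_point) =
  coord_derive [seq ord0 | _ <- s] f \o initial_point.
Proof.
rewrite /coord_derive iter_derive_trace -!map_comp; congr (iter_derive _ _ \o _).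
by apply: eq_map => i /=; exact: initial_point_delta.
Qed.

Lemma sup_bigO_trace (A : set 'rV[R]_1) (u : eps01 R -> 'rV[R]_2 -> K) q :
  sup_bigO (initial_point @` A) u q ->
  sup_bigO A (fun e => u e \o initial_point) q.
Proof.
move=> [C [eta [eta0 H]]]; exists C, eta; split=> // e ee x Ax.
by apply: H => //; exists x.
Qed.

Lemma compact_trace (A : set 'rV[R]_1) : compact A ->
  compact (initial_point @` A).
Proof.
apply: continuous_compact; apply: continuous_subspaceT.
exact: initial_point_continuous.
Qed.

Lemma net_trace_subproof u :
  (fun e => u e \o initial_point) \in @moderate_pred R 1 K.
Proof.
apply/asboolP; have [su mu] := net_moderate u.
split=> [e|A cA s]; first exact: smooth_trace.
have [p p0 Op] := mu _ (compact_trace cA) [seq ord0 | _ <- s].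
exists p => //; under [X in sup_bigO _ X]eq_fun do rewrite coord_derive_trace.
exact: sup_bigO_trace.
Qed.

Definition net_trace u : moderate_net 1 K := ModerateNet (net_trace_subproof u).

(* Restriction to t = 0, well defined on classes: see [colombeau_trace_pi]. *)
Definition colombeau_trace U : colombeau 1 K := \pi_(colombeau 1 K) (net_trace (repr U)).

Lemma colombeau_trace_pi u : colombeau_trace (\pi_(colombeau 2 K) u) = \pi_(colombeau 1 K) (net_trace u).
Proof.
apply/colombeau_eqP; have : \pi_(colombeau 2 K) (repr (\pi_(colombeau 2 K) u)) = \pi_(colombeau 2 K) u.
  by rewrite reprK.
move=> /colombeau_eqP; set v := repr _ => -[suv nuv].
have E e : net_val (net_trace v - net_trace u) e =
  net_val (v - u) e \o initial_point by [].
split=> [e|A cA s q q0]; first by rewrite E; exact: smooth_trace.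
under [X in sup_bigO _ X]eq_fun do rewrite E coord_derive_trace.
by apply: sup_bigO_trace; apply: nuv => //; exact: compact_trace.
Qed.

End Trace.

Section Scalars.
Variable k : scalars.
Local Notation K := (scalar_field R k).

Lemma linear_le_norm_continuous (V : normedModType R) (c : {linear V -> R}) :
  (forall z, `|c z| <= `|z|) -> continuous c.
Proof.
move=> cle; apply/bounded_linear_continuous/linear_boundedP.
exists 1; split=> [//|r r1 z].
by rewrite (le_trans (cle z))// ler_peMl// ltW.
Qed.

Lemma scalar_coordinates : exists (m : nat) (b : 'I_m -> K)
  (c : 'I_m -> {linear K -> R}), coordinates b c.
Proof.
case: k => /=.
  exists 1%N, (fun=> 1 : R), (fun=> idfun : {linear R^o -> R}); split=> [_|z].
    by move=> x; exact: cvg_id.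
  by rewrite big_ord1 /= [_ *: _]mulr1.
exists 2%N, (fun i => if i == ord0 then 1%:C else 'i)%C.
exists (fun i => if i == ord0 then
  (@complex.Re R : {linear Rcomplex R -> R}) else
  (@complex.Im R : {linear Rcomplex R -> R})); split=> [i|z].
  apply: linear_le_norm_continuous => -[x y].
  rewrite [leRHS]/(Num.sqrt (x ^+ 2 + y ^+ 2)).
  by case: ifP => _ /=; rewrite -sqrtr_sqr ler_wsqrtr// (lerDl, lerDr) sqr_ge0.
case: z => x y; rewrite big_ord_recl big_ord1 /=.
rewrite /GRing.scale/= /scalec/=; apply/eqP; rewrite eq_complex/=.
by rewrite !mulr1 !mulr0 addr0 add0r !eqxx.
Qed.

Section Superposition.
Variables (n : nat) (f : K -> K).
Hypothesis tf : tempered f.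
Implicit Types (u v : moderate_net n K) (U : colombeau n K).

Lemma net_comp_subproof u : (fun e => f \o u e) \in @moderate_pred R n K.
Proof.
have [m [b [c bc]]] := scalar_coordinates.
apply/asboolP; have /moderateE[su mu] := net_moderate u.
apply/moderateE; split=> [e|j].
  by apply: (smooth_comp bc) => //; exact: tempered_smooth.
exact: (upto_comp bc).
Qed.

Definition net_comp u : moderate_net n K := ModerateNet (net_comp_subproof u).

(* The class of (f o u_e)_e, well defined: see [colombeau_comp_pi]. *)
Definition colombeau_comp U : colombeau n K := \pi_(colombeau n K) (net_comp (repr U)).

Lemma colombeau_comp_pi u : colombeau_comp (\pi_(colombeau n K) u) = \pi_(colombeau n K) (net_comp u).
Proof.
have [m [b [c bc]]] := scalar_coordinates.
apply/colombeau_eqP; have : \pi_(colombeau n K) (repr (\pi_(colombeau n K) u)) = \pi_(colombeau n K) u.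
  by rewrite reprK.
move=> /colombeau_eqP; set v := repr _ => /nullE[suv nuv].
have /moderateE[su mu] := net_moderate u.
have /moderateE[sv mv] := net_moderate v.
apply/nullE; split=> [e|j].
  by apply: smoothB; apply: (smooth_comp bc) => //; exact: tempered_smooth.
by apply: (upto_compB bc) => //; exact: nuv.
Qed.

End Superposition.
End Scalars.
End Operations.

(* The sharp topology: the [sharp_V A m p] form a base of neighborhoods of 0,
   translated to the other points. *)
Section SharpTopology.
Context {R : realType} (n : nat) (K : normedModType R).
Local Notation G := (colombeau n K).

(* Only finitely many [s] satisfy [size s <= m], so that bounding each
   derivative amounts to bounding their supremum. *)
Definition sharp_V (A : set 'rV[R]_n) (m : nat) (p : R) : set G :=
  [set U | exists2 u : moderate_net n K, U = \pi_G u &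
    forall s : seq 'I_n, (size s <= m)%N ->
      sup_bigO A (fun e => coord_derive s (u e)) p].

Definition sharp_nbhs (U : G) : set_system G :=
  [set B | exists (A : set 'rV[R]_n) (m : nat) (p : R),
    [/\ compact A, 0 <= p & forall W, sharp_V A m p W -> B (U + W)]].

Lemma sharp_V0 A m p : sharp_V A m p 0.
Proof.
exists 0 => [|s sm]; first exact: (esym pi_net0).
rewrite /coord_derive.
under [X in sup_bigO _ X]eq_fun do rewrite iter_derive0.
exact: sup_bigO0.
Qed.

Lemma sharp_VD A m p U W :
  sharp_V A m p U -> sharp_V A m p W -> sharp_V A m p (U + W).
Proof.
move=> [u -> Hu] [w -> Hw]; exists (u + w); first exact: (esym (pi_netD u w)).
move=> s sm.
have [[su _] [sw _]] := (net_moderate u, net_moderate w).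
have -> : (fun e => coord_derive s (net_val (u + w) e)) =
    (fun e => coord_derive s (u e) + coord_derive s (w e)).
  by apply/funext => e; exact: (iter_deriveD _ (su e) (sw e)).
by apply: sup_bigOD; [exact: Hu|exact: Hw].
Qed.

Lemma sharp_VW A B m l p q : A `<=` B -> (m <= l)%N -> p <= q ->
  sharp_V B l q `<=` sharp_V A m p.
Proof.
move=> AB ml pq _ [u -> Hu]; exists u => // s sm.
apply: sup_bigO_sub AB _; apply: sup_bigOW pq _.
by apply: Hu; rewrite (leq_trans sm).
Qed.

Lemma sharp_nbhs_filter U : ProperFilter (sharp_nbhs U).
Proof.
split.
  by move=> [A [m [p [_ _ /(_ 0 (sharp_V0 A m p))]]]].
split.
- by exists set0, 0%N, 0; split=> //; exact: compact0.
- move=> P Q [A [m [p [cA p0 HP]]]] [B [l [q [cB q0 HQ]]]].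
  exists (A `|` B), (maxn m l), (Num.max p q); split.
  + exact: compactU.
  + by rewrite le_max p0.
  + move=> W HW; split; [apply: HP|apply: HQ]; apply: sharp_VW HW.
    * exact: subsetUl.
    * exact: leq_maxl.
    * by rewrite le_max lexx.
    * exact: subsetUr.
    * exact: leq_maxr.
    * by rewrite le_max lexx orbT.
- move=> P Q PQ [A [m [p [cA p0 HP]]]]; exists A, m, p; split=> // W /HP.
  exact: PQ.
Qed.

Lemma sharp_nbhs_singleton U (B : set G) : sharp_nbhs U B -> B U.
Proof.
by move=> [A [m [p [_ _ /(_ 0 (sharp_V0 A m p))]]]]; rewrite addr0.
Qed.

Lemma sharp_nbhs_nbhs U (B : set G) :
  sharp_nbhs U B -> sharp_nbhs U (sharp_nbhs^~ B).
Proof.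
move=> [A [m [p [cA p0 HB]]]]; exists A, m, p; split=> // W VW.
exists A, m, p; split=> // W' VW'; rewrite -addrA; apply: HB.
exact: sharp_VD.
Qed.

HB.instance Definition _ := hasNbhs.Build (colombeau n K) sharp_nbhs.
HB.instance Definition _ := Nbhs_isNbhsTopological.Build (colombeau n K)
  sharp_nbhs_filter sharp_nbhs_singleton sharp_nbhs_nbhs.

End SharpTopology.

Section WaveProblem.
Context {R : realType} (k : scalars).
Local Notation K := (scalar_field R k).

Definition colombeau_dx (u : colombeau 2 K) := colombeau_derive ord0 u.
Definition colombeau_dt (u : colombeau 2 K) := colombeau_derive ord_max u.

Definition wave_problem (f : K -> K) (tf : tempered f)
    (a b : colombeau 1 K) (h u : colombeau 2 K) : Prop :=
  [/\ colombeau_dt (colombeau_dt u) - colombeau_dx (colombeau_dx u) = colombeau_comp tf u + h,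
      colombeau_trace u = a & colombeau_trace (colombeau_dt u) = b].

End WaveProblem.

(* Main.v *)
(* In the characteristic directions e1 = (1,1) and e2 = (1,-1) the wave operator
   is - D_e2 D_e1, so with data on the diagonal {t = 0} a solution is a fixed
   point of u |-> u0 - J(f(u) + h), where J integrates twice along the
   characteristics.  J is a contraction for exponentially weighted sup norms on
   characteristic squares, which gives a continuous solution for each epsilon,
   and J gains one derivative, which makes it smooth.  A Gronwall estimate in the
   same weights bounds u (resp. a difference of two solutions) by the data.
   Higher derivatives follow by induction on the order: a bound on f(u) up to
   order k integrates along the characteristics to a bound on u up to order k+1;
   no Gronwall argument is needed there, and moderate and null bounds are
   propagated by the same proof.

   Continuity for the sharp topology is a formal consequence of existence and
   uniqueness: if it failed, perturbations violating it along a countable base of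
   neighborhoods could be glued, at parameters epsilon_n -> 0, into a single null
   perturbation of the data whose effect on the solution is not null. *)
Require Import Defs.
From HB Require Import structures.
From mathcomp Require Import all_boot all_order all_algebra.
From mathcomp Require Import all_classical all_reals all_analysis.
From mathcomp Require Import ring lra.

Set Implicit Arguments.
Unset Strict Implicit.
Unset Printing Implicit Defensive.

Import Order.TTheory GRing.Theory Num.Theory.
Import numFieldNormedType.Exports.

Local Open Scope classical_set_scope.
Local Open Scope ring_scope.

(** * Mean value inequalities and antiderivatives *)

Section Line.
Context {R : realType}.
Implicit Types V W : normedModType R.

(** The integrals along characteristics are differences of primitives picked by choice, one for each
    line, so their values on two different lines cannot be compared term by term. All else about
    them is extracted from two facts: the derivative along the line is the integrand, and the value
    on the diagonal is zero. Mean value inequalities then yield continuity, the derivative across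
    the lines and the weighted bounds. The two characteristic directions play symmetric roles, so a
    [frame] is kept abstract and lemmas are used a second time with the frame swapped.

    In the a priori estimates the constants depend on no more than the square, [L] and the mean
    value constant, never on epsilon; that uniformity turns a bound for one function into a
    statement about nets. The gluing in the continuity argument works because one fixed operator
    [sol] on functions produces the solution for each epsilon separately: altering the data at one
    parameter alters the solution at that parameter alone. *)

Lemma is_derive_line V W (f : V -> W) (z v : V) (s : R) :
  derivable f (z + s *: v) v ->
  is_derive s 1 (fun t : R => f (z + t *: v)) ('D_v f (z + s *: v)).
Proof.
move=> df.
have E : (fun h : R => h^-1 *: (((fun t : R => f (z + t *: v)) \o shift s) (h *: (1 : R)) - f (z + s *: v))) =
   (fun h : R => h^-1 *: ((f \o shift (z + s *: v)) (h *: v) - f (z + s *: v))).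
  apply/funext => h /=; congr (_ *: (f _ - _)).
  by rewrite -[h *: 1]/(h * 1) mulr1 scalerDl addrCA.
split; first by rewrite /derivable E.
by rewrite /derive E.
Qed.

(** Both [psi + F] and [psi - F] have a nonnegative derivative. Comparing with a majorant [psi]
    instead of a constant lets the exponential weights of the later estimates pass through without
    any integral. *)
Lemma real_mean_value (F F' psi psi' : R -> R) :
  (forall t : R, 0 <= t <= 1 -> is_derive t 1 F (F' t)) ->
  (forall t : R, 0 <= t <= 1 -> is_derive t 1 psi (psi' t)) ->
  (forall t : R, 0 <= t <= 1 -> `|F' t| <= psi' t) ->
  `|F 1 - F 0| <= psi 1 - psi 0.
Proof.
move=> dF dpsi Fpsi.
have H (G G' : R -> R) : (forall t : R, 0 <= t <= 1 -> is_derive t 1 G (G' t)) ->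
    (forall t : R, 0 <= t <= 1 -> 0 <= G' t) -> G 0 <= G 1.
  move=> dG G0; have [c] : exists2 c, c \in `[0 : R, 1] & G 1 - G 0 = G' c * (1 - 0).
    apply: MVT_segment => // [t|].
      by rewrite in_itv/= => /andP[t0 t1]; apply: dG; rewrite !ltW.
    apply: derivable_within_continuous => t; rewrite in_itv/= => t01.
    by have [] := dG t t01.
  by rewrite in_itv/= subr0 mulr1 => c01 E; rewrite -subr_ge0 E; exact: G0.
rewrite ler_norml; apply/andP; split.
  have := H (fun t => psi t + F t) (fun t => psi' t + F' t).
  have /[swap]/[apply] : forall t : R, 0 <= t <= 1 -> 0 <= psi' t + F' t.
    by move=> t t01; have := Fpsi t t01; rewrite ler_norml => /andP[]; lra.
  have /[swap]/[apply] : forall t : R, 0 <= t <= 1 ->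
      is_derive t 1 (fun t => psi t + F t) (psi' t + F' t).
    by move=> t t01; apply: is_deriveD; [exact: dpsi|exact: dF].
  by move=> /=; lra.
have := H (fun t => psi t - F t) (fun t => psi' t - F' t).
have /[swap]/[apply] : forall t : R, 0 <= t <= 1 -> 0 <= psi' t - F' t.
  by move=> t t01; have := Fpsi t t01; rewrite ler_norml => /andP[]; lra.
have /[swap]/[apply] : forall t : R, 0 <= t <= 1 ->
    is_derive t 1 (fun t => psi t - F t) (psi' t - F' t).
  by move=> t t01; apply: is_deriveB; [exact: dpsi|exact: dF].
by move=> /=; lra.
Qed.

(* A constant C > 1 appears because the inequality is proved coordinatewise;
   its value is irrelevant in all the estimates. *)
Definition mean_value_constant W (C : R) := 0 < C /\
  forall (F F' : R -> W) (psi psi' : R -> R),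
  (forall t : R, 0 <= t <= 1 -> is_derive t 1 F (F' t)) ->
  (forall t : R, 0 <= t <= 1 -> is_derive t 1 psi (psi' t)) ->
  (forall t : R, 0 <= t <= 1 -> `|F' t| <= psi' t) ->
  `|F 1 - F 0| <= C * (psi 1 - psi 0).

Lemma is_derive_lin V W (c : {linear V -> W}) (F : R -> V) (t : R) (d : V) :
  continuous c -> is_derive t 1 F d -> is_derive t 1 (c \o F) (c d).
Proof.
move=> cc [dF <-]; have [dcF E] := deriveLin (1 : R) cc ((derivable1_diffP F t).1 dF).
by split=> //; apply/derivable1_diffP.
Qed.

Lemma mean_value W m (b : 'I_m -> W) (c : 'I_m -> {linear W -> R}) :
  coordinates b c -> exists C, mean_value_constant W C.
Proof.
move=> [cc ce].
have /choice[M HM] : forall i : 'I_m, exists k, 0 < k /\ forall x, `|c i x| <= k * `|x|.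
  by move=> i; have [k k0 kP] := linear_lipschitz (cc i); exists k.
have S0 : 0 <= \sum_i M i * `|b i|.
  by apply: sumr_ge0 => i _; rewrite mulr_ge0// ltW// (HM i).1.
(* The summand 1 keeps the constant positive when the sum vanishes; its share of the bound is
   nonnegative by [psi0]. *)
exists (1 + \sum_i M i * `|b i|); split; first by rewrite ltr_wpDr.
move=> F F' psi psi' dF dpsi Fpsi.
have psi0 : 0 <= psi 1 - psi 0.
  have := @real_mean_value (cst 0) (cst 0) psi psi' (fun t _ => is_derive_cst _ _ _) dpsi.
  rewrite /= subrr normr0; apply => t t01.
  exact: le_trans (Fpsi t t01).
rewrite mulrDl mul1r ler_wpDl// mulr_suml [F 1 - F 0]ce.
rewrite (le_trans (ler_norm_sum _ _ _))//; apply: ler_sum => i _.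
rewrite normrZ mulrAC ler_wpM2r// linearB.
rewrite mulrBr; apply: (@real_mean_value (c i \o F) (c i \o F') (fun t => M i * psi t) (fun t => M i * psi' t)).
- by move=> t t01; apply: is_derive_lin => //; exact: dF.
- by move=> t t01; apply: is_deriveZ; exact: dpsi.
- move=> t t01 /=; rewrite (le_trans ((HM i).2 _))// ler_wpM2l ?(ltW (HM i).1)//.
  exact: Fpsi.
Qed.

Lemma is_derive_reparam W (F : R -> W) (a d t : R) (l : W) :
  is_derive (a + t * d) 1 F l -> is_derive t 1 (fun s => F (a + s * d)) (d *: l).
Proof.
move=> [dF <-].
have df : differentiable F (a + t *: (d : R)) by apply/derivable1_diffP.
have -> : d *: 'D_1 F (a + t * d) = 'D_d F (a + t *: (d : R)).
  rewrite !deriveE//.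
  by rewrite -linearZ/= [X in 'd F _ X]mulr1.
exact: (@is_derive_line R W F a d t (diff_derivable _)).
Qed.

Lemma is_derive_scal (k t : R) : is_derive t 1 (fun s : R => k * s) k.
Proof.
by rewrite -[X in is_derive _ _ _ X]mulr1; apply: (@is_deriveZ R R R id k t 1 1).
Qed.

Lemma mean_value_between W C (F F' : R -> W) (a b mu : R) :
  mean_value_constant W C ->
  (forall t : R, 0 <= t <= 1 -> is_derive (a + t * (b - a)) 1 F (F' (a + t * (b - a)))) ->
  (forall t : R, 0 <= t <= 1 -> `|F' (a + t * (b - a))| <= mu) ->
  `|F b - F a| <= C * (mu * `|b - a|).
Proof.
move=> [C0 HC] dF Fmu.
have := HC (fun s => F (a + s * (b - a))) (fun s => (b - a) *: F' (a + s * (b - a)))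
  (fun s => (mu * `|b - a|) * s) (fun=> (mu * `|b - a|) * 1).
rewrite mul1r mul0r addr0 mulr0 subr0 mulr1 [a + _]addrC subrK; apply=> t t01.
- exact/is_derive_reparam/dF.
- exact: is_derive_scal.
- by rewrite normrZ mulrC ler_wpM2r// Fmu.
Qed.

(** The majorant is the primitive of the exponential bound, and the division by [la] that it brings
    is the whole gain. Its value at 0 is dropped at the end. *)
Lemma mean_value_exp W C (F F' : R -> W) (a b mu la : R) :
  mean_value_constant W C -> 0 < la -> 0 <= mu ->
  (forall t : R, 0 <= t <= 1 -> is_derive (a + t * (b - a)) 1 F (F' (a + t * (b - a)))) ->
  (forall t : R, 0 <= t <= 1 ->
    `|F' (a + t * (b - a))| <= mu * expR (la * (t * `|b - a|))) ->
  `|F b - F a| <= C * mu / la * expR (la * `|b - a|).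
Proof.
move=> [C0 HC] la0 mu0 dF Fmu.
have := HC (fun s => F (a + s * (b - a))) (fun s => (b - a) *: F' (a + s * (b - a)))
  (fun s => (mu / la) * expR (la * (s * `|b - a|)))
  (fun s => (mu / la) * ((la * `|b - a|) * expR (la * (s * `|b - a|)))).
rewrite mul1r mul0r addr0 mul1r [a + _]addrC subrK => H; apply: le_trans (H _ _ _) _ => {H} [t t01|t t01|t t01|].
- exact/is_derive_reparam/dF.
- apply: is_deriveZ.
  have -> : (fun s : R => expR (la * (s * `|b - a|))) =
      expR \o (fun s : R => (la * `|b - a|) * s).
    by apply/funext => s /=; congr expR; ring.
  have -> : la * (t * `|b - a|) = (la * `|b - a|) * t by ring.
  rewrite [X in is_derive _ _ _ X]mulrC; apply: (@is_derive1_comp R expR).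
  exact: is_derive_scal.
- rewrite normrZ mulrC.
  rewrite [leRHS](_ : _ = (mu * expR (la * (t * `|b - a|))) * `|b - a|).
    by rewrite ler_wpM2r// Fmu.
  by field; rewrite gt_eqF.
- rewrite -mulrBr -!mulrA !ler_wpM2l ?(ltW C0)//.
    by rewrite invr_ge0 ltW.
  by rewrite gerBl// expR_ge0.
Qed.
End Line.

Section Antiderivative.
Context {R : realType}.
Implicit Types W : normedModType R.

Lemma is_derive0_eq (F : R -> R) (x : R) :
  (forall t : R, 0 <= t <= 1 -> is_derive (t * x) 1 F 0) -> F x = F 0.
Proof.
move=> dF; apply/eqP; rewrite -subr_eq0 -normr_le0.
have dFx (t : R) : 0 <= t <= 1 -> is_derive t 1 (fun s => F (0 + s * x)) (x *: 0).
  by move=> t01; apply: is_derive_reparam; rewrite add0r; exact: dF.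
have bd (t : R) : 0 <= t <= 1 -> `|x *: (0 : R)| <= cst 0 t.
  by rewrite scaler0 normr0.
have := @real_mean_value R _ (fun=> x *: 0) (cst 0) (cst 0) dFx
  (fun t _ => is_derive_cst _ _ _) bd.
by rewrite mul1r mul0r !add0r => /le_trans; apply; rewrite /= oppr0.
Qed.

(** The fundamental theorem of calculus gives an antiderivative [I n] only between [-n] and [n].
    Normalized to vanish at 0, two of these agree where both are antiderivatives, so choosing [n]
    above [|x|] point by point glues them. *)
Lemma real_antiderivative (g : R -> R) : continuous g ->
  exists F : R -> R, forall y : R, is_derive y 1 F (g y).
Proof.
move=> cg.
pose I (n : nat) (x : R) := (\int[lebesgue_measure]_(t in `[- n%:R, x]) g t)%R.
have dI n (x : R) : `|x| < n%:R -> is_derive x 1 (I n) (g x).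
  rewrite ltr_norml => /andP[nx xn].
  have [] := @continuous_FTC1_closed R g (- n%:R) x n%:R xn _ nx (cg x).
    apply: continuous_compact_integrable; first exact: segment_compact.
    exact: continuous_subspaceT.
  by move=> d e; exact: (DeriveDef d (etrans (esym (derive1E _ _)) e)).
pose G n := I n - cst (I n 0).
have dG n (x : R) : `|x| < n%:R -> is_derive x 1 (G n) (g x).
  move=> xn; rewrite -[g x]subr0; by apply: is_deriveB; exact: dI.
have G0 n : G n 0 = 0 by exact: subrr.
have GG n k (x : R) : `|x| < n%:R -> `|x| < k%:R -> G n x = G k x.
  move=> xn xk.
  have dGG (t : R) : 0 <= t <= 1 -> is_derive (t * x) 1 (G n - G k) 0.
    move=> /andP[t0 t1]; rewrite -(subrr (g (t * x))).
    have tx : `|t * x| <= `|x| by rewrite normrM ger0_norm// ler_piMl.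
    by apply: is_deriveB; apply: dG; exact: le_lt_trans tx _.
  have {}dGG := is_derive0_eq dGG.
  apply/eqP; rewrite -subr_eq0; apply/eqP; move: dGG.
  by rewrite -[LHS]/(G n x - G k x) -[RHS]/(G n 0 - G k 0) !G0 subrr.
pose N (x : R) := (Num.truncn `|x|).+1.
have NP x : `|x| < (N x)%:R by rewrite /N truncnS_gt.
exists (fun x => G (N x) x) => y.
(* Near [y] the bound [|x| < N y] persists, so the glued function is locally the single
   [G (N y)]. *)
have E : {near y, G (N y) =1 (fun x => G (N x) x)}.
  near=> x; apply: GG; last exact: NP.
  by near: x; apply: (cvgr_norm_lt y cvg_id _ (NP y)).
exact: near_eq_is_derive E (dG _ _ (NP y)).
Unshelve. all: by end_near. Qed.

Lemma antiderivative W m (b : 'I_m -> W) (c : 'I_m -> {linear W -> R}) (g : R -> W) :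
  coordinates b c -> continuous g ->
  exists F : R -> W, forall y : R, is_derive y 1 F (g y).
Proof.
move=> [cc ce] cg.
have /choice[F HF] : forall i : 'I_m, exists F : R -> R, forall y : R,
    is_derive y 1 F (c i (g y)).
  move=> i; apply: real_antiderivative => y.
  by apply: continuous_comp; [exact: cg|exact: cc].
exists (\sum_i (fun y => F i y *: b i)) => y.
rewrite [g y]ce; apply: is_derive_sum => i.
have [dF e] := HF i y.
have df : differentiable (F i) y by apply/derivable1_diffP.
have [d E] := @is_diffZ_fun R R W (F i) (cst (b i)) y df (differentiable_cst _ _).
split; first by apply/derivable1_diffP.
by rewrite E derive_cst scaler0 addr0 e.
Qed.

End Antiderivative.

(** * Functions of two variables *)

Section Frames.
Context {R : realType}.
Implicit Types V W : normedModType R.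

Lemma continuous_atP V W (f : V -> W) (x : V) : {for x, continuous f} <->
  forall eps, 0 < eps -> exists2 d, 0 < d &
    forall h, `|h| < d -> `|f (x + h) - f x| <= eps.
Proof.
split=> [cf eps eps0|H].
  have /nbhs_ballP[d d0 H] : \forall y \near x, `|f x - f y| < eps.
    by move/cvgrPdist_lt : cf; exact.
  exists d => // h hd; rewrite distrC ltW//; apply: H.
  by rewrite -ball_normE /ball_/= opprD addrA subrr add0r normrN.
apply/cvgrPdist_le => eps eps0; have [d d0 Hd] := H _ eps0.
apply/nbhs_ballP; exists d => // y; rewrite -ball_normE /ball_/= => xy.
by have := Hd (y - x); rewrite [x + _]addrC subrK distrC [`|f y - _|]distrC; apply.
Qed.

Lemma is_deriveP V W (f : V -> W) (x v : V) (l : W) : is_derive x v f l <->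
  forall eps, 0 < eps -> exists2 d, 0 < d &
    forall s : R, `|s| < d -> `|f (x + s *: v) - f x - s *: l| <= eps * `|s|.
Proof.
pose q (h : R) := h^-1 *: ((f \o shift x) (h *: v) - f x).
have E (s : R) : s != 0 ->
    `|f (x + s *: v) - f x - s *: l| = `|l - q s| * `|s|.
  move=> s0; rewrite mulrC -normrZ scalerBr /q scalerA divff// scale1r /=.
  by rewrite distrC [x + _]addrC.
split=> [[df dl] eps eps0|H].
  have /cvgrPdist_le/(_ eps eps0) : q @ 0^' --> l by rewrite -dl; exact: df.
  move=> /nbhs_ballP[d d0 H]; exists d => // s sd.
  have [->|s0] := eqVneq s 0; first by rewrite !scale0r addr0 subrr subr0 !normr0 mulr0.
  rewrite E// ler_wpM2r//; apply: H => //.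
  by rewrite -ball_normE /ball_/= sub0r normrN.
have ql : q @ 0^' --> l.
  apply/cvgrPdist_le => eps eps0; have [d d0 Hd] := H _ eps0.
  apply/nbhs_ballP; exists d => // s; rewrite -ball_normE /ball_/= sub0r normrN => sd s0.
  by have := Hd s sd; rewrite E// ler_pM2r// normr_gt0.
split; first by apply/cvg_ex; exists l.
exact: cvg_lim ql.
Qed.

Lemma differentiable_bound V W (f : V -> W) (L : {linear V -> W}) (x : V) :
  continuous L ->
  (forall eps, 0 < eps -> exists2 d, 0 < d &
    forall h, `|h| < d -> `|f (x + h) - f x - L h| <= eps * `|h|) ->
  differentiable f x /\ forall v, 'D_v f x = L v.
Proof.
move=> cL H.
have fL : f \o shift x = cst (f x) + L +o_0 id.
  apply/eqaddoP => eps eps0; have [d d0 Hd] := H _ eps0.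
  apply/nbhs_ballP; exists d => // h; rewrite -ball_normE /ball_/= sub0r normrN => hd.
  by rewrite fctE opprD addrA /= [h + x]addrC; exact: Hd.
have E := diff_unique cL fL.
have df : differentiable f x by apply/diff_locallyP; rewrite E.
by split=> // v; rewrite deriveE// E.
Qed.

(** The point [x + h] may leave [A], so uniform continuity on [A] would not suffice. Compactness is
    used as a near-covering property. *)
Lemma compact_unif_increment V W (f : V -> W) (A : set V) :
  compact A -> (forall x, A x -> {for x, continuous f}) ->
  forall eps, 0 < eps -> exists2 d, 0 < d &
    forall x h, A x -> `|h| < d -> `|f (x + h) - f x| <= eps.
Proof.
move=> cA cf eps eps0.
have /compact_near_coveringP cov := cA.
have : \forall h \near (0 : V), forall x, A x -> `|f (x + h) - f x| <= eps.
  apply: (cov V (nbhs (0 : V)) (fun h x => `|f (x + h) - f x| <= eps)) => x Ax.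
  have /continuous_atP/(_ (eps / 2))[|d d0 Hd] := cf x Ax; first by rewrite divr_gt0.
  exists (ball x (d / 2), ball (0 : V) (d / 2)).
    by split; apply: nbhsx_ballx; rewrite divr_gt0.
  move=> [y h] [/=]; rewrite -!ball_normE /ball_/= sub0r normrN distrC => xy hd.
  have -> : f (y + h) - f y = (f (x + ((y - x) + h)) - f x) - (f (x + (y - x)) - f x).
    by rewrite addrA [x + (y - x)]addrC subrK opprB addrA subrK.
  rewrite (le_trans (ler_normB _ _))// [eps]splitr lerD// Hd//.
    by rewrite (le_lt_trans (ler_normD _ _))// [d]splitr ltrD.
  by rewrite (lt_le_trans xy)//; move: (ltW d0); lra.
move=> /nbhs_ballP[d d0 H]; exists d => // x h Ax hd; apply: H => //.
by rewrite -ball_normE /ball_/= sub0r normrN.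
Qed.

Lemma compact_line_segment V (p q : V) : compact [set p + t *: q | t in `[0 : R, 1]].
Proof.
apply: continuous_compact; last exact: segment_compact.
apply: continuous_subspaceT => t; apply: cvgD; first exact: cvg_cst.
exact: scalel_continuous.
Qed.

Lemma is_derive_scalel W (l : W) (t : R) : is_derive t 1 (fun r : R => r *: l) l.
Proof.
have di : differentiable (@id R) t by apply/derivable1_diffP; exact: derivable_id.
have [d E] := @is_diffZ_fun R R W id (cst l) t di (differentiable_cst _ _).
split; first by apply/derivable1_diffP.
by rewrite E derive_cst scaler0 addr0 derive_id scale1r.
Qed.

(** Mean value inequality for [F] minus the linear function of slope [l]. With [l = 0] it bounds an
    increment, with the expected derivative it bounds the error of linearization. *)
Lemma mean_value_line V W C (F : V -> W) (z v : V) (s mu : R) (l : W) :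
  mean_value_constant W C ->
  (forall t : R, 0 <= t <= 1 -> derivable F (z + (t * s) *: v) v) ->
  (forall t : R, 0 <= t <= 1 -> `|'D_v F (z + (t * s) *: v) - l| <= mu) ->
  `|F (z + s *: v) - F z - s *: l| <= C * (mu * `|s|).
Proof.
move=> HC dF Fmu.
pose P (r : R) := F (z + r *: v) - r *: l.
have := @mean_value_between R W C P (fun r => 'D_v F (z + r *: v) - l) 0 s mu HC.
rewrite subr0 /P scale0r addr0 scale0r subr0 addrAC; apply=> t t01; rewrite add0r.
- by apply: is_deriveB; [exact/is_derive_line/dF|exact: is_derive_scalel].
- exact: Fmu.
Qed.

(** A basis of the plane [V] together with its dual basis. *)
Definition frame V (e1 e2 : V) (l1 l2 : {linear V -> R}) :=
  [/\ continuous l1, continuous l2, (forall z, z = l1 z *: e1 + l2 z *: e2),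
      l1 e1 = 1 /\ l2 e1 = 0 & l1 e2 = 0 /\ l2 e2 = 1].

Lemma frame_swap V (e1 e2 : V) l1 l2 : frame e1 e2 l1 l2 -> frame e2 e1 l2 l1.
Proof. by case=> c1 c2 z [? ?] [? ?]; split=> // w; rewrite addrC. Qed.

Lemma continuous_lincomb V W (l1 l2 : {linear V -> R}) (a b : W) :
  continuous l1 -> continuous l2 -> continuous (fun v => l1 v *: a + l2 v *: b).
Proof.
move=> c1 c2 v; apply: cvgD.
  by apply: (@continuous_comp _ _ _ l1 (fun t : R => t *: a)); [exact: c1|exact: scalel_continuous].
by apply: (@continuous_comp _ _ _ l2 (fun t : R => t *: b)); [exact: c2|exact: scalel_continuous].
Qed.

(** The classical criterion of continuous partial derivatives: [z + h] is reached by one leg along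
    [e1] and one along [e2], and [mean_value_line] linearizes each leg. *)
Lemma differentiable_frame V W C (e1 e2 : V) (l1 l2 : {linear V -> R}) (F : V -> W) :
  mean_value_constant W C -> frame e1 e2 l1 l2 ->
  (forall z, derivable F z e1) -> (forall z, derivable F z e2) ->
  continuous ('D_e1 F) -> continuous ('D_e2 F) ->
  forall z, differentiable F z /\
    forall v, 'D_v F z = l1 v *: 'D_e1 F z + l2 v *: 'D_e2 F z.
Proof.
move=> HC [cl1 cl2 le _ _] d1 d2 c1 c2 z; have C0 := HC.1.
have Llin : linear (fun v => l1 v *: 'D_e1 F z + l2 v *: 'D_e2 F z).
  move=> a u v /=; rewrite (linearP l1) (linearP l2) !scalerDl scalerDr !scalerA.
  by rewrite addrACA.
pose L : {linear V -> W} := HB.pack (fun v => l1 v *: 'D_e1 F z + l2 v *: 'D_e2 F z)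
  (GRing.isLinear.Build R V W _ _ Llin).
apply: (@differentiable_bound V W F L z) => [|eps eps0].
  exact: continuous_lincomb.
have [k1 k10 Hk1] := linear_lipschitz cl1; have [k2 k20 Hk2] := linear_lipschitz cl2.
(* Each leg costs a factor [C] and has parameter length at most [k1] or [k2] times [|h|], so this
   [mu] makes the total error at most [eps * |h|]. *)
pose mu := eps / (C * (k1 + k2)).
have Ck0 : 0 < C * (k1 + k2) by rewrite mulr_gt0// addr_gt0.
have mu0 : 0 < mu by rewrite divr_gt0.
have [a1 a10 Ha1] := (continuous_atP _ _).1 (c1 z) _ mu0.
have [a2 a20 Ha2] := (continuous_atP _ _).1 (c2 z) _ mu0.
pose N := k1 * `|e1| + k2 * `|e2| + 1.
have N0 : 0 < N by rewrite ltr_wpDl// addr_ge0// mulr_ge0// ltW.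
exists (Num.min a1 a2 / N) => [|h]; first by rewrite divr_gt0// lt_min a10.
rewrite ltr_pdivlMr// lt_min => /andP[hN1 hN2].
pose w := z + l1 h *: e1.
have lh1 (t : R) : 0 <= t <= 1 -> `|(t * l1 h) *: e1| <= k1 * `|e1| * `|h|.
  move=> /andP[t0 t1]; rewrite normrZ mulrAC ler_wpM2r// normrM ger0_norm//.
  by rewrite (le_trans _ (Hk1 h))// ler_piMl.
have lh2 (t : R) : 0 <= t <= 1 -> `|(t * l2 h) *: e2| <= k2 * `|e2| * `|h|.
  move=> /andP[t0 t1]; rewrite normrZ mulrAC ler_wpM2r// normrM ger0_norm//.
  by rewrite (le_trans _ (Hk2 h))// ler_piMl.
have B1 : `|F w - F z - l1 h *: 'D_e1 F z| <= C * (mu * `|l1 h|).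
  apply: mean_value_line => // t t01; apply: Ha1.
  rewrite (le_lt_trans (lh1 t t01))// (le_lt_trans _ hN1)// mulrC ler_wpM2l//.
  by rewrite /N -addrA lerDl addr_ge0// mulr_ge0// ltW.
have B2 : `|F (w + l2 h *: e2) - F w - l2 h *: 'D_e2 F z| <= C * (mu * `|l2 h|).
  apply: mean_value_line => // t t01; rewrite -addrA; apply: Ha2.
  rewrite (le_lt_trans (ler_normD _ _))// (le_lt_trans _ hN2)//.
  have := lh1 1; rewrite mul1r lexx ler01 => /(_ isT) H1.
  rewrite (le_trans (lerD H1 (lh2 t t01)))// -mulrDl mulrC ler_wpM2l//.
  by rewrite /N lerDl.
have -> : F (z + h) - F z - L h =
    (F w - F z - l1 h *: 'D_e1 F z) + (F (w + l2 h *: e2) - F w - l2 h *: 'D_e2 F z).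
  have -> : w + l2 h *: e2 = z + h by rewrite /w -addrA -le.
  rewrite [L h]/(_ + _) [RHS]addrACA -opprD; congr (_ - _).
  by rewrite addrC addrA subrK.
rewrite (le_trans (ler_normD _ _))// (le_trans (lerD B1 B2))//.
rewrite -!mulrDr (@le_trans _ _ (C * (mu * ((k1 + k2) * `|h|))))//.
  by rewrite !ler_wpM2l ?(ltW C0) ?(ltW mu0)// mulrDl lerD.
by rewrite le_eqVlt /mu; apply/orP; left; apply/eqP; field; lra.
Qed.

End Frames.

(** * Functions of class C^k *)

Section Ck.
Context {R : realType}.
Implicit Types U V W : normedModType R.

(* Unlike [smoothn k], [Ck 0] is mere continuity, which is where the
   bootstrap from a continuous fixed point has to start. *)
Fixpoint Ck V W k (f : V -> W) : Prop :=
  if k is j.+1 then (forall x, differentiable f x) /\ forall v, Ck j ('D_v f)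
  else continuous f.

Lemma Ck_continuous V W k (f : V -> W) : Ck k f -> continuous f.
Proof. by case: k => [//|k] [df _] x; exact: differentiable_continuous. Qed.

Lemma CkW V W k (f : V -> W) : Ck k.+1 f -> Ck k f.
Proof.
elim: k f => [|k IH] f; first exact: (@Ck_continuous V W 1).
by move=> [df Df]; split=> // v; apply: IH; exact: Df.
Qed.

Lemma Ck_smoothn V W k (f : V -> W) : Ck k.+1 f -> smoothn k f.
Proof.
elim: k f => [|k IH] f; first by move=> [df _]; apply/smoothn0.
by move=> [df Df]; apply/smoothnS; split=> // v; apply: IH; exact: Df.
Qed.

Lemma smoothCk V W (f : V -> W) : smooth f <-> forall k, Ck k f.
Proof.
split=> [sf k|Cf]; last by apply/smoothnP => k; apply: Ck_smoothn; exact: Cf.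
elim: k f sf => [|k IH] f sf.
  by move=> x; apply: differentiable_continuous; exact: smooth_differentiable.
by split=> [x|v]; [exact: smooth_differentiable|apply: IH; exact: smooth_derive].
Qed.

Lemma CkD V W k (f g : V -> W) : Ck k f -> Ck k g -> Ck k (f + g).
Proof.
elim: k f g => [|k IH] f g; first by move=> cf cg x; apply: cvgD; [exact: cf|exact: cg].
move=> [df Df] [dg Dg]; split=> [x|v]; first exact: differentiableD.
by rewrite deriveDE//; apply: IH; [exact: Df|exact: Dg].
Qed.

Lemma CkN V W k (f : V -> W) : Ck k f -> Ck k (- f).
Proof.
elim: k f => [|k IH] f; first by move=> cf x; apply: cvgN; exact: cf.
move=> [df Df]; split=> [x|v]; first exact: differentiableN.
by rewrite deriveNE//; apply: IH; exact: Df.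
Qed.

Lemma CkB V W k (f g : V -> W) : Ck k f -> Ck k g -> Ck k (f - g).
Proof. by move=> Cf Cg; apply: CkD => //; exact: CkN. Qed.

Lemma CkZ V W k (a : V -> R) (f : V -> W) :
  Ck k a -> Ck k f -> Ck k (fun x => a x *: f x).
Proof.
elim: k a f => [|k IH] a f.
  by move=> ca cf x; apply: cvgZ; [exact: ca|exact: cf].
move=> Ca Cf; have [a0 a1] := Ca; have [f0 f1] := Cf; split=> [x|v].
  by have [] := is_diffZ_fun (a0 x) (f0 x).
have -> : 'D_v (fun x => a x *: f x) =
    (fun x => 'D_v a x *: f x) + (fun x => a x *: 'D_v f x).
  by apply/funext => x; have [_ ->] := is_diffZ_fun (a0 x) (f0 x).
by apply: CkD; apply: IH; by [exact: CkW|exact: a1|exact: f1].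
Qed.

Lemma Ck_cst V W k (w : W) : Ck k (cst w : V -> W).
Proof. by move: k; apply/smoothCk/smoothnP => k; exact: smoothn_cst. Qed.

Lemma Ck_scale V W k (a : R) (f : V -> W) : Ck k f -> Ck k (fun x => a *: f x).
Proof. by move=> Cf; apply: (CkZ (Ck_cst V k a)). Qed.

Lemma Ck_sum V W k m (f : 'I_m -> V -> W) :
  (forall i, Ck k (f i)) -> Ck k (\sum_i f i).
Proof.
move=> Cf; elim/big_ind: _ => //; [exact: (Ck_cst V k (0 : W))|exact: CkD].
Qed.

Lemma Ck_lin U V W k (c : {linear V -> W}) (f : U -> V) :
  continuous c -> Ck k f -> Ck k (c \o f).
Proof.
move=> cc; elim: k f => [|k IH] f.
  by move=> cf x; apply: continuous_comp; [exact: cf|exact: cc].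
move=> [f0 f1]; split=> [x|v]; first by have [] := deriveLin 0 cc (f0 x).
suff -> : 'D_v (c \o f) = c \o 'D_v f by apply: IH; exact: f1.
by apply/funext => x; have [] := deriveLin v cc (f0 x).
Qed.

Lemma Ck_comp U V W m (b : 'I_m -> V) (c : 'I_m -> {linear V -> R})
    k (g : V -> W) (f : U -> V) :
  coordinates b c -> Ck k g -> Ck k f -> Ck k (g \o f).
Proof.
move=> bc; elim: k g f => [|k IH] g f.
  by move=> cg cf x; apply: continuous_comp; [exact: cf|exact: cg].
move=> Cg Cf; have [g0 g1] := Cg; have [f0 f1] := Cf; split=> [x|v].
  by apply: differentiable_comp.
have -> : 'D_v (g \o f) =
    \sum_i (fun x => (c i \o 'D_v f) x *: ('D_(b i) g \o f) x).
  by apply/funext => x; rewrite fct_sumE (chain_rule v bc).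
apply: Ck_sum => i; apply: CkZ; first by apply: Ck_lin; [exact: (proj1 bc)|exact: f1].
by apply: IH; [exact: g1|exact: CkW].
Qed.

Lemma derive_comp_lin U V W (L : {linear U -> V}) (f : V -> W) :
  continuous L -> (forall y, differentiable f y) ->
  forall x, differentiable (f \o L) x /\ forall v, 'D_v (f \o L) x = 'D_(L v) f (L x).
Proof.
move=> cL df x; have dL := linear_differentiable x cL.
split=> [|v]; first exact: differentiable_comp.
rewrite deriveE; last exact: differentiable_comp.
rewrite diff_comp//= (diff_lin _ cL) deriveE//.
Qed.

Lemma Ck_comp_lin U V W k (L : {linear U -> V}) (f : V -> W) :
  continuous L -> Ck k f -> Ck k (f \o L).
Proof.
move=> cL; elim: k f => [|k IH] f.
  by move=> cf x; apply: continuous_comp; [exact: cL|exact: cf].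
move=> [df Df]; split=> [x|v]; first by have [] := derive_comp_lin cL df x.
have -> : 'D_v (f \o L) = 'D_(L v) f \o L.
  by apply/funext => x; have [_ ->] := derive_comp_lin cL df x.
by apply: IH; exact: Df.
Qed.

End Ck.

(** * Integration along characteristics *)

Section CharInt.
Context {R : realType} {V K : normedModType R}.
Variables (m : nat) (b : 'I_m -> K) (c : 'I_m -> {linear K -> R}).
Hypothesis bc : coordinates b c.
Variable C : R.
Hypothesis HC : mean_value_constant K C.

(* Meaningful for continuous [g] only. *)
Definition primitive (g : R -> K) : R -> K :=
  get [set F : R -> K | forall y : R, is_derive y 1 F (g y)].

Lemma primitiveP g : continuous g -> forall y : R, is_derive y 1 (primitive g) (g y).
Proof.
move=> /(antiderivative bc) [F HF].
exact: (@getPex (R -> K) [set F | forall y : R, is_derive y 1 F (g y)]) (ex_intro _ F HF).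
Qed.

Section OneFrame.
Variables (e1 e2 : V) (l1 l2 : {linear V -> R}).
Hypothesis fr : frame e1 e2 l1 l2.
Implicit Types (G : V -> K) (z : V).

(* The integral of [G] along the direction [e2], from the diagonal [l1 = l2]
   to the point [z]. *)
Definition charint (e1 e2 : V) (l1 l2 : V -> R) (G : V -> K) (z : V) : K :=
  let F := primitive (fun y => G (l1 z *: e1 + y *: e2)) in F (l2 z) - F (l1 z).

Let A := charint e1 e2 l1 l2.
Let diag z : V := l1 z *: (e1 + e2).

Lemma charint_diag0 G z : l1 z = l2 z -> A G z = 0.
Proof. by rewrite /A /charint => ->; rewrite subrr. Qed.

Lemma frame_line1 z (s : R) : l1 (z + s *: e1) = l1 z + s /\ l2 (z + s *: e1) = l2 z.
Proof.
case: fr => _ _ _ [E1 E2] _; rewrite !linearD !linearZ/= E1 E2.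
by rewrite [_ *: 1]mulr1 [_ *: 0]mulr0 addr0.
Qed.

Lemma frame_line2 z (s : R) : l1 (z + s *: e2) = l1 z /\ l2 (z + s *: e2) = l2 z + s.
Proof.
case: fr => _ _ _ _ [E1 E2]; rewrite !linearD !linearZ/= E1 E2.
by rewrite [_ *: 0]mulr0 [_ *: 1]mulr1 addr0.
Qed.

Lemma frame_diag z : z = diag z + (l2 z - l1 z) *: e2.
Proof.
case: fr => _ _ le _ _; rewrite [LHS]le /diag scalerDr -addrA; congr (_ + _).
by rewrite -scalerDl addrC subrK.
Qed.

Lemma l_diag z : l1 (diag z) = l1 z /\ l2 (diag z) = l1 z.
Proof.
case: fr => _ _ _ [E1 E2] [E3 E4]; rewrite !linearZ !linearD/= E1 E2 E3 E4.
by rewrite addr0 add0r [_ *: _]mulr1.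
Qed.

(** A move along [e2] leaves [l1 z] fixed, so both values use the same primitive. *)
Lemma charint_derive2 G z : continuous G -> is_derive z e2 (A G) (G z).
Proof.
move=> cG; set g := fun y : R => G (l1 z *: e1 + y *: e2).
have cg : continuous g.
  move=> y; apply: (@continuous_comp R V K (fun y : R => l1 z *: e1 + y *: e2) G); last exact: cG.
  by apply: cvgD; [exact: cvg_cst|exact: scalel_continuous].
have := primitiveP cg (l2 z).
have -> : g (l2 z) = G z by case: fr => _ _ le _ _; rewrite /g -le.
move=> /is_deriveP H; apply/is_deriveP => eps eps0.
have [d d0 Hd] := H _ eps0; exists d => // s sd.
have -> : A G (z + s *: e2) - A G z = primitive g (l2 z + s *: 1) - primitive g (l2 z).
  rewrite /A /charint; have [-> ->] := frame_line2 z s.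
  by rewrite -/g [s *: 1]mulr1 opprB addrA subrK.
exact: Hd.
Qed.

Lemma charint_increment (H : V -> K) z mu :
  (forall y, derivable H y e2) ->
  (forall t : R, 0 <= t <= 1 ->
     `|'D_e2 H (diag z + (t * (l2 z - l1 z)) *: e2)| <= mu) ->
  `|H z - H (diag z)| <= C * (mu * `|l2 z - l1 z|).
Proof.
move=> dH Hmu.
have := @mean_value_line R V K C H (diag z) e2 (l2 z - l1 z) mu 0 HC.
by rewrite -frame_diag scaler0 subr0; apply => // t t01; rewrite subr0; exact: Hmu.
Qed.

Lemma frame_scale_bound : exists2 k, 0 < k &
  forall r, `|r *: e1| <= k * `|r| /\ `|r *: e2| <= k * `|r|.
Proof.
exists (`|e1| + `|e2| + 1) => [|r]; first by rewrite ltr_wpDl// addr_ge0.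
by rewrite !normrZ ![_ * `|r|]mulrC !ler_wpM2l// ?lerDl -?addrA ?lerDl ?addr_ge0// addrCA lerDl addr_ge0.
Qed.

(** Off the diagonal by [s *: e1], the path of integration has signed length [- s]; hence the
    derivative along [e1] at the diagonal is [- G (diag z)]. This is the boundary term of
    [charint_derive1]. *)
Lemma charint_bound1 G z eps : continuous G -> 0 < eps -> exists2 d, 0 < d &
  forall s : R, `|s| < d ->
  `|A G (diag z + s *: e1) + s *: G (diag z)| <= eps * `|s|.
Proof.
move=> cG eps0; have C0 := HC.1.
have [k k0 Hk] := frame_scale_bound.
have [d d0 Hd] := (continuous_atP _ _).1 (cG (diag z)) _ (divr_gt0 eps0 C0).
exists (d / (2 * k)) => [|s sd]; first by rewrite divr_gt0// mulr_gt0.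
have [E1 E2] := frame_line1 (diag z) s.
have [E3 E4] := l_diag z.
pose w := diag z + s *: e1.
have dw : diag w = diag z + s *: (e1 + e2).
  by rewrite /diag /w E1 E3 scalerDl.
have sdd : 2 * (k * `|s|) < d by move: sd; rewrite ltr_pdivlMr ?mulr_gt0//; lra.
have := @mean_value_line R V K C (A G) (diag w) e2 (- s) (eps / C) (G (diag z)) HC.
have -> : diag w + - s *: e2 = w.
  by rewrite dw scalerDr scaleNr addrA addrK.
have -> : A G (diag w) = 0.
  by apply: charint_diag0; have [-> ->] := l_diag w.
rewrite subr0 scaleNr opprK normrN.
have -> : C * (eps / C * `|s|) = eps * `|s| by field; rewrite gt_eqF.
apply=> t t01.
  by have [] := charint_derive2 (diag w + (t * - s) *: e2) cG.
have [_ ->] := charint_derive2 (diag w + (t * - s) *: e2) cG.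
rewrite dw scalerDr -!addrA -scalerDl; apply: Hd.
rewrite (le_lt_trans (ler_normD _ _))// (le_lt_trans _ sdd)//.
rewrite mulr2n mulrDl mul1r lerD//; first by have [] := Hk s.
have [_ H] := Hk (s + t * - s); rewrite (le_trans H)// ler_wpM2l ?(ltW k0)//.
have -> : s + t * - s = (1 - t) * s by ring.
case/andP: t01 => t0 t1.
by rewrite normrM ger0_norm ?subr_ge0// ler_piMl// gerBl.
Qed.

Lemma segment_unif_continuous G z eps : continuous G -> 0 < eps ->
  exists2 d, 0 < d & forall (t : R) (s r : R), 0 <= t <= 1 -> `|s| < d -> `|r| <= `|s| ->
  `|G (diag z + (t * (l2 z - l1 z)) *: e2 + r *: e1) - G (diag z + (t * (l2 z - l1 z)) *: e2)| <= eps.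
Proof.
move=> cG eps0; have [k k0 Hk] := frame_scale_bound.
have [d d0 Hd] := compact_unif_increment
  (@compact_line_segment _ _ (diag z) ((l2 z - l1 z) *: e2)) (fun x _ => cG x) eps0.
exists (d / k) => [|t s r t01 sd rs]; first by rewrite divr_gt0.
apply: Hd; first by exists t; rewrite ?scalerA//= in_itv.
have [H _] := Hk r; rewrite (le_lt_trans H)// mulrC -ltr_pdivlMr//.
exact: le_lt_trans rs sd.
Qed.

Lemma charint_shift_derive2 G (s : R) y : continuous G ->
  is_derive y e2 (fun w => A G (w + s *: e1)) (G (y + s *: e1)).
Proof.
move=> cG; have /is_deriveP H := charint_derive2 (y + s *: e1) cG.
apply/is_deriveP => eps /H[d d0 Hd]; exists d => // r rd.
by have := Hd r rd; rewrite [y + s *: e1 + _]addrAC.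
Qed.

(** Differentiation under the integral sign. For a fixed step [s], the error [H] has along [e2] the
    derivative [G (y + s *: e1) - G y - s *: 'D_e1 G y], which is small compared with [s] uniformly
    on the path, and on the diagonal it reduces to the increment treated by [charint_bound1]. *)
Lemma charint_derive1 G z : continuous G -> (forall y, derivable G y e1) ->
  continuous ('D_e1 G) ->
  is_derive z e1 (A G) (A ('D_e1 G) z - G (diag z)).
Proof.
move=> cG dG cDG; have C0 := HC.1; apply/is_deriveP => eps eps0.
have e20 : 0 < eps / 2 by rewrite divr_gt0.
have [d1 d10 Hd1] := charint_bound1 z cG e20.
pose L := `|l2 z - l1 z| + 1.
have L0 : 0 < L by rewrite ltr_wpDl.
(* Half of [eps] is available for this part; two mean value inequalities cost [C] each, and [L]
   bounds the length of the path. *)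
have mu0 : 0 < eps / (2 * C * C * L) by rewrite divr_gt0// !mulr_gt0.
have [d2 d20 Hd2] := segment_unif_continuous z cDG mu0.
exists (Num.min d1 d2) => [|s]; first by rewrite lt_min d10.
rewrite lt_min => /andP[s1 s2].
pose H (w : V) := A G (w + s *: e1) - A G w - s *: A ('D_e1 G) w.
have dH y : is_derive y e2 H (G (y + s *: e1) - G y - s *: 'D_e1 G y).
  apply: is_deriveB; last by apply: is_deriveZ; exact: charint_derive2.
  by apply: is_deriveB; [exact: charint_shift_derive2|exact: charint_derive2].
have := @charint_increment H z (C * (eps / (2 * C * C * L) * `|s|)).
have -> : H z - H (diag z) = A G (z + s *: e1) - A G z - s *: A ('D_e1 G) z
     - A G (diag z + s *: e1).
  have A0 F : A F (diag z) = 0 by apply: charint_diag0; have [-> ->] := l_diag z.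
  by rewrite /H !A0 scaler0 !subr0.
move=> HH.
have -> : A G (z + s *: e1) - A G z - s *: (A ('D_e1 G) z - G (diag z)) =
  (A G (z + s *: e1) - A G z - s *: A ('D_e1 G) z - A G (diag z + s *: e1)) +
  (A G (diag z + s *: e1) + s *: G (diag z)).
  set p := A G (z + s *: e1) - A G z; set q := A G _; rewrite scalerBr.
  by rewrite [RHS]addrA subrK opprB [LHS]addrA addrAC.
rewrite (le_trans (ler_normD _ _))// [eps]splitr mulrDl lerD//; last exact: Hd1.
have {}HH : `|A G (z + s *: e1) - A G z - s *: A ('D_e1 G) z - A G (diag z + s *: e1)| <=
    C * (C * (eps / (2 * C * C * L) * `|s|) * `|l2 z - l1 z|).
  apply: HH => [y|t t01]; first by have [] := dH y.
  have [_ ->] := dH (diag z + (t * (l2 z - l1 z)) *: e2).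
  apply: mean_value_line => // r /andP[r0 r1]; apply: (Hd2 t s (r * s)) => //.
  by rewrite normrM (ger0_norm r0) ler_piMl.
rewrite (le_trans HH)//.
have -> : C * (C * (eps / (2 * C * C * L) * `|s|) * `|l2 z - l1 z|) =
    (eps / 2 * `|s|) * (`|l2 z - l1 z| / L) by field; rewrite !gt_eqF.
have es0 : 0 <= eps / 2 * `|s| by rewrite mulr_ge0// ltW.
by rewrite ler_piMr// ler_pdivrMr// mul1r lerDl.
Qed.

(** The increment is split in three: along [e2] from [w], the change of [H] along the path from the
    diagonal to [z], and the value of [H] on the diagonal. Each is at most [eps / 4]. *)
Lemma charint_continuous G : continuous G -> continuous (A G).
Proof.
move=> cG z; have C0 := HC.1; apply/continuous_atP => eps eps0.
have [k k0 Hk] := frame_scale_bound.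
case: fr => cl1 cl2 le _ _.
have [k1 k10 Hk1] := linear_lipschitz cl1; have [k2 k20 Hk2] := linear_lipschitz cl2.
pose L := `|l2 z - l1 z| + 1; have L0 : 0 < L by rewrite ltr_wpDl.
(* Bounds with tolerance 1: [M] for [G] near [z], and [N * |s|] for [A G (diag z + s *: e1)]. *)
pose M := `|G z| + 1; have M0 : 0 < M by rewrite ltr_wpDl.
pose N := 1 + `|G (diag z)|; have N0 : 0 < N by rewrite ltr_pwDl.
have [d1 d10 Hd1] := (continuous_atP _ _).1 (cG z) _ (ltr01 : 0 < (1 : R)).
have mu0 : 0 < eps / (4 * C * L) by rewrite divr_gt0// !mulr_gt0.
have [d2 d20 Hd2] := segment_unif_continuous z cG mu0.
have [d3 d30 Hd3] := charint_bound1 z cG (ltr01 : 0 < (1 : R)).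
pose d4 := Num.min (Num.min d2 d3)
  (Num.min (d1 / (2 * k)) (Num.min (eps / (4 * N)) (eps / (4 * C * M)))).
have d40 : 0 < d4 by rewrite !lt_min d20 d30 !divr_gt0 ?mulr_gt0.
exists (d4 / (k1 + k2)) => [|h]; first by rewrite divr_gt0// addr_gt0.
rewrite ltr_pdivlMr ?addr_gt0// => hd.
have hx : `|l1 h| < d4.
  rewrite (le_lt_trans (Hk1 h))// (le_lt_trans _ hd)// mulrC ler_wpM2l// lerDl.
  exact: ltW.
have hy : `|l2 h| < d4.
  rewrite (le_lt_trans (Hk2 h))// (le_lt_trans _ hd)// mulrC ler_wpM2l// lerDr.
  exact: ltW.
move: hx hy; rewrite !lt_min => /andP[/andP[x2 x3] /andP[x4 /andP[x5 _]]].
move=> /andP[_ /andP[y4 /andP[_ y5]]].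
pose w := z + l1 h *: e1.
pose H (w : V) := A G (w + l1 h *: e1) - A G w.
have dH y : is_derive y e2 H (G (y + l1 h *: e1) - G y).
  by apply: is_deriveB; [exact: charint_shift_derive2|exact: charint_derive2].
have B1 : `|A G (w + l2 h *: e2) - A G w| <= C * (M * `|l2 h|).
  have := @mean_value_line R V K C (A G) w e2 (l2 h) M 0 HC.
  rewrite scaler0 subr0; apply => t t01.
    by have [] := charint_derive2 (w + (t * l2 h) *: e2) cG.
  have [_ ->] := charint_derive2 (w + (t * l2 h) *: e2) cG.
  rewrite subr0 -[X in `|X|](subrK (G z)) (le_trans (ler_normD _ _))//.
  rewrite /M [leLHS]addrC lerD//.
  rewrite -addrA; apply: Hd1; rewrite (le_lt_trans (ler_normD _ _))//.
  have [h1 _] := Hk (l1 h); have [_ h2] := Hk (t * l2 h).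
  have h3 : k * `|t * l2 h| <= k * `|l2 h|.
    by case/andP: t01 => t0 t1; rewrite ler_wpM2l ?(ltW k0)// normrM ger0_norm// ler_piMl.
  by move: x4 y4; rewrite !ltr_pdivlMr ?mulr_gt0//; lra.
have B2 : `|H z - H (diag z)| <= C * (eps / (4 * C * L) * `|l2 z - l1 z|).
  apply: charint_increment => [y|t t01]; first by have [] := dH y.
  by have [_ ->] := dH (diag z + (t * (l2 z - l1 z)) *: e2); exact: (Hd2 t (l1 h) (l1 h) t01 x2 (lexx _)).
have B3 : `|H (diag z)| <= N * `|l1 h|.
  have -> : H (diag z) = (A G (diag z + l1 h *: e1) + l1 h *: G (diag z)) - l1 h *: G (diag z).
    have A0 : A G (diag z) = 0 by apply: charint_diag0; have [-> ->] := l_diag z.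
    by rewrite /H addrK A0 subr0.
  rewrite (le_trans (ler_normB _ _))// mulrDl lerD//; first exact: Hd3.
  by rewrite normrZ mulrC.
have -> : A G (z + h) - A G z = (A G (w + l2 h *: e2) - A G w) + ((H z - H (diag z)) + H (diag z)).
  have -> : z + h = w + l2 h *: e2 by rewrite /w -addrA -le.
  by rewrite subrK /H [RHS]addrA subrK.
rewrite (le_trans (ler_normD _ _))// (le_trans (lerD B1 (ler_normD _ _)))//.
have B1' : C * (M * `|l2 h|) <= eps / 4.
  move: y5; rewrite ltr_pdivlMr ?mulr_gt0// => y5; rewrite ler_pdivlMr//.
  by rewrite ltW// (le_lt_trans _ y5)// le_eqVlt; apply/orP; left; apply/eqP; ring.
have B3' : N * `|l1 h| <= eps / 4.
  move: x5; rewrite ltr_pdivlMr ?mulr_gt0// => x5; rewrite ler_pdivlMr//.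
  by rewrite ltW// (le_lt_trans _ x5)// le_eqVlt; apply/orP; left; apply/eqP; ring.
have B2' : C * (eps / (4 * C * L) * `|l2 z - l1 z|) <= eps / 4.
  have -> : C * (eps / (4 * C * L) * `|l2 z - l1 z|) = eps / 4 * (`|l2 z - l1 z| / L).
    by field; rewrite !gt_eqF.
  have e40 : 0 <= eps / 4 by rewrite divr_ge0// ltW.
  by rewrite ler_piMr// ler_pdivrMr// mul1r lerDl.
by move: eps0; lra.
Qed.

(** Along [e2] the derivative is [G]; along [e1] it is [A ('D_e1 G) - (G \o D)] with [D] the
    projection to the diagonal along [e2], and the induction hypothesis applies to ['D_e1 G]. *)
Lemma Ck_charint k G : Ck k G -> Ck k (A G).
Proof.
have diagL : linear diag by move=> a u v; rewrite /diag linearP scalerDl scalerA.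
pose D : {linear V -> V} := HB.pack diag (GRing.isLinear.Build R V V _ _ diagL).
case: (fr) => cl1 cl2 _ _ _.
have cD : continuous D.
  move=> z; apply: (@continuous_comp _ _ _ l1 (fun t : R => t *: (e1 + e2))); first exact: cl1.
  exact: scalel_continuous.
elim: k G => [|k IH] G; first exact: charint_continuous.
move=> CG; have cG := Ck_continuous CG; have [dG DG] := CG.
have dG1 y : derivable G y e1 by exact: diff_derivable.
have cDG : continuous ('D_e1 G) by apply: (@Ck_continuous _ _ _ k); exact: DG.
have D1 z := charint_derive1 z cG dG1 cDG.
have D2 z := charint_derive2 z cG.
have E1 : 'D_e1 (A G) = A ('D_e1 G) - (G \o D).
  by apply/funext => z; have [_ ->] := D1 z.
have E2 : 'D_e2 (A G) = G by apply/funext => z; have [_ ->] := D2 z.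
have C1 : Ck k ('D_e1 (A G)).
  rewrite E1; apply: CkB; first by apply: IH; exact: DG.
  by apply: Ck_comp_lin => //; exact: CkW.
have C2 : Ck k ('D_e2 (A G)) by rewrite E2; exact: CkW.
have H := @differentiable_frame R V K C e1 e2 l1 l2 (A G) HC fr
  (fun z => @ex_derive _ _ _ _ _ _ _ (D1 z)) (fun z => @ex_derive _ _ _ _ _ _ _ (D2 z))
  (Ck_continuous C1) (Ck_continuous C2).
split=> [x|v]; first by have [] := H x.
have -> : 'D_v (A G) = (fun z => l1 v *: 'D_e1 (A G) z) + (fun z => l2 v *: 'D_e2 (A G) z).
  by apply/funext => z; have [_ ->] := H z.
by apply: CkD; exact: Ck_scale.
Qed.

End OneFrame.
End CharInt.

(** * The semilinear problem for a fixed parameter *)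

Section Picard.
Context {R : realType} {V K : normedModType R}.
Variables (m : nat) (b : 'I_m -> K) (c : 'I_m -> {linear K -> R}).
Hypothesis bc : coordinates b c.
Variable C : R.
Hypothesis HC : mean_value_constant K C.

Definition square (l1 l2 : V -> R) (T : R) : set V :=
  [set z | `|l1 z| <= T /\ `|l2 z| <= T].

Lemma square_swap l1 l2 T : square l2 l1 T = square l1 l2 T.
Proof. by apply/seteqP; split=> z [? ?]. Qed.

(* Integrating the weight [expR (la * |l2 - l1|)] gains a factor [1 / la]: this
   is what makes the Picard map a contraction for large [la]. *)
Lemma charint_exp (e1 e2 : V) (l1 l2 : {linear V -> R}) (H : V -> K) T M la :
  frame e1 e2 l1 l2 -> 0 < la -> 0 <= M -> (forall y, derivable H y e2) ->
  (forall y, square l1 l2 T y -> `|'D_e2 H y| <= M * expR (la * `|l2 y - l1 y|)) ->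
  forall z, square l1 l2 T z ->
  `|H z - H (l1 z *: (e1 + e2))| <= C * M / la * expR (la * `|l2 z - l1 z|).
Proof.
move=> fr la0 M0 dH HM z [z1 z2].
have := @mean_value_exp R K C (fun y => H (l1 z *: (e1 + e2) + y *: e2))
  (fun y => 'D_e2 H (l1 z *: (e1 + e2) + y *: e2)) 0 (l2 z - l1 z) M la HC la0 M0.
rewrite -(frame_diag fr) scale0r addr0 subr0; apply=> t /andP[t0 t1]; rewrite add0r.
  exact/is_derive_line/dH.
have [E1 E2] := frame_line2 fr (l1 z *: (e1 + e2)) (t * (l2 z - l1 z)).
have [E3 E4] := l_diag fr z.
have -> : t * `|l2 z - l1 z| = `|t * (l2 z - l1 z)| by rewrite normrM ger0_norm.
move: E1 E2; rewrite E3 E4; set w := _ + _ => E1 E2.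
have -> : t * (l2 z - l1 z) = l2 w - l1 w by rewrite E1 E2 [l1 z + _]addrC addrK.
apply: HM; split; rewrite ?E1// E2.
(* Along the path the second coordinate is a convex combination of [l1 z] and [l2 z], so the path
   stays in the square: squares contain their domains of dependence. *)
have -> : l1 z + t * (l2 z - l1 z) = (1 - t) * l1 z + t * l2 z by ring.
rewrite (le_trans (ler_normD _ _))// !normrM (ger0_norm t0) ger0_norm ?subr_ge0//.
have -> : T = (1 - t) * T + t * T by ring.
by rewrite lerD// ler_wpM2l// subr_ge0.
Qed.

Lemma le0_geometric (a B : R) : (forall n, a <= B / 2 ^+ n) -> a <= 0.
Proof.
move=> aB; rewrite leNgt; apply/negP => a0.
pose n := (Num.truncn (B / a)).+1.
have : B / a < 2 ^+ n.
  rewrite (lt_le_trans (truncnS_gt _))// -natrX ler_nat ltnW//.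
  exact: ltn_expl.
rewrite ltr_pdivrMr// => Ba; have := aB n.
by rewrite ler_pdivlMr ?exprn_gt0// leNgt mulrC Ba.
Qed.

Definition geometric_increments (W : normedModType R) (x : nat -> W) (M : R) :=
  forall n, `|x n.+1 - x n| <= M / 2 ^+ n.

(** The bound is the exact geometric sum from [n] to [k - 1], so that the induction closes with
    equality. *)
Lemma geometric_cauchy (W : normedModType R) (x : nat -> W) M n k :
  geometric_increments x M -> (n <= k)%N ->
  `|x n - x k| <= 2 * M / 2 ^+ n - 2 * M / 2 ^+ k.
Proof.
move=> xM /subnKC <-; elim: {k}(k - n)%N => [|k IH].
  by rewrite addn0 !subrr normr0.
rewrite addnS -[x n](subrK (x (n + k)%N)) -addrA (le_trans (ler_normD _ _))//.
have := lerD IH (xM (n + k)%N); rewrite [`|x (n + k).+1 - _|]distrC => /le_trans; apply.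
by rewrite le_eqVlt exprS; apply/orP; left; apply/eqP; field; rewrite !expf_neq0.
Qed.

(** Nested intervals: the limit is the supremum of the lower ends [y n - 2 * M / 2 ^+ n], each of
    which lies below every upper end. *)
Lemma geometric_limit_real (y : nat -> R) M : 0 <= M ->
  geometric_increments y M -> exists l, forall n, `|y n - l| <= 2 * M / 2 ^+ n.
Proof.
move=> M0 yM.
have nM n : 0 <= 2 * M / 2 ^+ n :> R by rewrite !mulr_ge0// invr_ge0 exprn_ge0.
have yy n k : y n - 2 * M / 2 ^+ n <= y k + 2 * M / 2 ^+ k.
  have H : `|y n - y k| <= 2 * M / 2 ^+ n + 2 * M / 2 ^+ k.
    case: (leqP n k) => [nk|/ltnW kn].
      by have := geometric_cauchy yM nk; move: (nM n) (nM k); lra.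
    by rewrite distrC; have := geometric_cauchy yM kn; move: (nM n) (nM k); lra.
  by move: H; rewrite ler_norml => /andP[]; lra.
pose E : set R := [set y n - 2 * M / 2 ^+ n | n in setT].
have E0 : E !=set0 by exists (y 0%N - 2 * M / 2 ^+ 0); exists 0%N.
have uE k : ubound E (y k + 2 * M / 2 ^+ k) by move=> _ [n _ <-].
exists (sup E) => n.
have h1 : y n - 2 * M / 2 ^+ n <= sup E.
  by apply: ub_le_sup; [exists (y 0%N + 2 * M / 2 ^+ 0); exact: uE|exists n].
have h2 : sup E <= y n + 2 * M / 2 ^+ n by apply: ge_sup.
by rewrite ler_norml; apply/andP; split; lra.
Qed.

(** Completeness through coordinates. The limit depends on [x] alone while the rate holds for every
    admissible [M]: pointwise limits later inherit one rate on a whole square. *)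
Lemma geometric_limit : exists2 D : R, 0 <= D & forall x : nat -> K,
  (exists2 M, 0 <= M & geometric_increments x M) ->
  exists l, forall M, geometric_increments x M -> forall n, `|x n - l| <= D * M / 2 ^+ n.
Proof.
have [cc ce] := bc.
have /choice[k Hk] : forall i : 'I_m, exists k, 0 < k /\ forall x, `|c i x| <= k * `|x|.
  by move=> i; have [k k0 kP] := linear_lipschitz (cc i); exists k.
pose D := \sum_i 2 * k i * `|b i|.
have D0 : 0 <= D by apply: sumr_ge0 => i _; rewrite !mulr_ge0// ltW// (Hk i).1.
have M0 (x : nat -> K) M : geometric_increments x M -> 0 <= M.
  by move=> /(_ 0%N); rewrite expr0 divr1; exact: le_trans.
have lim (x : nat -> K) M : geometric_increments x M ->
    exists l, forall n, `|x n - l| <= D * M / 2 ^+ n.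
  move=> xM.
  have /choice[l Hl] : forall i : 'I_m, exists l, forall n,
      `|c i (x n) - l| <= 2 * (k i * M) / 2 ^+ n.
    move=> i; apply: geometric_limit_real => [|n].
      by rewrite mulr_ge0 ?(M0 _ _ xM)// ltW// (Hk i).1.
    rewrite -linearB (le_trans ((Hk i).2 _))// -mulrA ler_wpM2l ?(ltW (Hk i).1)//.
  exists (\sum_i l i *: b i) => n.
  rewrite {1}[x n]ce -sumrB (le_trans (ler_norm_sum _ _ _))// /D mulr_suml mulr_suml.
  apply: ler_sum => i _; rewrite -scalerBl normrZ.
  rewrite (le_trans (ler_wpM2r _ (Hl i n)))//.
  by rewrite le_eqVlt; apply/orP; left; apply/eqP; ring.
exists D => // x [M _ xM]; have [l Hl] := lim x M xM; exists l => M' xM' n.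
have [l' Hl'] := lim x M' xM'; suff -> : l = l' by [].
apply/eqP; rewrite -subr_eq0 -normr_le0; apply: (@le0_geometric _ (D * M + D * M')) => j.
rewrite -(subrK (x j) l) -addrA (le_trans (ler_normD _ _))// mulrDl lerD//.
by rewrite distrC.
Qed.

Variables (e1 e2 : V) (l1 l2 : {linear V -> R}).
Hypothesis fr : frame e1 e2 l1 l2.
Local Notation A := (charint e1 e2 l1 l2).
Local Notation B := (charint e2 e1 l2 l1).
Local Notation diag z := (l1 z *: (e1 + e2)).

Lemma square_compact T : compact (square l1 l2 T).
Proof.
have [cl1 cl2 le [E1 E2] [E3 E4]] := fr.
have -> : square l1 l2 T =
    (fun p : R * R => p.1 *: e1 + p.2 *: e2) @` (`[- T, T] `*` `[- T, T]).
  apply/seteqP; split=> [z [z1 z2]|_ [[x y] [/= x1 y1] <-]].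
    exists (l1 z, l2 z); last exact/esym/le.
    by split; rewrite /= in_itv/= -ler_norml.
  move: x1 y1; rewrite /= !in_itv/= -!ler_norml => x1 y1.
  rewrite /square/= !linearD !linearZ/= E1 E2 E3 E4.
  by rewrite ![_ *: 1]mulr1 ![_ *: 0]mulr0 addr0 add0r.
apply: continuous_compact; last by apply: compact_setX; exact: segment_compact.
apply: continuous_subspaceT => p; apply: cvgD.
  apply: (@continuous_comp _ _ _ (fun p : R * R => p.1) (fun t : R => t *: e1)); first exact: cvg_fst.
  exact: scalel_continuous.
apply: (@continuous_comp _ _ _ (fun p : R * R => p.2) (fun t : R => t *: e2)); first exact: cvg_snd.
exact: scalel_continuous.
Qed.

Lemma compact_square (S : set V) : compact S -> exists2 T : R, 0 <= T & S `<=` square l1 l2 T.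
Proof.
move=> cS; have [cl1 cl2 le _ _] := fr.
have [k1 k10 Hk1] := linear_lipschitz cl1; have [k2 k20 Hk2] := linear_lipschitz cl2.
have [M [_ HM]] := compact_bounded cS.
have {}HM := HM (`|M| + 1) (ltr_pwDr ltr01 (ler_norm M)).
exists ((k1 + k2) * (`|M| + 1)) => [|z Sz]; first by rewrite mulr_ge0// ?addr_ge0// ltW.
split; [rewrite (le_trans (Hk1 z))//|rewrite (le_trans (Hk2 z))//];
  by rewrite ler_pM ?(ltW k10) ?(ltW k20) ?lerDl ?lerDr ?(ltW k10) ?(ltW k20)//; exact: HM.
Qed.

Lemma square_bounded (G : V -> K) T : continuous G ->
  exists2 M, 0 <= M & forall z, square l1 l2 T z -> `|G z| <= M.
Proof.
move=> cG; have cS : compact (G @` square l1 l2 T).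
  by apply: continuous_compact; [exact: continuous_subspaceT|exact: square_compact].
have [M [_ HM]] := compact_bounded cS.
exists (`|M| + 1) => [|z Sz]; first by rewrite addr_ge0.
by apply: (HM (`|M| + 1)); [rewrite ltr_pwDr// ler_norm|exists z].
Qed.

Local Notation J := (fun G => B (A G)).
Let rf := frame_swap fr.

Lemma charint2_derive1 (G : V -> K) z : continuous G -> is_derive z e1 (J G) (A G z).
Proof.
by move=> cG; apply: (charint_derive2 bc rf); exact: (charint_continuous bc HC fr).
Qed.

(** The swapped [charint_derive1] applied to [A G]: the derivative of [A G] along [e2] is [G], and
    the boundary term vanishes because [A G] is zero on the diagonal. *)
Lemma charint2_derive2 (G : V -> K) z : continuous G -> is_derive z e2 (J G) (B G z).
Proof.
move=> cG; have cA := charint_continuous bc HC fr cG.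
have D2 y := charint_derive2 bc fr y cG.
have E2 : 'D_e2 (A G) = G by apply/funext => y; have [_ ->] := D2 y.
have dA y : derivable (A G) y e2 by have [] := D2 y.
have := @charint_derive1 _ _ _ _ _ _ bc C HC _ _ _ _ rf (A G) z cA dA.
rewrite E2 => /(_ cG); rewrite (_ : A G (l2 z *: (e2 + e1)) = 0) ?subr0//.
apply: charint_diag0; have [-> ->] := l_diag rf z => //.
Qed.

(** The first derivatives of [J G] along the frame are [A G] and [B G], which are as regular as
    [G]. *)
Lemma Ck_charint2 k (G : V -> K) : Ck k G -> Ck k.+1 (J G).
Proof.
move=> CG; have cG := Ck_continuous CG.
have D1 z := charint2_derive1 z cG; have D2 z := charint2_derive2 z cG.
have E1 : 'D_e1 (J G) = A G by apply/funext => z; have [_ ->] := D1 z.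
have E2 : 'D_e2 (J G) = B G by apply/funext => z; have [_ ->] := D2 z.
have C1 : Ck k ('D_e1 (J G)) by rewrite E1; exact: (Ck_charint bc HC fr).
have C2 : Ck k ('D_e2 (J G)) by rewrite E2; exact: (Ck_charint bc HC rf).
have H := @differentiable_frame R V K C e1 e2 l1 l2 (J G) HC fr
  (fun z => @ex_derive _ _ _ _ _ _ _ (D1 z)) (fun z => @ex_derive _ _ _ _ _ _ _ (D2 z))
  (Ck_continuous C1) (Ck_continuous C2).
split=> [x|v]; first by have [] := H x.
have -> : 'D_v (J G) = (fun z => l1 v *: 'D_e1 (J G) z) + (fun z => l2 v *: 'D_e2 (J G) z).
  by apply/funext => z; have [_ ->] := H z.
by apply: CkD; exact: Ck_scale.
Qed.

(** Two uses of [charint_exp], each gaining [C / la]: the differences under [A] and under [J] vanish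
    on the diagonal, and their derivatives along [e2] and [e1] are the preceding differences. *)
Lemma charint2_exp (G1 G2 : V -> K) T M la : continuous G1 -> continuous G2 ->
  0 < la -> 0 <= M ->
  (forall y, square l1 l2 T y -> `|G1 y - G2 y| <= M * expR (la * `|l2 y - l1 y|)) ->
  forall z, square l1 l2 T z ->
  `|J G1 z - J G2 z| <= C * (C * M / la) / la * expR (la * `|l2 z - l1 z|).
Proof.
move=> c1 c2 la0 M0 GM; have C0 := HC.1.
have D2 y : is_derive y e2 (A G1 - A G2) (G1 y - G2 y).
  by apply: is_deriveB; exact: (charint_derive2 bc fr).
have AM y : square l1 l2 T y ->
    `|A G1 y - A G2 y| <= C * M / la * expR (la * `|l2 y - l1 y|).
  move=> Ty; have A0 : (A G1 - A G2) (diag y) = 0.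
    have [E1 E2] := l_diag fr y.
    by rewrite -[LHS]/(A G1 (diag y) - A G2 (diag y)) !charint_diag0 ?subrr// E1 E2.
  have := @charint_exp e1 e2 l1 l2 (A G1 - A G2) T M la fr la0 M0
    (fun x => @ex_derive _ _ _ _ _ _ _ (D2 x)) _ y Ty.
  rewrite A0 subr0; apply=> x Tx.
  by have [_ ->] := D2 x; exact: GM.
have D1 y : is_derive y e1 (J G1 - J G2) (A G1 y - A G2 y).
  by apply: is_deriveB; exact: charint2_derive1.
move=> z Tz; have B0 : (J G1 - J G2) (l2 z *: (e2 + e1)) = 0.
  have [E1 E2] := l_diag rf z.
  by rewrite -[LHS]/(B (A G1) _ - B (A G2) _) !charint_diag0 ?subrr// E1 E2.
have CM0 : 0 <= C * M / la by rewrite divr_ge0 ?mulr_ge0// ltW.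
have Tz' : square l2 l1 T z by rewrite square_swap.
have := @charint_exp e2 e1 l2 l1 (J G1 - J G2) T (C * M / la) la rf la0 CM0
  (fun x => @ex_derive _ _ _ _ _ _ _ (D1 x)) _ z Tz'.
rewrite B0 subr0 [`|l2 z - _|]distrC; apply=> y.
by rewrite square_swap => Ty; have [_ ->] := D1 y; rewrite [`|l1 y - _|]distrC; exact: AM.
Qed.

Section FixedPoint.
Variables (f : K -> K) (u0 h : V -> K) (L : R).
Hypotheses (L0 : 0 < L) (Lf : forall x y, `|f x - f y| <= L * `|x - y|).
Hypotheses (cu0 : continuous u0) (ch : continuous h).

Let cf : continuous f.
Proof.
move=> x; apply/continuous_atP => eps eps0; exists (eps / L) => [|d dd].
  by rewrite divr_gt0.
rewrite (le_trans (Lf _ _))// addrAC subrr add0r.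
by move: dd; rewrite ltr_pdivlMr// mulrC => /ltW.
Qed.

Let src (u : V -> K) : V -> K := (f \o u) + h.
Let Phi (u : V -> K) : V -> K := u0 - J (src u).

Let csrc u : continuous u -> continuous (src u).
Proof.
move=> cu x; apply: cvgD; last exact: ch.
by apply: continuous_comp; [exact: cu|exact: cf].
Qed.

Let cPhi u : continuous u -> continuous (Phi u).
Proof.
move=> cu x; apply: cvgB; first exact: cu0.
by apply: (charint_continuous bc HC rf); apply: (charint_continuous bc HC fr); exact: csrc.
Qed.

(** Two integrations and the Lipschitz bound multiply the weighted norm by [C * C * L / (la * la)],
    at most one half for this [la]. The value does not depend on the square, so one iteration serves
    all squares. *)
Let la := 2 * C * (L + 1).

Let la0 : 0 < la. Proof. by rewrite !mulr_gt0 ?HC.1// addr_gt0. Qed.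

Let Phi_contract v w T M : continuous v -> continuous w -> 0 <= M ->
  (forall y, square l1 l2 T y -> `|v y - w y| <= M * expR (la * `|l2 y - l1 y|)) ->
  forall z, square l1 l2 T z -> `|Phi v z - Phi w z| <= M / 2 * expR (la * `|l2 z - l1 z|).
Proof.
move=> cv cw M0 vw z Tz.
have -> : Phi v z - Phi w z = B (A (src w)) z - B (A (src v)) z.
  rewrite -[Phi v z]/(u0 z - B (A (src v)) z) -[Phi w z]/(u0 z - B (A (src w)) z).
  move: (u0 z) (B (A (src v)) z) (B (A (src w)) z) => p q r.
  by rewrite opprB [LHS]addrC addrA subrK.
have C0 := HC.1.
have LM0 : 0 <= L * M by rewrite mulr_ge0// ltW.
have bd y : square l1 l2 T y ->
    `|src v y - src w y| <= L * M * expR (la * `|l2 y - l1 y|).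
  move=> Ty; have -> : src v y - src w y = f (v y) - f (w y).
    by rewrite -[src v y]/(f (v y) + h y) -[src w y]/(f (w y) + h y) opprD addrACA subrr addr0.
  by rewrite (le_trans (Lf _ _))// -mulrA ler_wpM2l ?(ltW L0)// vw.
rewrite distrC (le_trans (charint2_exp (csrc cv) (csrc cw) la0 LM0 bd Tz))//.
rewrite ler_wpM2r ?expR_ge0//.
have -> : C * (C * (L * M) / la) / la = M * (C * C * L / (la * la)).
  by field; rewrite gt_eqF.
have la20 : 0 < la * la by rewrite mulr_gt0.
rewrite ler_wpM2l// ler_pdivrMr// /la.
have -> : 2^-1 * (2 * C * (L + 1) * (2 * C * (L + 1))) =
  C * C * L + C * C * (2 * L * L + 3 * L + 2) by field.
by rewrite lerDl !mulr_ge0 ?(ltW C0)// !addr_ge0// !mulr_ge0// ltW.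
Qed.

Lemma continuous_fixed_point : exists u, continuous u /\ u = u0 - J ((f \o u) + h).
Proof.
pose U n := iter n Phi u0.
have cU n : continuous (U n) by elim: n => [//|n IH]; exact: cPhi.
have inc T : exists2 M, 0 <= M & forall n z, square l1 l2 T z ->
    `|U n.+1 z - U n z| <= M / 2 ^+ n * expR (la * `|l2 z - l1 z|).
  have [M M0 HM] := @square_bounded (U 1%N - U 0%N) T
    (fun x => cvgB (cU 1%N x) (cU 0%N x)).
  exists M => //; elim=> [|n IH] z Tz.
    rewrite expr0 divr1 (le_trans (HM z Tz))// ler_peMr// -expR0 ler_expR.
    by rewrite mulr_ge0// ltW.
  rewrite [U n.+2]/(Phi (U n.+1)) {2}[U n.+1]/(Phi (U n)).
  have -> : M / 2 ^+ n.+1 = M / 2 ^+ n / 2 by rewrite exprSr invfM mulrA.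
  by apply: (@Phi_contract _ _ T); rewrite ?divr_ge0 ?exprn_ge0.
(* On a square the weight is at most [expR (la * (T + T))]; replacing it by this bound gives plain
   geometric increments. *)
have geo T : exists2 M, 0 <= M & forall z, square l1 l2 T z ->
    geometric_increments (U ^~ z) M.
  have [M M0 HM] := inc T; exists (M * expR (la * (T + T))) => [|z Tz n].
    by rewrite mulr_ge0// expR_ge0.
  rewrite (le_trans (HM n z Tz))// mulrAC ler_wpM2r ?invr_ge0 ?exprn_ge0//.
  rewrite ler_wpM2l// ler_expR ler_wpM2l ?(ltW la0)//.
  by rewrite (le_trans (ler_normB _ _))// lerD ?Tz.2 ?Tz.1.
have [D D0 HD] := geometric_limit.
have sq z : square l1 l2 (`|l1 z| + `|l2 z|) z by split; rewrite ?lerDl ?lerDr.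
have /choice[u Hu] : forall z, exists l, forall M, geometric_increments (U ^~ z) M ->
    forall n, `|U n z - l| <= D * M / 2 ^+ n.
  by move=> z; apply: HD; have [M M0 HM] := geo (`|l1 z| + `|l2 z|); exists M => //; exact: HM.
have uU T : exists2 M, 0 <= M & forall n z, square l1 l2 T z -> `|U n z - u z| <= M / 2 ^+ n.
  have [M M0 HM] := geo T; exists (D * M) => [|n z Tz]; first by rewrite mulr_ge0.
  by apply: Hu; exact: HM.
have [cl1 cl2 _ _ _] := fr.
have cu : continuous u.
  move=> z; apply/continuous_atP => eps eps0.
  have [M M0 HM] := uU (`|l1 z| + `|l2 z| + 1).
  have [n Hn] : exists n, M / 2 ^+ n <= eps / 3.
    apply: contrapT => /forallNP H; have := @le0_geometric (eps / 3) M.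
    rewrite leNgt divr_gt0// => /(_ _)/negP; apply=> // n.
    by rewrite ltW// ltNge; apply/negP; exact: H.
  have [d1 d10 Hd1] := (continuous_atP _ _).1 (cU n z) _ (divr_gt0 eps0 (ltr0n _ 3)).
  have [d2 d20 Hd2] := (continuous_atP _ _).1 (cl1 z) _ ltr01.
  have [d3 d30 Hd3] := (continuous_atP _ _).1 (cl2 z) _ ltr01.
  exists (Num.min d1 (Num.min d2 d3)) => [|y]; first by rewrite !lt_min d10 d20.
  rewrite !lt_min => /and3P[y1 y2 y3].
  have Tz : square l1 l2 (`|l1 z| + `|l2 z| + 1) z.
    by split; rewrite -addrA ?lerDl ?addr_ge0// addrCA lerDl addr_ge0.
  have Ty : square l1 l2 (`|l1 z| + `|l2 z| + 1) (z + y).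
    split.
      rewrite -[l1 (z + y)](subrK (l1 z)) (le_trans (ler_normD _ _))//.
      by have := Hd2 y y2; have := normr_ge0 (l2 z); lra.
    rewrite -[l2 (z + y)](subrK (l2 z)) (le_trans (ler_normD _ _))//.
    by have := Hd3 y y3; have := normr_ge0 (l1 z); lra.
  have -> : u (z + y) - u z = (u (z + y) - U n (z + y)) + (U n (z + y) - U n z) + (U n z - u z).
    by rewrite !subrKA.
  rewrite (le_trans (ler_normD _ _))// (le_trans (lerD (ler_normD _ _) (lexx _)))//.
  have := HM n _ Ty; have := HM n _ Tz; have := Hd1 y y1; rewrite [`|u _ - _|]distrC; lra.
exists u; split=> //; apply/funext => z; apply/eqP; rewrite -subr_eq0 -normr_le0.
set T := `|l1 z| + `|l2 z|; have [M M0 HM] := uU T.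
(* Both [u - U n.+1] and [Phi (U n) - Phi u] are of order [1 / 2 ^+ n], the second by contraction
   after inserting the weight, which is at least 1. *)
have := @le0_geometric `|u z - Phi u z| (M + M * expR (la * (T + T))); apply=> n.
have -> : u z - Phi u z = (u z - U n.+1 z) + (U n.+1 z - Phi u z) by rewrite addrA subrK.
rewrite (le_trans (ler_normD _ _))// mulrDl lerD//.
  rewrite distrC (le_trans (HM _ _ (sq z)))// ler_wpM2l// lef_pV2 ?posrE ?exprn_gt0//.
  by rewrite ler_weXn2l// ler1n.
rewrite [U n.+1]/(Phi (U n)).
have := @Phi_contract (U n) u T (M / 2 ^+ n) (cU n) cu _ _ z (sq z).
rewrite divr_ge0 ?exprn_ge0// => /(_ isT) H; apply: (le_trans (H _)) => {H}.
  move=> y Ty; rewrite (le_trans (HM n y Ty))// ler_peMr ?divr_ge0 ?exprn_ge0//.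
  by rewrite -expR0 ler_expR mulr_ge0// ltW.
rewrite [leRHS]mulrAC ler_pM ?expR_ge0 ?divr_ge0 ?exprn_ge0//.
  by rewrite ler_pdivrMr// ler_peMr ?divr_ge0 ?exprn_ge0// ler1n.
rewrite ler_expR ler_wpM2l ?(ltW la0)//.
by rewrite (le_trans (ler_normB _ _))// lerD ?(sq z).2 ?(sq z).1.
Qed.

End FixedPoint.
(** The wave equation and the initial velocity will be read off the derivative along [e1]. *)
Lemma smooth_fixed_point (f : K -> K) (u0 h : V -> K) (L : R) :
  0 < L -> (forall x y, `|f x - f y| <= L * `|x - y|) ->
  smooth f -> smooth u0 -> smooth h ->
  exists2 u, smooth u & forall z,
    [/\ u z = u0 z - J ((f \o u) + h) z,
        'D_e1 u z = 'D_e1 u0 z - A ((f \o u) + h) z &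
        'D_e2 u z = 'D_e2 u0 z - B ((f \o u) + h) z].
Proof.
move=> L0 Lf sf su0 sh.
have [/smoothCk Cf /smoothCk Cu0 /smoothCk Ch] := And3 sf su0 sh.
have [u [cu uE]] := continuous_fixed_point L0 Lf (Cu0 0%N) (Ch 0%N).
set g := (f \o u) + h in uE.
have Cu k : Ck k u.
  elim: k => [//|k IH]; rewrite uE; apply: CkB; first exact: Cu0.
  by apply: Ck_charint2; apply: CkD => //; apply: (Ck_comp bc).
have cg : continuous g.
  by apply: (@Ck_continuous _ _ _ 0); apply: CkD => //; apply: (Ck_comp bc).
exists u => [|z]; first exact/smoothCk.
have du0 v : derivable u0 z v by exact: smooth_derivable.
have [d1 E1] := charint2_derive1 z cg; have [d2 E2] := charint2_derive2 z cg.
split; first by rewrite {1}uE.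
- by rewrite {1}uE deriveB// E1.
- by rewrite {1}uE deriveB// E2.
Qed.

End Picard.

(** * Symmetry of second derivatives and factorization of the wave operator *)

Section Schwarz.
Context {R : realType} {V K : normedModType R}.
Variable C : R.
Hypothesis HC : mean_value_constant K C.

Lemma ler_dist_common (D p q : K) (M M' : R) :
  `|D - p| <= M -> `|D - q| <= M' -> `|p - q| <= M + M'.
Proof.
move=> h1 h2; rewrite distrC in h1.
by rewrite -(subrKA D) (le_trans (ler_normD _ _))// lerD.
Qed.

(** The mean value inequality is used along [v] for the increment of [F] by [s *: w], then along [w]
    for ['D_v F]; each use costs a factor [C], whence the tolerance [mu / (C * C)]. *)
Lemma second_difference (F : V -> K) (x v w : V) : smooth F ->
  forall mu, 0 < mu -> exists2 d, 0 < d & forall s : R, `|s| < d ->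
  `|(F (x + s *: v + s *: w) - F (x + s *: v)) - (F (x + s *: w) - F x) -
    s *: (s *: 'D_w ('D_v F) x)| <= mu * `|s| * `|s|.
Proof.
move=> sF mu mu0; have C0 := HC.1.
have sv : smooth ('D_v F) by exact: smooth_derive.
have cD : {for x, continuous ('D_w ('D_v F))}.
  by apply/differentiable_continuous/smooth_differentiable/smooth_derive.
have mu'0 : 0 < mu / (C * C) by rewrite divr_gt0// mulr_gt0.
have [d d0 Hd] := (continuous_atP _ _).1 cD _ mu'0.
pose N := `|v| + `|w| + 1; have N0 : 0 < N by rewrite ltr_wpDl// addr_ge0.
exists (d / N) => [|s]; first by rewrite divr_gt0.
rewrite ltr_pdivlMr// => sd.
pose H y := F (y + s *: w) - F y.
have dH y : is_derive y v H ('D_v F (y + s *: w) - 'D_v F y).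
  apply: is_deriveB; last by split=> //; exact: smooth_derivable.
  have := @smooth_derivable R V K F (y + s *: w) v sF.
  rewrite -[X in derivable F X v]/(y + s *: w) => dF.
  have /is_deriveP HF : is_derive (y + s *: w) v F ('D_v F (y + s *: w)) by split.
  apply/is_deriveP => eps /HF[r r0 Hr]; exists r => // q qr.
  by have := Hr q qr; rewrite [y + s *: w + _]addrAC.
have := @mean_value_line R V K C H x v s (C * (mu / (C * C) * `|s|))
  (s *: 'D_w ('D_v F) x) HC.
rewrite -[H (x + s *: v)]/(F (x + s *: v + s *: w) - F (x + s *: v)).
have -> : C * (C * (mu / (C * C) * `|s|) * `|s|) = mu * `|s| * `|s|.
  by field; rewrite gt_eqF.
apply=> t /andP[t0 t1]; first by have [] := dH (x + (t * s) *: v).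
have [_ ->] := dH (x + (t * s) *: v).
apply: (@mean_value_line R V K C ('D_v F) _ w s _ _ HC) => r /andP[r0 r1]; first exact: smooth_derivable.
rewrite -addrA; apply: Hd; rewrite (le_lt_trans (ler_normD _ _))// !normrZ.
rewrite (ger0_norm t0) (ger0_norm r0) (le_lt_trans _ sd)// /N !mulrDr mulr1.
have A1 : t * `|s| * `|v| <= `|s| * `|v| by rewrite ler_wpM2r// ler_piMl.
have A2 : r * `|s| * `|w| <= `|s| * `|w| by rewrite ler_wpM2r// ler_piMl.
by have := normr_ge0 s; lra.
Qed.

(** The second difference is symmetric in [v] and [w], so both mixed derivatives are within [mu / 2]
    of its quotient by [s * s]. *)
Lemma derive_comm (F : V -> K) (v w : V) : smooth F -> 'D_w ('D_v F) = 'D_v ('D_w F).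
Proof.
move=> sF; apply/funext => x; apply/eqP; rewrite -subr_eq0 -normr_le0.
apply/ler_addgt0Pl => mu mu0; rewrite addr0.
have mu20 : 0 < mu / 2 by rewrite divr_gt0.
have [d1 d10 Hd1] := second_difference x v w sF mu20.
have [d2 d20 Hd2] := second_difference x w v sF mu20.
have [s s0 /andP[sd1 sd2]] : exists2 s : R, 0 < s & (s < d1) && (s < d2).
  have d0 : 0 < Num.min d1 d2 by rewrite lt_min d10.
  by exists (Num.min d1 d2 / 2); rewrite -?lt_min; lra.
have := Hd1 s; have := Hd2 s; rewrite (gtr0_norm s0) => /(_ sd2) h2 /(_ sd1) h1.
rewrite -(ler_pM2r (mulr_gt0 s0 s0)).
have -> : `|'D_w ('D_v F) x - 'D_v ('D_w F) x| * (s * s) =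
    `|s *: (s *: 'D_w ('D_v F) x) - s *: (s *: 'D_v ('D_w F) x)|.
  by rewrite -!scalerBr !normrZ (gtr0_norm s0) mulrC mulrA.
have E : F (x + s *: w + s *: v) - F (x + s *: w) - (F (x + s *: v) - F x) =
    F (x + s *: v + s *: w) - F (x + s *: v) - (F (x + s *: w) - F x).
  by rewrite [x + s *: w + s *: v]addrAC !opprB addrACA [RHS]addrACA [- _ - _]addrC.
rewrite E in h2; rewrite (le_trans (ler_dist_common h1 h2))//.
by rewrite -2!mulrDl -splitr mulrA.
Qed.

Lemma iter_derive_comm (F : V -> K) (s : seq V) v : smooth F ->
  iter_derive s ('D_v F) = 'D_v (iter_derive s F).
Proof.
elim/last_ind: s F => [//|s w IH] F sF; rewrite !iter_derive_rcons.
by rewrite derive_comm// IH//; exact: smooth_derive.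
Qed.

Lemma deriveDv (W : normedModType R) (U : normedModType R) (F : U -> W) z (v w : U) :
  differentiable F z -> 'D_(v + w) F z = 'D_v F z + 'D_w F z.
Proof. by move=> dF; rewrite !deriveE// linearD. Qed.

Lemma deriveNv (W : normedModType R) (U : normedModType R) (F : U -> W) z (v : U) :
  differentiable F z -> 'D_(- v) F z = - 'D_v F z.
Proof. by move=> dF; rewrite !deriveE// linearN. Qed.

Lemma smoothD (U W : normedModType R) (F G : U -> W) : smooth F -> smooth G -> smooth (F + G).
Proof. by move=> /smoothnP sF /smoothnP sG; apply/smoothnP => k; exact: smoothnD. Qed.

Lemma deriveD_smooth (F : V -> K) (v w : V) : smooth F -> 'D_(v + w) F = 'D_v F + 'D_w F.
Proof.
by move=> sF; apply/funext => z; rewrite deriveDv//; exact: smooth_differentiable.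
Qed.

Lemma deriveB_smooth (F : V -> K) (v w : V) : smooth F -> 'D_(v - w) F = 'D_v F - 'D_w F.
Proof.
move=> sF; apply/funext => z; have dF := smooth_differentiable z sF.
by rewrite deriveDv// deriveNv.
Qed.

Lemma subr_cancel (U : zmodType) (x y y' z : U) : y = y' -> (x + y) - (y' + z) = x - z.
Proof. by move=> ->; rewrite opprD addrA addrK. Qed.

Lemma derive_subadd (u : V -> K) (p q : V) : smooth u ->
  'D_(p - q) ('D_(p + q) u) = 'D_p ('D_p u) - 'D_q ('D_q u).
Proof.
move=> su; have s1 := smooth_derive p su; have s2 := smooth_derive q su.
rewrite (deriveD_smooth p q su) (deriveB_smooth p q (smoothD s1 s2)).
have dd v : 'D_v ('D_p u + 'D_q u) = 'D_v ('D_p u) + 'D_v ('D_q u).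
  by apply: deriveDE => x; exact: smooth_differentiable.
apply: (etrans (congr2 (fun F G => F - G) (dd p) (dd q))).
exact: subr_cancel (derive_comm q p su).
Qed.

End Schwarz.

(** * Characteristic coordinates in the plane *)

Section Plane.
Context {R : realType} {K : normedModType R}.
Variable C : R.
Hypothesis HC : mean_value_constant K C.
Local Notation V := 'rV[R]_2.
Local Notation dx := (delta_mx 0 ord0 : V).
Local Notation dt := (delta_mx 0 ord_max : V).

Lemma coord_derive_cons n (k : 'I_n) s (F : 'rV[R]_n -> K) :
  coord_derive (k :: s) F = 'D_(delta_mx 0 k) (coord_derive s F).
Proof. by []. Qed.

Lemma ord2_cases (k : 'I_2) : k = ord0 \/ k = ord_max.
Proof. by case: (unliftP ord0 k) => [k'|] ->; [right; apply/val_inj; rewrite /= ord1|left]. Qed.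

(** The sorted word depends only on the letter counts, which gives the invariance under
    permutations. *)
Lemma coord_derive_sort (s : seq 'I_2) (F : V -> K) : smooth F ->
  coord_derive s F =
  coord_derive (nseq (count_mem ord0 s) ord0 ++ nseq (count_mem ord_max s) ord_max) F.
Proof.
move=> sF; elim: s => [//|k s IH]; rewrite coord_derive_cons IH.
have [->|->] := ord2_cases k; first by rewrite -coord_derive_cons.
rewrite -(iter_derive_comm HC)// -/(coord_derive _ _) -coord_derive_rcons rcons_cat.
rewrite -[count_mem ord0 (_ :: s)]/(count_mem ord0 s).
rewrite -[count_mem ord_max (_ :: s)]/(count_mem ord_max s).+1.
by congr (coord_derive (_ ++ _) F); elim: (count_mem _ _) => //= p ->.
Qed.

Lemma coord_derive_perm (s s' : seq 'I_2) (F : V -> K) : smooth F -> perm_eq s s' ->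
  coord_derive s F = coord_derive s' F.
Proof.
by move=> sF /permP ss'; rewrite coord_derive_sort// [RHS]coord_derive_sort// !ss'.
Qed.

Lemma size_count_ord2 (s : seq 'I_2) : size s = (count_mem ord0 s + count_mem ord_max s)%N.
Proof.
elim: s => [//|k s IH]; rewrite [LHS]/= IH.
by have [->|->] := ord2_cases k; [|exact: esym (addnS _ _)].
Qed.

Definition char1 : V := dx + dt.
Definition char2 : V := dx - dt.
(** With [char_coord2], the basis dual to [char1] and [char2]. The two coordinates agree exactly on
    the initial line, which is thus the diagonal where [charint] starts. *)
Definition char_coord1 (z : V) : R := (z 0 ord0 + z 0 ord_max) / 2.
Definition char_coord2 (z : V) : R := (z 0 ord0 - z 0 ord_max) / 2.

Lemma char_coord1_linear : linear char_coord1.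
Proof.
move=> a u v; rewrite /char_coord1 !mxE.
rewrite -[RHS]/(a * ((u 0 ord0 + u 0 ord_max) / 2) + (v 0 ord0 + v 0 ord_max) / 2).
by ring.
Qed.
HB.instance Definition _ := GRing.isLinear.Build R V R _ char_coord1 char_coord1_linear.

Lemma char_coord2_linear : linear char_coord2.
Proof.
move=> a u v; rewrite /char_coord2 !mxE.
rewrite -[RHS]/(a * ((u 0 ord0 - u 0 ord_max) / 2) + (v 0 ord0 - v 0 ord_max) / 2).
by ring.
Qed.
HB.instance Definition _ := GRing.isLinear.Build R V R _ char_coord2 char_coord2_linear.

Lemma char_frame : frame char1 char2 char_coord1 char_coord2.
Proof.
split.
- move=> z; have c0 := @coord_continuous R 1 2 0 ord0 z.
  have c1 := @coord_continuous R 1 2 0 ord_max z.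
  exact: (cvgMr_tmp (cvgD c0 c1)).
- move=> z; have c0 := @coord_continuous R 1 2 0 ord0 z.
  have c1 := @coord_continuous R 1 2 0 ord_max z.
  exact: (cvgMr_tmp (cvgB c0 c1)).
- move=> z; apply/rowP => i; rewrite !mxE /char_coord1 /char_coord2.
  case: (unliftP ord0 i) => [k'|] ->.
    have -> : lift ord0 k' = ord_max :> 'I_2 by apply/val_inj; rewrite /= ord1.
    by rewrite /= /char_coord1 /char_coord2; field.
  by rewrite /= /char_coord1 /char_coord2; field.
- by split; rewrite /= /char_coord1 /char_coord2 !mxE /=; field.
- by split; rewrite /= /char_coord1 /char_coord2 !mxE /=; field.
Qed.

Definition wave (u : V -> K) : V -> K := 'D_dt ('D_dt u) - 'D_dx ('D_dx u).

Lemma wave_char (u : V -> K) : smooth u -> 'D_char2 ('D_char1 u) = - wave u.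
Proof. by move=> su; rewrite /wave opprB; exact: (derive_subadd HC dx dt su). Qed.

End Plane.

(** * The Cauchy problem for one parameter *)

Section ExactSolution.
Context {R : realType} {K : normedModType R}.
Variables (m : nat) (b : 'I_m -> K) (c : 'I_m -> {linear K -> R}).
Hypothesis bc : coordinates b c.
Variable C : R.
Hypothesis HC : mean_value_constant K C.
Local Notation V := 'rV[R]_2.
Local Notation d1 := (delta_mx 0 0 : 'rV[R]_1).
Local Notation l1 := (@char_coord1 R).
Local Notation l2 := (@char_coord2 R).
Local Notation A := (@charint R V K (char1 : V) (char2 : V) l1 l2).
Local Notation B := (@charint R V K (char2 : V) (char1 : V) l2 l1).

Lemma initial_point_coord (x : 'rV[R]_1) :
  l1 (initial_point x) = x 0 0 / 2 /\ l2 (initial_point x) = x 0 0 / 2.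
Proof.
rewrite /l1 /l2 /initial_point !mxE /= !mulr1 !mulr0.
by rewrite addr0 subr0.
Qed.

Lemma rV1E (x : 'rV[R]_1) : x = x 0 0 *: d1.
Proof. by apply/rowP => i; rewrite !mxE !ord1 /= mulr1. Qed.

Lemma derive_trace (F : V -> K) (x : 'rV[R]_1) :
  'D_d1 (F \o initial_point) x = 'D_(delta_mx 0 ord0) F (initial_point x).
Proof.
have := @iter_derive_trace R K [:: d1] F => /(congr1 (@^~ x)) /= ->.
by rewrite initial_point_delta.
Qed.

Lemma exact_solution (f : K -> K) (L : R) (a0 b0 : 'rV[R]_1 -> K) (h : V -> K) :
  0 < L -> (forall x y, `|f x - f y| <= L * `|x - y|) -> smooth f ->
  smooth a0 -> smooth b0 -> smooth h ->
  exists u : V -> K, [/\ smooth u, wave u = (f \o u) + h,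
    u \o initial_point = a0 & 'D_(delta_mx 0 ord_max) u \o initial_point = b0].
Proof.
move=> L0 Lf sf sa sb sh.
have fr := @char_frame R; have rf := frame_swap fr.
have [cl1 cl2 le [E11 E21] [E12 E22]] := fr.
have linX (l : {linear V -> R}) : linear (fun z : V => l z *: (2 *: d1)).
  move=> k u v; rewrite linearP scalerDl; congr (_ + _).
  exact: (esym (scalerA _ _ _)).
have contX (l : {linear V -> R}) : continuous l -> continuous (fun z : V => l z *: (2 *: d1)).
  move=> cl z; apply: (@continuous_comp _ _ _ l (fun t : R => t *: (2 *: d1))); first exact: cl.
  exact: scalel_continuous.
(* [X1] and [X2] are [x + t] and [x - t] as points of the line; the factor 2 is there because both
   characteristic coordinates of [initial_point x] are half of [x]. *)
pose X1 : {linear V -> 'rV[R]_1} := HB.pack (fun z : V => l1 z *: (2 *: d1))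
  (GRing.isLinear.Build R V 'rV[R]_1 _ _ (linX l1)).
pose X2 : {linear V -> 'rV[R]_1} := HB.pack (fun z : V => l2 z *: (2 *: d1))
  (GRing.isLinear.Build R V 'rV[R]_1 _ _ (linX l2)).
have cX1 : continuous X1 by exact: contX.
have cX2 : continuous X2 by exact: contX.
have X1ip x : X1 (initial_point x) = x.
  apply: (etrans (congr1 (fun t : R => t *: (2 *: d1)) (initial_point_coord x).1)).
  by rewrite [RHS]rV1E scalerA; congr (_ *: _); field.
have X2ip x : X2 (initial_point x) = x.
  apply: (etrans (congr1 (fun t : R => t *: (2 *: d1)) (initial_point_coord x).2)).
  by rewrite [RHS]rV1E scalerA; congr (_ *: _); field.
have dX (W : normedModType R) (X : {linear V -> 'rV[R]_1}) (F : 'rV[R]_1 -> W) :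
    continuous X -> smooth F -> smooth (F \o X) /\
    forall z v, derivable (F \o X) z v /\ 'D_v (F \o X) z = 'D_(X v) F (X z).
  move=> cX sF; split; first by apply/smoothCk => k; apply: Ck_comp_lin => //; move: k; apply/smoothCk.
  move=> z v; have [dF E] := derive_comp_lin cX (fun y => smooth_differentiable y sF) z.
  by split; [exact: diff_derivable|exact: E].
have [sbX dbX] := dX K X1 b0 cX1 sb.
have [sa1 da1] := dX K X1 a0 cX1 sa.
have [sa2 da2] := dX K X2 a0 cX2 sa.
have cb : continuous (b0 \o X1) by have /smoothCk/(_ 0%N) := sbX.
have sB : smooth (B (b0 \o X1)).
  by apply/smoothCk => k; apply: (Ck_charint bc HC rf); move: k; apply/smoothCk.
(* d'Alembert's formula: the integrand of [B] at [y] is [b0] at [2 * y], so the last term is half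
   the integral of [b0] from [x - t] to [x + t]. *)
pose u0 : V -> K := (2^-1 \*: ((a0 \o X1) + (a0 \o X2))) + B (b0 \o X1).
have saa : smooth ((a0 \o X1) + (a0 \o X2)) by exact: smoothD.
have su0 : smooth u0.
  apply: smoothD => //; apply/smoothCk => k; apply: Ck_scale; move: k; exact/smoothCk.
pose phi := 'D_d1 a0 + b0.
have sphi : smooth phi by apply: smoothD => //; exact: smooth_derive.
have [sp dp] := dX K X1 phi cX1 sphi.
have D0 (F : 'rV[R]_1 -> K) x : smooth F -> 'D_0 F x = 0.
  by move=> sF; rewrite deriveE ?linear0//; exact: smooth_differentiable.
have X11 : X1 char1 = 2 *: d1.
  exact: etrans (congr1 (fun t : R => t *: (2 *: d1)) E11) (scale1r _).
have X21 : X2 char1 = 0.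
  exact: etrans (congr1 (fun t : R => t *: (2 *: d1)) E21) (scale0r _).
have X12 : X1 char2 = 0.
  exact: etrans (congr1 (fun t : R => t *: (2 *: d1)) E12) (scale0r _).
(* This derivative is a function of [x + t] alone, hence constant along [char2]: [u0] solves the
   homogeneous equation. *)
have Du0 z : 'D_char1 u0 z = phi (X1 z).
  have [dB EB] := charint_derive2 bc rf z cb.
  have dsum v : derivable ((a0 \o X1) + (a0 \o X2)) z v by exact: smooth_derivable.
  rewrite deriveD//; last exact: derivableZ.
  rewrite deriveZ// deriveD; [|exact: smooth_derivable..].
  rewrite (da1 z char1).2 (da2 z char1).2 X11 X21 EB D0// addr0.
  have da := smooth_differentiable (X1 z) sa.
  have Da2 : 'D_(2 *: d1) a0 (X1 z) = 2 *: 'D_d1 a0 (X1 z) by rewrite !deriveE// linearZ.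
  by rewrite Da2 scalerA mulVf// scale1r.
have [u su Hu] := smooth_fixed_point bc HC fr L0 Lf sf su0 sh.
have sg : smooth ((f \o u) + h) by apply: smoothD => //; exact: (smooth_comp bc).
set g := (f \o u) + h in Hu sg *.
have cg : continuous g by have /smoothCk/(_ 0%N) := sg.
have E1 : 'D_char1 u = (phi \o X1) - A g.
  by apply/funext => z; have [_ -> _] := Hu z; rewrite Du0.
have diag x : l1 (initial_point x) = l2 (initial_point x).
  by have [-> ->] := initial_point_coord x.
have uip : u \o initial_point = a0.
  apply/funext => x; rewrite /=; have [-> _ _] := Hu (initial_point x).
  rewrite [charint _ _ _ _ _ _]charint_diag0; last exact/esym/diag.
  rewrite subr0.
  rewrite -[LHS]/(2^-1 *: (a0 (X1 _) + a0 (X2 _)) + B (b0 \o X1) _) X1ip X2ip.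
  rewrite charint_diag0; last exact/esym/diag.
  rewrite addr0 scalerDr -scalerDl -[RHS]scale1r.
  by congr (_ *: _); field.
exists u; split=> //.
- apply: oppr_inj; rewrite -(wave_char HC su) E1; apply/funext => z.
  have [dA EA] := charint_derive2 bc fr z cg.
  rewrite deriveB//; last exact: (dp z char2).1.
  by rewrite (dp z char2).2 X12 D0// EA sub0r.
- apply/funext => x; pose p := initial_point x.
  (* The initial velocity is what remains of ['D_char1 u] on the initial line once the space
     derivative, which is that of [a0], is subtracted. *)
  have E : 'D_char1 u p = 'D_(delta_mx 0 ord0) u p + 'D_(delta_mx 0 ord_max) u p.
    exact: (congr1 (@^~ p) (deriveD_smooth (delta_mx 0 ord0) (delta_mx 0 ord_max) su)).
  have E' : 'D_char1 u p = 'D_d1 a0 x + b0 x.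
    have [_ -> _] := Hu p; rewrite Du0 charint_diag0; last exact: diag.
    by rewrite subr0 X1ip.
  have E3 : 'D_(delta_mx 0 ord0) u p = 'D_d1 a0 x by rewrite -uip derive_trace.
  by move: E; rewrite E' E3 => /addrI/esym.
Qed.

End ExactSolution.

(** * A priori estimates *)

Section SquareEstimates.
Context {R : realType} {V K : normedModType R}.
Variable C : R.
Hypothesis HC : mean_value_constant K C.
Variables (e1 e2 : V) (l1 l2 : {linear V -> R}).
Hypothesis fr : frame e1 e2 l1 l2.
Local Notation diag z := (l1 z *: (e1 + e2)).

Lemma square_diag T z : square l1 l2 T z ->
  square l1 l2 T (l1 z *: (e1 + e2)) /\ square l1 l2 T (l2 z *: (e1 + e2)).
Proof.
move=> [z1 z2]; have [E1 E2] := l_diag fr z; have [E3 E4] := l_diag (frame_swap fr) z.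
by rewrite /square/= [e1 + e2]addrC E3 E4 addrC E1 E2.
Qed.

(** Integration from the diagonal. [charint_exp] with [la = 1] is enough, since its weight lies
    between 1 and [expR (T + T)] on the square. *)
Lemma transport_bound T : 0 <= T -> exists2 Q : R, 0 <= Q &
  forall (p : V -> K) M, (forall z, derivable p z e2) -> 0 <= M ->
  (forall z, square l1 l2 T z -> `|'D_e2 p z| <= M) ->
  (forall z, square l1 l2 T z -> l1 z = l2 z -> `|p z| <= M) ->
  forall z, square l1 l2 T z -> `|p z| <= Q * M.
Proof.
move=> T0; have C0 := HC.1; exists (1 + C * expR (T + T)) => [|p M dp M0 pM pd z Tz].
  by rewrite addr_ge0// mulr_ge0 ?expR_ge0// ltW.
rewrite -[p z](subrK (p (diag z))) (le_trans (ler_normD _ _))// addrC mulrDl mul1r lerD//.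
  apply: pd; first by have [] := square_diag Tz.
  by have [-> ->] := l_diag fr z.
have := @charint_exp R V K C HC e1 e2 l1 l2 p T M 1 fr ltr01 M0 dp _ z Tz.
rewrite divr1 mul1r => H; apply: (le_trans (H _)) => {H}.
  by move=> y Ty; rewrite (le_trans (pM y Ty))// ler_peMr// -expR0 ler_expR.
rewrite -mulrA [M * _]mulrC mulrA ler_wpM2r// ler_wpM2l ?(ltW C0)// ler_expR.
by rewrite (le_trans (ler_normB _ _))// lerD ?Tz.1 ?Tz.2.
Qed.

(** Let [N] be the maximum over the square of [|w|] divided by the weight. Two integrations from the
    diagonal bound [N] by a multiple of [M] plus a small fraction of [N], which is absorbed on the
    left. *)
Lemma gronwall_bound T L : 0 <= T -> 0 <= L -> exists2 Q : R, 0 <= Q &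
  forall (w : V -> K) M, smooth w -> 0 <= M ->
  (forall z, square l1 l2 T z -> `|'D_e2 ('D_e1 w) z| <= L * `|w z| + M) ->
  (forall z, square l1 l2 T z -> l1 z = l2 z -> `|w z| <= M /\ `|'D_e1 w z| <= M) ->
  forall z, square l1 l2 T z -> `|w z| <= Q * M.
Proof.
move=> T0 L0; have C0 := HC.1.
pose la := 2 * C * (L + 1).
have L10 : 0 < L + 1 by rewrite ltr_wpDl.
have la0 : 0 < la by rewrite !mulr_gt0.
exists (4 * expR (la * (T + T))) => [|w M sw M0 wM wd z Tz].
  by rewrite mulr_ge0// expR_ge0.
have [cl1 cl2 _ _ _] := fr.
have cw : continuous w by have /smoothCk/(_ 0%N) := sw.
pose phi z := expR (- (la * `|l2 z - l1 z|)) * `|w z|.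
have cphi : continuous phi.
  move=> y; apply: cvgM; last by apply: cvg_norm; exact: cw.
  apply: (@continuous_comp V R R (fun y => - (la * `|l2 y - l1 y|)) expR); last exact: continuous_expR.
  apply: cvgN; apply: cvgM; first exact: cvg_cst.
  by apply: cvg_norm; apply: cvgB; [exact: cl2|exact: cl1].
have [z0 Tz0 Hz0] : exists2 z0, square l1 l2 T z0 & forall y, square l1 l2 T y -> phi y <= phi z0.
  have S0 : square l1 l2 T !=set0 by exists z.
  have [z0 Tz0 H] := compact_EVT_max S0 (@square_compact _ _ _ _ _ _ fr T) (continuous_subspaceT cphi).
  by exists z0; [rewrite inE in Tz0|move=> y Ty; apply: H; rewrite inE].
pose N := phi z0.
have N0 : 0 <= N by rewrite mulr_ge0// expR_ge0.
have wN y : square l1 l2 T y -> `|w y| <= N * expR (la * `|l2 y - l1 y|).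
  move=> Ty; have := Hz0 y Ty; rewrite -/N {1}/phi expRN => H.
  by rewrite -ler_pdivrMr ?expR_gt0// mulrC.
have e1' y : 1 <= expR (la * `|l2 y - l1 y|).
  by rewrite -expR0 ler_expR mulr_ge0// ltW.
have LNM0 : 0 <= L * N + M by rewrite addr_ge0// mulr_ge0.
have sD1 := smooth_derive e1 sw.
pose M1 := M + C * (L * N + M) / la.
have M10 : 0 <= M1 by rewrite addr_ge0// divr_ge0 ?mulr_ge0// ltW.
have D1 y : square l1 l2 T y -> `|'D_e1 w y| <= M1 * expR (la * `|l2 y - l1 y|).
  move=> Ty; rewrite -['D_e1 w y](subrK ('D_e1 w (diag y))) (le_trans (ler_normD _ _))//.
  rewrite /M1 mulrDl [leLHS]addrC lerD//.
    have [Td _] := square_diag Ty; have [E1 E2] := l_diag fr y.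
    have [_ H] := wd _ Td (etrans E1 (esym E2)).
    by rewrite (le_trans H)// ler_peMr.
  have bd x : square l1 l2 T x ->
      `|'D_e2 ('D_e1 w) x| <= (L * N + M) * expR (la * `|l2 x - l1 x|).
    move=> Tx; rewrite (le_trans (wM x Tx))// mulrDl -mulrA lerD//; last by rewrite ler_peMr.
    by rewrite ler_wpM2l// wN.
  exact: (charint_exp HC fr la0 LNM0 (fun x => @smooth_derivable _ _ _ _ x e2 sD1) bd Ty).
have D0 y : square l1 l2 T y -> `|w y| <= (M + C * M1 / la) * expR (la * `|l2 y - l1 y|).
  move=> Ty; rewrite -[w y](subrK (w (l2 y *: (e2 + e1)))) (le_trans (ler_normD _ _))//.
  rewrite mulrDl [leLHS]addrC lerD//.
    have [_ Td] := square_diag Ty; have [E1 E2] := l_diag (frame_swap fr) y.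
    move: E1 E2 Td; rewrite [e1 + e2]addrC => E1 E2 Td.
    have [H _] := wd _ Td (etrans E2 (esym E1)).
    by rewrite (le_trans H)// ler_peMr.
  have bd x : square l2 l1 T x -> `|'D_e1 w x| <= M1 * expR (la * `|l1 x - l2 x|).
    by rewrite square_swap => Tx; rewrite [`|l1 x - _|]distrC; exact: D1.
  have Ty' : square l2 l1 T y by rewrite square_swap.
  rewrite [`|l2 y - _|]distrC.
  exact: (charint_exp HC (frame_swap fr) la0 M10 (fun x => @smooth_derivable _ _ _ _ x e1 sw) bd Ty').
have NM : N <= M + C * M1 / la.
  have := D0 z0 Tz0; rewrite -ler_pdivrMr ?expR_gt0// mulrC -expRN; exact.
(* By [B1] and [B2] below, [N] is at most [M + M / 2 + (N + M) / 4], so at most 7/3 of [M]. *)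
have N4 : N <= 4 * M.
  have E : M + C * M1 / la = M + M / (2 * (L + 1)) + (L * N + M) / (4 * (L + 1) * (L + 1)).
    by rewrite /M1 /la; field; rewrite !gt_eqF.
  have B1 : M / (2 * (L + 1)) <= M / 2.
    by rewrite ler_wpM2l// lef_pV2 ?posrE ?mulr_gt0// ler_peMr// lerDr.
  have B2 : (L * N + M) / (4 * (L + 1) * (L + 1)) <= (N + M) / 4.
    rewrite ler_pdivrMr ?mulr_gt0//.
    rewrite (_ : (N + M) / 4 * _ = L * N + M + ((L * L + L + 1) * N + (L * L + 2 * L) * M)); last by field.
    by rewrite lerDl !addr_ge0// mulr_ge0// !addr_ge0// mulr_ge0.
  by move: NM; rewrite E; lra.
rewrite (le_trans (wN z Tz))// [leRHS]mulrAC ler_pM ?expR_ge0//.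
rewrite ler_expR ler_wpM2l ?(ltW la0)//.
by rewrite (le_trans (ler_normB _ _))// lerD ?Tz.1 ?Tz.2.
Qed.

End SquareEstimates.

(** * Moderate and null nets of solutions *)

Section Growth.
Context {R : realType}.
Implicit Types V W : normedModType R.

(* One predicate for both classes, so that estimates are propagated only once. *)
Definition growth (negligible : bool) V W (u : eps01 R -> V -> W) : Prop :=
  if negligible then null0 u else mod0 u.

Lemma growth_add nl V W : additive_class (@growth nl V W).
Proof. by case: nl; [exact: null0_add|exact: mod0_add]. Qed.

(** A linear bound between compact sets with [Q] independent of [e] preserves both kinds of growth.
    There are three sources because a Gronwall estimate draws on the right-hand side and on two
    initial data; with fewer, a net is repeated. *)
Lemma growth_estimate nl V W V1 W1 V2 W2 V3 W3 (u1 : eps01 R -> V1 -> W1)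
    (u2 : eps01 R -> V2 -> W2) (u3 : eps01 R -> V3 -> W3) (v : eps01 R -> V -> W) :
  (forall A : set V, compact A -> exists A1 A2 A3 (Q : R),
     [/\ compact A1, compact A2, compact A3, 0 <= Q & forall e M, 0 <= M ->
       (forall x, A1 x -> `|u1 e x| <= M) -> (forall x, A2 x -> `|u2 e x| <= M) ->
       (forall x, A3 x -> `|u3 e x| <= M) -> forall x, A x -> `|v e x| <= Q * M]) ->
  growth nl u1 -> growth nl u2 -> growth nl u3 -> growth nl v.
Proof.
move=> H; have tr (A : set V) : compact A -> exists A1 A2 A3,
    [/\ compact A1, compact A2, compact A3 & forall q,
      sup_bigO A1 u1 q -> sup_bigO A2 u2 q -> sup_bigO A3 u3 q -> sup_bigO A v q].
  move=> /H[A1 [A2 [A3 [Q [c1 c2 c3 Q0 HQ]]]]]; exists A1, A2, A3; split=> // q.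
  move=> /sup_bigO_ge0[C1 [n1 [C10 n10 H1]]] /sup_bigO_ge0[C2 [n2 [C20 n20 H2]]].
  move=> /sup_bigO_ge0[C3 [n3 [C30 n30 H3]]].
  exists (Q * (C1 + C2 + C3)), (Num.min n1 (Num.min n2 n3)).
  split=> [|e]; first by rewrite !lt_min n10 n20.
  rewrite !lt_min => /and3P[e1 e2 e3] x Ax; rewrite -mulrA.
  have pe := eps01_powR_ge0 e q.
  apply: HQ Ax; first by rewrite mulr_ge0// !addr_ge0.
  - by move=> y /(H1 e e1) /le_trans; apply; rewrite ler_wpM2r// -addrA lerDl addr_ge0.
  - by move=> y /(H2 e e2) /le_trans; apply; rewrite ler_wpM2r// addrAC lerDr addr_ge0.
  - by move=> y /(H3 e e3) /le_trans; apply; rewrite ler_wpM2r// lerDr addr_ge0.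
case: nl => /= g1 g2 g3 A cA; have [A1 [A2 [A3 [c1 c2 c3 HA]]]] := tr A cA.
  by move=> q q0; apply: HA; [exact: g1|exact: g2|exact: g3].
have [p1 p10 O1] := g1 _ c1; have [p2 p20 O2] := g2 _ c2; have [p3 p30 O3] := g3 _ c3.
exists (p1 + p2 + p3); first by rewrite !addr_ge0.
apply: HA; [apply: sup_bigOW O1|apply: sup_bigOW O2|apply: sup_bigOW O3];
  rewrite lerN2.
- by rewrite -addrA lerDl addr_ge0.
- by rewrite addrAC lerDr addr_ge0.
- by rewrite lerDr addr_ge0.
Qed.

Lemma growthD nl V W (u v : eps01 R -> V -> W) :
  growth nl u -> growth nl v -> growth nl (fun e => u e + v e).
Proof. exact: (proj2 (growth_add nl V W)). Qed.

Lemma growth_le nl V W W' (u : eps01 R -> V -> W) (v : eps01 R -> V -> W') (k : R) :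
  0 <= k -> (forall e x, `|v e x| <= k * `|u e x|) -> growth nl u -> growth nl v.
Proof.
move=> k0 vu gu; apply: (growth_estimate _ gu gu gu) => A cA.
exists A, A, A, k; split=> // e M M0 uM _ _ x Ax.
by rewrite (le_trans (vu e x))// ler_wpM2l// uM.
Qed.

Lemma growthN nl V W (u : eps01 R -> V -> W) : growth nl u -> growth nl (fun e => - u e).
Proof.
apply: (@growth_le _ _ _ _ _ _ 1) => // e x.
by rewrite -[(- u e) x]/(- u e x) normrN mul1r.
Qed.

Lemma growthB nl V W (u v : eps01 R -> V -> W) :
  growth nl u -> growth nl v -> growth nl (fun e => u e - v e).
Proof. by move=> gu gv; apply: growthD => //; exact: growthN. Qed.

Lemma growthZ nl V W (a : R) (u : eps01 R -> V -> W) :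
  growth nl u -> growth nl (fun e => a \*: u e).
Proof.
apply: (@growth_le _ _ _ _ _ _ `|a|) => // e x.
by rewrite -[(a \*: u e) x]/(a *: u e x) normrZ.
Qed.

Lemma growth_trace nl W (u : eps01 R -> 'rV[R]_2 -> W) :
  growth nl u -> growth nl (fun e => u e \o initial_point).
Proof.
move=> gu; apply: (growth_estimate _ gu gu gu) => A cA.
have cT := compact_trace cA.
exists (initial_point @` A), (initial_point @` A), (initial_point @` A), 1.
by split=> // e M M0 uM _ _ x Ax; rewrite mul1r; apply: uM; exists x.
Qed.

End Growth.

Section WaveNets.
Context {R : realType} {K : normedModType R}.
Variable C : R.
Hypothesis HC : mean_value_constant K C.
Local Notation V := 'rV[R]_2.
Local Notation d1 := (delta_mx 0 0 : 'rV[R]_1).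
Local Notation l1 := (@char_coord1 R).
Local Notation l2 := (@char_coord2 R).
Implicit Types (w p g : eps01 R -> V -> K).
Let fr := @char_frame R.

(** On the initial line [x] is twice the characteristic coordinate, hence the half-length
    [2 * T]. *)
Definition base_segment (T : R) : set 'rV[R]_1 :=
  [set t *: d1 | t in `[- (2 * T), 2 * T]].

Lemma base_segment_compact T : compact (base_segment T).
Proof.
apply: continuous_compact; last exact: segment_compact.
by apply: continuous_subspaceT => t; exact: scalel_continuous.
Qed.

Lemma square_base T (z : V) : square l1 l2 T z -> l1 z = l2 z ->
  exists2 x, base_segment T x & z = initial_point x.
Proof.
move=> [z1 _] z12; exists ((2 * l1 z) *: d1).
  exists (2 * l1 z) => //; rewrite /= in_itv/= -ler_norml normrM ger0_norm//.
  by rewrite ler_wpM2l.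
have z1' : z 0 ord_max = 0 by move: z12; rewrite /= /char_coord1 /char_coord2; lra.
have z0' : 2 * l1 z = z 0 ord0 by rewrite /= /char_coord1 z1'; field.
rewrite /initial_point z0'; apply/rowP => i; rewrite !mxE /= mulr1.
case: (unliftP ord0 i) => [k'|] ->; last by rewrite /= mulr1.
have -> : lift ord0 k' = ord_max :> 'I_2 by apply/val_inj; rewrite /= ord1.
by rewrite z1' /= mulr0.
Qed.

(** The side conditions on squares and diagonal hold for the characteristic frame and for its swap,
    so that both directions are covered. *)
Lemma growth_transport nl p (v1 v2 : V) (k1 k2 : {linear V -> R}) :
  frame v1 v2 k1 k2 -> (forall T, square k1 k2 T = square l1 l2 T) ->
  (forall z, k1 z = k2 z -> l1 z = l2 z) ->
  (forall e, smooth (p e)) -> growth nl (fun e => 'D_v2 (p e)) ->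
  growth nl (fun e => p e \o initial_point) -> growth nl p.
Proof.
move=> kfr sqE kl sp gD gt; apply: (growth_estimate _ gD gt gt) => A cA.
have [T T0 AT] := compact_square fr cA.
have [Q Q0 HQ] := transport_bound HC kfr T0.
exists (square l1 l2 T), (base_segment T), (base_segment T), Q; split=> //.
- exact: (@square_compact _ _ _ _ _ _ fr).
- exact: base_segment_compact.
- exact: base_segment_compact.
move=> e M M0 DM tM _ z /AT Tz; apply: HQ => // [y|y|y|].
- exact: smooth_derivable.
- by rewrite sqE; exact: DM.
- by rewrite sqE => Ty /kl /(square_base Ty)[x Sx ->]; exact: tM.
- by rewrite sqE.
Qed.

(** The inequality on [wave (w e)] covers a solution, by [f 0 = 0], and a difference of two
    solutions, by the Lipschitz bound. *)
Lemma growth_gronwall nl w g (L : R) : 0 <= L -> (forall e, smooth (w e)) ->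
  (forall e z, `|wave (w e) z| <= L * `|w e z| + `|g e z|) ->
  growth nl g -> growth nl (fun e => w e \o initial_point) ->
  growth nl (fun e => 'D_char1 (w e) \o initial_point) -> growth nl w.
Proof.
move=> L0 sw wg gg gw gD; apply: (growth_estimate _ gg gw gD) => A cA.
have [T T0 AT] := compact_square fr cA.
have [Q Q0 HQ] := gronwall_bound HC fr T0 L0.
exists (square l1 l2 T), (base_segment T), (base_segment T), Q; split=> //.
- exact: (@square_compact _ _ _ _ _ _ fr).
- exact: base_segment_compact.
- exact: base_segment_compact.
move=> e M M0 gM wM DM z /AT Tz; apply: HQ => // y Ty.
- have /(congr1 (@^~ y)) E := wave_char HC (sw e).
  rewrite E -[X in `|X|]/(- wave (w e) y) normrN (le_trans (wg e y))// lerD2l.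
  exact: gM.
- by move=> /(square_base Ty)[x Sx ->]; split; [exact: wM|exact: DM].
Qed.

End WaveNets.

(** * Derivatives of higher order *)

Section Bootstrap.
Context {R : realType} {K : normedModType R}.
Variable C : R.
Hypothesis HC : mean_value_constant K C.
Local Notation V := 'rV[R]_2.
Local Notation dx := (delta_mx 0 ord0 : V).
Local Notation dt := (delta_mx 0 ord_max : V).
Implicit Types w : eps01 R -> V -> K.
Let fr := @char_frame R.
Let rf := frame_swap fr.

Lemma iter_derive_smooth (U W : normedModType R) (s : seq U) (F : U -> W) :
  smooth F -> smooth (iter_derive s F).
Proof. by move=> sF; elim: s => [//|v s IH]; exact: smooth_derive. Qed.

Lemma coord_derive_smooth n (W : normedModType R) (s : seq 'I_n) (F : 'rV[R]_n -> W) :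
  smooth F -> smooth (coord_derive s F).
Proof. exact: iter_derive_smooth. Qed.

Lemma coord_derive_cat n (W : normedModType R) (s s' : seq 'I_n) (F : 'rV[R]_n -> W) :
  coord_derive (s ++ s') F = coord_derive s (coord_derive s' F).
Proof. by rewrite /coord_derive /iter_derive map_cat foldr_cat. Qed.

Lemma smooth_wave (u : V -> K) : smooth u -> smooth (wave u).
Proof. by move=> su; apply: smoothB; do 2 apply: smooth_derive. Qed.

Lemma derive_dtdt (u : V -> K) : smooth u ->
  coord_derive (nseq 2 ord_max) u = coord_derive (nseq 2 ord0) u + wave u.
Proof.
move=> su; rewrite /wave addrC; apply: esym.
exact: (subrK ('D_dx ('D_dx u)) ('D_dt ('D_dt u))).
Qed.

(* Two time derivatives are traded for two space derivatives and a derivative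
   of lower order of [wave w]. *)
Lemma growth_trace_all nl k w : (forall e, smooth (w e)) ->
  upto k (@growth R nl V K) (fun e => wave (w e)) ->
  (forall j, upto j (@growth R nl _ K) (fun e => w e \o initial_point)) ->
  (forall j, upto j (@growth R nl _ K) (fun e => 'D_dt (w e) \o initial_point)) ->
  forall s : seq 'I_2, (size s <= k.+2)%N ->
  growth nl (fun e => coord_derive s (w e) \o initial_point).
Proof.
move=> sw gw g0 g1.
have base (u : eps01 R -> V -> K) i :
    (forall j, upto j (@growth R nl _ K) (fun e => u e \o initial_point)) ->
    growth nl (fun e => coord_derive (nseq i ord0) (u e) \o initial_point).
  move=> /(_ i (nseq i ord0)); rewrite size_nseq leqnn => /(_ isT).
  by under eq_fun do rewrite coord_derive_trace map_nseq.
(* Strong induction on the number [j] of time derivatives, with [i] free because each exchange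
   raises it by two; [j = 0] and [j = 1] are the data. *)
have main j : forall i, (i + j <= k.+2)%N ->
    growth nl (fun e => coord_derive (nseq i ord0 ++ nseq j ord_max) (w e) \o initial_point).
  elim/ltn_ind: j => -[|[|j]] IH i ij.
  - by under eq_fun do rewrite cats0; exact: base.
  - by under eq_fun do rewrite coord_derive_cat; exact: base.
  - pose s := nseq i (ord0 : 'I_2) ++ nseq j (ord_max : 'I_2).
    have ss : size s = (i + j)%N by rewrite size_cat !size_nseq.
    have -> : (fun e => coord_derive (nseq i ord0 ++ nseq j.+2 ord_max) (w e) \o initial_point) =
      (fun e => (coord_derive (nseq i.+2 ord0 ++ nseq j ord_max) (w e) \o initial_point) +
                (coord_derive s (wave (w e)) \o initial_point)).
      apply/funext => e; have -> : nseq i ord0 ++ nseq j.+2 ord_max = s ++ nseq 2 (ord_max : 'I_2).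
        by rewrite /s -catA; congr (_ ++ _); rewrite -nseqD addn2.
      rewrite coord_derive_cat derive_dtdt// {1}/coord_derive iter_deriveD//; last first.
      + exact: smooth_wave.
      + exact: coord_derive_smooth.
      rewrite -!/(coord_derive _ _) -coord_derive_cat.
      suff -> : coord_derive (s ++ nseq 2 ord0) (w e) = coord_derive (nseq i.+2 ord0 ++ nseq j ord_max) (w e) by [].
      by apply: (coord_derive_perm HC) => //; rewrite perm_catC /s catA; exact: perm_refl.
    apply: growthD; first by apply: IH => //; rewrite addSn addSn -addnS -addnS.
    apply: growth_trace; apply: gw; rewrite ss.
    by move: ij; rewrite !addnS !ltnS.
move=> s sk; under eq_fun do rewrite (coord_derive_sort HC s)//.
by apply: main; rewrite -size_count_ord2.
Qed.

(* [D_char2 (D_s (D_char1 w)) = - D_s (wave w)], so that [D_s (D_char1 w)] is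
   obtained by one integration from its trace and from [D_s (wave w)]. *)
Lemma growth_bootstrap nl k w : (forall e, smooth (w e)) ->
  upto k (@growth R nl V K) (fun e => wave (w e)) ->
  (forall j, upto j (@growth R nl _ K) (fun e => w e \o initial_point)) ->
  (forall j, upto j (@growth R nl _ K) (fun e => 'D_dt (w e) \o initial_point)) ->
  upto k (@growth R nl V K) w -> upto k.+1 (@growth R nl V K) w.
Proof.
move=> sw gw g0 g1 uw; have tr := growth_trace_all sw gw g0 g1.
apply/uptoS; split; first exact: upto0 uw.
have ss (s : seq 'I_2) (v : V) e : smooth (coord_derive s ('D_v (w e))).
  by apply: coord_derive_smooth; exact: smooth_derive.
have sdir (s : seq 'I_2) e i : coord_derive (rcons s i) (w e) = coord_derive s ('D_(delta_mx 0 i) (w e)).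
  exact: coord_derive_rcons.
have dir (p q : V) e : 'D_(p + q) (w e) = 'D_p (w e) + 'D_q (w e) /\
    'D_(p - q) (w e) = 'D_p (w e) - 'D_q (w e).
  by split; [exact: deriveD_smooth|exact: deriveB_smooth].
have trD s i : (size s <= k)%N ->
    growth nl (fun e => coord_derive s ('D_(delta_mx 0 i) (w e)) \o initial_point).
  move=> sk; have := tr (rcons s i); rewrite size_rcons => /(_ (leqW sk)).
  by under eq_fun do rewrite sdir.
(* Used with the characteristic frame for ['D_char1] and with the swapped frame for ['D_char2]. *)
have gch (v v' : V) (k1 k2 : {linear V -> R}) s : frame v v' k1 k2 ->
    (forall T, square k1 k2 T = square (@char_coord1 R) (@char_coord2 R) T) ->
    (forall z, k1 z = k2 z -> @char_coord1 R z = char_coord2 z) ->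
    (forall e, 'D_v' ('D_v (w e)) = - wave (w e)) ->
    growth nl (fun e => coord_derive s ('D_v (w e)) \o initial_point) ->
    (size s <= k)%N -> growth nl (fun e => coord_derive s ('D_v (w e))).
  move=> vfr sqE kl Dw gt sk; apply: (growth_transport HC vfr) => //.
  have -> : (fun e => 'D_v' (coord_derive s ('D_v (w e)))) =
      (fun e => - coord_derive s (wave (w e))).
    apply/funext => e; have sv := smooth_derive v (sw e).
    have := @iter_derive_comm R V K C HC ('D_v (w e)) [seq delta_mx 0 i | i <- s] v' sv.
    by rewrite Dw => <-; exact: iter_deriveN (smooth_wave (sw e)).
  by apply: growthN; exact: gw.
have dirs (s : seq 'I_2) e :
    coord_derive s ('D_char1 (w e)) = coord_derive s ('D_dx (w e)) + coord_derive s ('D_dt (w e)) /\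
    coord_derive s ('D_char2 (w e)) = coord_derive s ('D_dx (w e)) - coord_derive s ('D_dt (w e)).
  have [E1 E2] := dir dx dt e; have s1 := smooth_derive dx (sw e); have s2 := smooth_derive dt (sw e).
  split; first by rewrite -[char1]/(dx + dt) E1; exact: iter_deriveD.
  by rewrite -[char2]/(dx - dt) E2; exact: iter_deriveB.
have gc1 s : (size s <= k)%N -> growth nl (fun e => coord_derive s ('D_char1 (w e))).
  move=> sk; apply: (gch _ _ _ _ s fr) => // [e|]; first exact: (wave_char HC (sw e)).
  under eq_fun do rewrite (dirs s _).1.
  exact: (growthD (trD s ord0 sk) (trD s ord_max sk)).
have gc2 s : (size s <= k)%N -> growth nl (fun e => coord_derive s ('D_char2 (w e))).
  move=> sk; apply: (gch _ _ _ _ s rf) => // [T|e|].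
  - exact: square_swap.
  - by rewrite -(wave_char HC (sw e)); exact: (derive_comm HC).
  - under eq_fun do rewrite (dirs s _).2.
    exact: (growthB (trD s ord0 sk) (trD s ord_max sk)).
move=> i s sk; have [->|->] := ord2_cases i.
- have -> : (fun e => coord_derive s ('D_dx (w e))) =
      (fun e => 2^-1 \*: (coord_derive s ('D_char1 (w e)) + coord_derive s ('D_char2 (w e)))).
    apply/funext => e; have [-> ->] := dirs s e; apply/funext => z.
    move: (coord_derive s ('D_dx (w e))) (coord_derive s ('D_dt (w e))) => p q.
    rewrite -[RHS]/(2^-1 *: ((p z + q z) + (p z - q z))) addrACA subrr addr0 scalerDr -scalerDl.
    by rewrite -[LHS]scale1r; congr (_ *: _); field.
  by apply: growthZ; apply: growthD; [exact: gc1|exact: gc2].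
- have -> : (fun e => coord_derive s ('D_dt (w e))) =
      (fun e => 2^-1 \*: (coord_derive s ('D_char1 (w e)) - coord_derive s ('D_char2 (w e)))).
    apply/funext => e; have [-> ->] := dirs s e; apply/funext => z.
    move: (coord_derive s ('D_dx (w e))) (coord_derive s ('D_dt (w e))) => p q.
    rewrite -[RHS]/(2^-1 *: ((p z + q z) - (p z - q z))) opprB [p z + q z]addrC addrACA subrr addr0.
    rewrite scalerDr -scalerDl.
    by rewrite -[LHS]scale1r; congr (_ *: _); field.
  by apply: growthZ; apply: growthB; [exact: gc1|exact: gc2].
Qed.

End Bootstrap.

Section SemilinearNets.
Context {R : realType} {K : normedModType R}.
Variables (m : nat) (b : 'I_m -> K) (c : 'I_m -> {linear K -> R}).
Hypothesis bc : coordinates b c.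
Variable C : R.
Hypothesis HC : mean_value_constant K C.
Local Notation V := 'rV[R]_2.
Local Notation dx := (delta_mx 0 ord0 : V).
Local Notation dt := (delta_mx 0 ord_max : V).
Implicit Types (u v w h : eps01 R -> V -> K).
Variables (f : K -> K) (L : R).
Hypotheses (tf : tempered f) (L0 : 0 < L).
Hypothesis (Lf : forall x y, `|f x - f y| <= L * `|x - y|).

Lemma growth_char1_trace nl w : (forall e, smooth (w e)) ->
  (forall j, upto j (@growth R nl _ K) (fun e => w e \o initial_point)) ->
  (forall j, upto j (@growth R nl _ K) (fun e => 'D_dt (w e) \o initial_point)) ->
  growth nl (fun e => 'D_char1 (w e) \o initial_point).
Proof.
move=> sw g0 g1.
have -> : (fun e => 'D_char1 (w e) \o initial_point) =
    (fun e => coord_derive [:: 0] (w e \o initial_point) + ('D_dt (w e) \o initial_point)).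
  apply/funext => e; apply/funext => x.
  have /(congr1 (@^~ (initial_point x))) E := deriveD_smooth dx dt (sw e).
  apply: (etrans E); congr (_ + _); exact: esym (derive_trace _ _).
by apply: growthD; [exact: (g0 1%N)|exact: (g1 0%N [::])].
Qed.

Lemma moderate_solution u h (a0 b0 : eps01 R -> 'rV[R]_1 -> K) : f 0 = 0 ->
  moderate a0 -> moderate b0 -> moderate h -> (forall e, smooth (u e)) ->
  (forall e, wave (u e) = (f \o u e) + h e) ->
  (forall e, u e \o initial_point = a0 e) ->
  (forall e, 'D_dt (u e) \o initial_point = b0 e) -> moderate u.
Proof.
move=> f0 /moderateE[sa ma] /moderateE[sb mb] /moderateE[sh mh] su uE ua ub.
have g0 j : upto j (@growth R false _ K) (fun e => u e \o initial_point).
  by under eq_fun do rewrite ua; exact: ma.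
have g1 j : upto j (@growth R false _ K) (fun e => 'D_dt (u e) \o initial_point).
  by under eq_fun do rewrite ub; exact: mb.
apply/moderateE; split=> //; elim=> [|k IH].
  case=> // _; apply: (@growth_gronwall R K C HC false u h L) => //; rewrite ?ltW//.
  (* Here [f 0 = 0] turns the Lipschitz estimate into a bound of [f] at [u] by [L * |u|]. *)
  - move=> e z; rewrite uE -[X in `|X|]/(f (u e z) + h e z) (le_trans (ler_normD _ _))//.
    by rewrite lerD2r; have := Lf (u e z) 0; rewrite f0 !subr0.
  - exact: (mh 0%N [::]).
  - exact: (g0 0%N [::]).
  - exact: growth_char1_trace.
apply: (@growth_bootstrap R K C HC false k u) => //.
under eq_fun do rewrite uE.
apply: (@uptoD R 2 k K (@growth R false V K) (fun e => f \o u e) h (growth_add false _ _)) => //.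
- by move=> e; apply: (smooth_comp bc) => //; exact: tempered_smooth.
- by apply: (upto_comp bc) => //; exact: IH.
Qed.

(** Order zero uses the Lipschitz bound. Above it, differentiating the difference of the
    compositions produces null factors times derivatives of [u] or of [f] along [v]; moderateness of
    [u] and [v] makes these products null. *)
Lemma null_difference u v (nu : eps01 R -> V -> K) : moderate u -> moderate v ->
  null nu -> (forall e, wave (u e - v e) = ((f \o u e) - (f \o v e)) + nu e) ->
  null (fun e => (u e - v e) \o initial_point) ->
  null (fun e => 'D_dt (u e - v e) \o initial_point) ->
  null (fun e => u e - v e).
Proof.
move=> /moderateE[su mu] /moderateE[sv mv] /nullE[sn nn] wE /nullE[_ n0] /nullE[_ n1].
pose w e := u e - v e; have sw e : smooth (w e) by exact: smoothB.
apply/nullE; split=> //; elim=> [|k IH].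
  case=> // _; apply: (@growth_gronwall R K C HC true w nu L) => //; rewrite ?ltW//.
  - move=> e z; rewrite wE -[X in `|X|]/((f (u e z) - f (v e z)) + nu e z).
    by rewrite (le_trans (ler_normD _ _))// lerD2r Lf.
  - exact: (nn 0%N [::]).
  - exact: (n0 0%N [::]).
  - exact: growth_char1_trace.
apply: (@growth_bootstrap R K C HC true k w) => //.
rewrite /w; under eq_fun do rewrite wE.
have sfu e : smooth (f \o u e) by apply: (smooth_comp bc) => //; exact: tempered_smooth.
have sfv e : smooth (f \o v e) by apply: (smooth_comp bc) => //; exact: tempered_smooth.
apply: (@uptoD R 2 k K (@growth R true V K) (fun e => (f \o u e) - (f \o v e)) nu (growth_add true _ _)) => //.
- by move=> e; exact: smoothB.
- exact: (upto_compB bc).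
Qed.

End SemilinearNets.

(** * Sharp continuity *)

Section Diagonal.
Context {R : realType}.

Lemma finite_lower_bound (n : nat) (eta : 'I_n -> R) : (forall i, 0 < eta i) ->
  exists2 d, 0 < d & forall i, d <= eta i.
Proof.
move=> eta0; pose S := 1 + \sum_i (eta i)^-1.
have S0 (i : 'I_n) : (eta i)^-1 <= S.
  rewrite /S (bigD1 i)//= addrCA lerDl addr_ge0// sumr_ge0// => j _.
  by rewrite invr_ge0 ltW.
have Sp : 0 < S by rewrite ltr_wpDr// sumr_ge0// => j _; rewrite invr_ge0 ltW.
exists S^-1 => [|i]; first by rewrite invr_gt0.
by rewrite -[eta i]invrK lef_pV2 ?posrE ?invr_gt0.
Qed.

(** Finitely many words have length at most [k], so one threshold serves all of them; the induction
    peels off the first letter. *)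
Lemma words_uniform (d k : nat) (P : seq 'I_d -> R -> Prop) :
  (forall s x y, x <= y -> P s y -> P s x) ->
  (forall s, (size s <= k)%N -> exists2 x, 0 < x & P s x) ->
  exists2 x, 0 < x & forall s, (size s <= k)%N -> P s x.
Proof.
elim: k P => [|k IH] P mono ex.
  by have [x x0 Px] := ex [::] isT; exists x => // -[].
have /choice[eta Heta] (i : 'I_d) : exists x : R, 0 < x /\
    forall s, (size s <= k)%N -> P (i :: s) x.
  have [x x0 Px] := IH (fun s => P (i :: s)) (fun s => mono (i :: s)) (fun s => ex (i :: s)).
  by exists x.
have [x x0 Px] := ex [::] isT.
have [y y0 Hy] := finite_lower_bound (fun i => (Heta i).1).
exists (Num.min x y) => [|[_|i s]]; first by rewrite lt_min x0.
  by apply: mono Px; rewrite ge_min lexx.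
rewrite /= ltnS => sk; apply: mono ((Heta i).2 s sk).
by rewrite (le_trans _ (Hy i))// ge_min lexx orbT.
Qed.

Definition centered_ball d (n : nat) : set 'rV[R]_d := [set x | `|x| <= n%:R].

Lemma centered_ball_compact d n : compact (@centered_ball d n).
Proof.
apply: bounded_closed_compact.
  exists n%:R; split; first exact: num_real.
  by move=> x nx y /= yn; rewrite (le_trans yn)// ltW.
have -> : @centered_ball d n = closed_ball_ Num.norm (0 : 'rV[R]_d) n%:R.
  by apply/seteqP; split => x; rewrite /closed_ball_/= sub0r normrN.
exact: closed_closed_ball_.
Qed.

Lemma compact_centered_ball d (A : set 'rV[R]_d) : compact A ->
  exists N, forall n, (N <= n)%N -> A `<=` @centered_ball d n.
Proof.
move=> /compact_bounded[M [_ HM]]; exists (Num.truncn (`|M| + 1)).+1 => n Nn x Ax.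
rewrite /centered_ball/=; apply: (le_trans (HM (`|M| + 1) _ x Ax)).
  by rewrite ltr_pwDr// ler_norm.
by rewrite ltW// (lt_le_trans (truncnS_gt _))// ler_nat.
Qed.

(** One spare power of the parameter absorbs the constant once the parameter is below
    [(C + 1)^-1]. *)
Lemma sup_bigO_power (V W : normedModType R) (A : set V) (u : eps01 R -> V -> W) q :
  sup_bigO A u (q + 1) -> exists2 eta, 0 < eta & forall e : eps01 R, val e < eta ->
  forall x, A x -> `|u e x| <= val e `^ q.
Proof.
move=> /sup_bigO_ge0[C [eta [C0 eta0 H]]].
have C10 : 0 < C + 1 by rewrite ltr_wpDl.
exists (Num.min eta (C + 1)^-1) => [|e]; first by rewrite lt_min eta0 invr_gt0.
rewrite lt_min => /andP[e1 e2] x Ax; rewrite (le_trans (H e e1 x Ax))//.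
have pe := eps01_powR_ge0 e q; have e0 := eps01_gt0 e.
rewrite eps01_powRD powRr1 ?(ltW e0)// mulrCA ler_piMr//.
move: e2; rewrite -[_^-1]mul1r ltr_pdivlMr// mulrC => e2.
by rewrite (le_trans _ (ltW e2))// ler_wpM2r ?(ltW e0)// lerDl.
Qed.

Context {d : nat} {K : normedModType R}.

(** [N] is a partial inverse of [en]. A parameter below the first [M] values of [en] can only carry
    an index from [M] on, and there the assumed bound is the wanted one. *)
Lemma null_diagonal (w : nat -> eps01 R -> 'rV[R]_d -> K) (en : nat -> eps01 R)
    (N : eps01 R -> option nat) :
  (forall n e, smooth (w n e)) ->
  (forall n s x, (size s <= n)%N -> `|x| <= n%:R ->
    `|coord_derive s (w n (en n)) x| <= val (en n) `^ n%:R) ->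
  (forall e n, N e = Some n -> en n = e) ->
  null (fun e => if N e is Some n then w n e else 0).
Proof.
move=> sw bw HN; split=> [e|A cA s q q0].
  by case: (N e) => [n|]; [exact: sw|exact: smooth0].
have [N0 HN0] := compact_centered_ball cA.
(* From this index on, the ball contains [A], the word is short enough and the exponent exceeds
   [q]. *)
pose M := (maxn (maxn N0 (size s)) (Num.truncn q).+1).
have [eta eta0 Heta] := finite_lower_bound (fun i : 'I_M => eps01_gt0 (en i)).
exists 1, eta; split=> // e ee x Ax; rewrite mul1r.
case E : (N e) => [n|]; last first.
  by rewrite /coord_derive iter_derive0 normr0 eps01_powR_ge0.
have en_e := HN e n E.
have Mn : (M <= n)%N.
  rewrite leqNgt; apply/negP => nM; have := Heta (Ordinal nM).
  by rewrite /= en_e leNgt ee.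
move: Mn; rewrite !geq_max => /andP[/andP[N0n sn] qn].
rewrite -en_e (le_trans (bw n s x sn _))//; first exact: HN0 Ax.
by rewrite eps01_powR_le// ltW// (lt_le_trans (truncnS_gt _))// ler_nat.
Qed.

Lemma null_moderate (u : eps01 R -> 'rV[R]_d -> K) : null u -> moderate u.
Proof.
by move=> [su nu]; split=> // A cA s; exists 0 => //; rewrite oppr0; exact: nu.
Qed.

End Diagonal.

Lemma subrBB (V : zmodType) (p q r s : V) : (p - q) - (r - s) = (p - r) - (q - s).
Proof. by rewrite !opprB addrACA [RHS]addrACA [- q - r]addrC. Qed.

Lemma addrKl (V : zmodType) (p h : V) : p + h - p = h.
Proof. by rewrite [p + h]addrC addrK. Qed.

Lemma subr_split (V : zmodType) (p q r s : V) : r - s = (p - q) + ((r - p) - (s - q)).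
Proof. by rewrite subrBB [RHS]addrC subrK. Qed.

Lemma waveB (R : realType) (K : normedModType R) (F F' : 'rV[R]_2 -> K) :
  smooth F -> smooth F' -> wave (F - F') = wave F - wave F'.
Proof.
move=> sF sF'; have D2 (p : 'rV[R]_2) := iter_deriveB [:: p; p] sF sF'.
apply: (etrans (congr2 (fun x y => x - y) (D2 (delta_mx 0 ord_max)) (D2 (delta_mx 0 ord0)))).
exact: subrBB.
Qed.

(** * The wave problem in the Colombeau algebra *)

Section WaveProblemSolution.
Context {R : realType} (k : scalars).
Local Notation K := (scalar_field R k).
Local Notation G d := (colombeau d K).
Local Notation pi d u := (\pi_(colombeau d K)%qT u).
Variable f : K -> K.
Hypotheses (tf : tempered f) (lf : lipschitz f) (f0 : f 0 = 0).

Lemma lipschitz_constant : exists2 L : R, 0 < L &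
  forall x y, `|f x - f y| <= L * `|x - y|.
Proof.
have [M [_ HM]] := lf; exists (`|M| + 1) => [|x y]; first by rewrite ltr_wpDl.
have M1 : M < `|M| + 1 by rewrite ltr_pwDr// ler_norm.
by have := HM _ M1 (x, y); apply.
Qed.

Definition net_wave (u : moderate_net 2 K) : moderate_net 2 K :=
  net_derive ord_max (net_derive ord_max u) - net_derive ord0 (net_derive ord0 u).

Lemma pi_netB d (x y : moderate_net d K) : pi d (x - y) = pi d x - pi d y.
Proof. by rewrite pi_netD pi_netN. Qed.

Lemma wave_problem_pi (a b : G 1) (h : G 2) u : wave_problem tf a b h (pi 2 u) <->
  [/\ pi 2 (net_wave u) = pi 2 (net_comp tf u) + h, pi 1 (net_trace u) = a &
      pi 1 (net_trace (net_derive ord_max u)) = b].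
Proof.
by rewrite /wave_problem /colombeau_dt /colombeau_dx /net_wave !colombeau_derive_pi
  colombeau_comp_pi pi_netB !colombeau_trace_pi.
Qed.

(** Representatives solve the equation only up to null nets, which become a source term in the
    equation for their difference. *)
Lemma wave_problem_unique (a b : G 1) (h U U' : G 2) :
  wave_problem tf a b h U -> wave_problem tf a b h U' -> U = U'.
Proof.
have [m [bs [c bc]]] := @scalar_coordinates R k.
have [C HC] := mean_value bc; have [L L0 Lf] := lipschitz_constant.
rewrite -[U]reprK -[U']reprK; move: (repr U) (repr U') => u v.
move=> /wave_problem_pi[uE ua ub] /wave_problem_pi[vE va vb].
apply/colombeau_eqP.
have su := (net_moderate u).1; have sv := (net_moderate v).1.
(* Both residuals represent [h], so their difference is null. *)
pose nu : moderate_net 2 K := (net_wave u - net_comp tf u) - (net_wave v - net_comp tf v).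
have nnu : null (net_val nu).
  have nuh w : pi 2 (net_wave w) = pi 2 (net_comp tf w) + h ->
      pi 2 (net_wave w - net_comp tf w) = h.
    by move=> E; apply: (etrans (pi_netB _ _)); rewrite E; exact: addrKl.
  apply/colombeau_eqP; exact: etrans (nuh u uE) (esym (nuh v vE)).
have w0 : null (net_val (net_trace u - net_trace v)).
  by apply/colombeau_eqP; rewrite ua va.
have w1 : null (net_val (net_trace (net_derive ord_max u) - net_trace (net_derive ord_max v))).
  by apply/colombeau_eqP; rewrite ub vb.
apply: (null_difference bc HC tf L0 Lf (net_moderate u) (net_moderate v) nnu) => [e||].
- rewrite waveB//; apply/funext => z.
  rewrite -[RHS]/((f (u e z) - f (v e z)) +
    ((wave (u e) z - f (u e z)) - (wave (v e) z - f (v e z)))).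
  rewrite -[LHS]/(wave (u e) z - wave (v e) z).
  exact: subr_split.
- exact: w0.
- have -> : (fun e => 'D_(delta_mx 0 ord_max) (u e - v e) \o initial_point) =
      net_val (net_trace (net_derive ord_max u) - net_trace (net_derive ord_max v)).
    apply/funext => e; have := iter_deriveB [:: delta_mx 0 ord_max] (su e) (sv e).
    by move=> /(congr1 (fun F : _ -> _ => F \o initial_point)).
  exact: w1.
Qed.

Definition solves (a b : 'rV[R]_1 -> K) (h u : 'rV[R]_2 -> K) :=
  [/\ smooth u, wave u = (f \o u) + h, u \o initial_point = a &
      'D_(delta_mx 0 ord_max) u \o initial_point = b].

(** The choice is made for functions, not for nets, so that a solution net at [e] depends on the
    data at [e] alone. *)
Lemma solution_operator : exists sol : ('rV[R]_1 -> K) -> ('rV[R]_1 -> K) ->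
    ('rV[R]_2 -> K) -> 'rV[R]_2 -> K,
  forall (a b : 'rV[R]_1 -> K) (h : 'rV[R]_2 -> K),
    smooth a -> smooth b -> smooth h -> solves a b h (sol a b h).
Proof.
have [m [bs [c bc]]] := @scalar_coordinates R k.
have [C HC] := mean_value bc; have [L L0 Lf] := lipschitz_constant.
pose P (x : ('rV[R]_1 -> K) * ('rV[R]_1 -> K) * ('rV[R]_2 -> K)) (u : 'rV[R]_2 -> K) :=
  smooth x.1.1 -> smooth x.1.2 -> smooth x.2 -> solves x.1.1 x.1.2 x.2 u.
have /choice[sol Hsol] : forall x, exists u, P x u.
  move=> [[a b] h]; have [sa|nsa] := pselect (smooth a); last by exists 0.
  have [sb|nsb] := pselect (smooth b); last by exists 0.
  have [sh|nsh] := pselect (smooth h); last by exists 0.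
  have [u Hu] := exact_solution bc HC L0 Lf (tempered_smooth tf) sa sb sh.
  by exists u.
by exists (fun a' b' h' => sol (a', b', h')) => a' b' h'; exact: (Hsol (a', b', h')).
Qed.

Variable sol : ('rV[R]_1 -> K) -> ('rV[R]_1 -> K) -> ('rV[R]_2 -> K) -> 'rV[R]_2 -> K.
Hypothesis solP : forall (a b : 'rV[R]_1 -> K) (h : 'rV[R]_2 -> K),
  smooth a -> smooth b -> smooth h -> solves a b h (sol a b h).

Lemma solution_net (a b : moderate_net 1 K) (h : moderate_net 2 K) :
  exists u : moderate_net 2 K, (forall e, u e = sol (a e) (b e) (h e)) /\
  wave_problem tf (pi 1 a) (pi 1 b) (pi 2 h) (pi 2 u).
Proof.
have [m [bs [c bc]]] := @scalar_coordinates R k.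
have [C HC] := mean_value bc; have [L L0 Lf] := lipschitz_constant.
have Hs e := solP ((net_moderate a).1 e) ((net_moderate b).1 e) ((net_moderate h).1 e).
pose u e := sol (a e) (b e) (h e).
have mu : u \in @moderate_pred R 2 K.
  apply/asboolP; apply: (moderate_solution bc HC tf L0 Lf f0
    (net_moderate a) (net_moderate b) (net_moderate h)) => e; by have [] := Hs e.
exists (ModerateNet mu); split=> //; apply/wave_problem_pi; split.
- rewrite -pi_netD; congr (\pi_(_)%qT _); apply/val_inj; apply/funext => e.
  by have [] := Hs e.
- by congr (\pi_(_)%qT _); apply/val_inj; apply/funext => e; have [] := Hs e.
- by congr (\pi_(_)%qT _); apply/val_inj; apply/funext => e; have [] := Hs e.
Qed.

(** The exponent [n.+1] provides the spare power spent in [sup_bigO_power], which leaves a bound by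
    the [n]-th power with constant 1. *)
Lemma sharp_ball_nbhs d (U : G d) n : nbhs U
  [set U' | sharp_V (@centered_ball R d n) n n.+1%:R (U' - U)].
Proof.
exists (@centered_ball R d n), n, n.+1%:R; split=> //; first exact: centered_ball_compact.
by move=> W VW; rewrite /= addrKl.
Qed.

Lemma sharp_ball_bound d (W : G d) n :
  sharp_V (@centered_ball R d n) n n.+1%:R W ->
  exists w : moderate_net d K, W = pi d w /\
  exists2 eta, 0 < eta & forall s, (size s <= n)%N ->
  forall e : eps01 R, val e < eta -> forall x, `|x| <= n%:R ->
    `|coord_derive s (w e) x| <= val e `^ n%:R.
Proof.
move=> [w -> Hw]; exists w; split=> //.
apply: (@words_uniform R d n (fun s eta => forall e : eps01 R, val e < eta ->
    forall x, `|x| <= n%:R -> `|coord_derive s (w e) x| <= val e `^ n%:R)).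
  by move=> s x y xy H e ex; apply: H; exact: lt_le_trans ex xy.
by move=> s sn; apply: sup_bigO_power; have := Hw s sn; rewrite -natr1.
Qed.

Lemma sharp_nbhs_counterexample (S : G 1 * G 1 * G 2 -> G 2) x B n :
  ~ nbhs x (S @^-1` B) -> exists (a b : G 1) (h : G 2),
  [/\ sharp_V (@centered_ball R 1 n) n n.+1%:R a,
     sharp_V (@centered_ball R 1 n) n n.+1%:R b,
     sharp_V (@centered_ball R 2 n) n n.+1%:R h &
     ~ B (S (x.1.1 + a, x.1.2 + b, x.2 + h))].
Proof.
move=> nB; apply: contrapT => H; apply: nB.
pose Q d (U : G d) := [set U' : G d | sharp_V (@centered_ball R d n) n n.+1%:R (U' - U)].
exists (Q 1%N x.1.1 `*` Q 1%N x.1.2, Q 2%N x.2).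
  split; last exact: sharp_ball_nbhs.
  by exists (Q 1%N x.1.1, Q 1%N x.1.2) => //; split; exact: sharp_ball_nbhs.
move=> [[a b] h] [[/= Qa Qb] Qh]; apply: contrapT => nBS; apply: H.
exists (a - x.1.1), (b - x.1.2), (h - x.2); split=> //.
have E (V : zmodType) (p q : V) : q + (p - q) = p by rewrite addrC subrK.
by rewrite !E.
Qed.

Lemma sup_bigO_not (V W : normedModType R) (A : set V) (u : eps01 R -> V -> W) p :
  ~ sup_bigO A u p -> forall eta : R, 0 < eta -> exists e : eps01 R,
  val e < eta /\ exists2 x, A x & val e `^ p < `|u e x|.
Proof.
move=> nO eta eta0; apply: contrapT => H; apply: nO; exists 1, eta; split=> // e ee x Ax.
rewrite mul1r leNgt; apply/negP => lt; apply: H; exists e; split=> //.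
by exists x.
Qed.

Lemma solution_continuous (S : G 1 * G 1 * G 2 -> G 2) :
  (forall a b h, wave_problem tf a b h (S (a, b, h))) -> continuous S.
Proof.
move=> SP x B HB; apply: contrapT => nB.
have [A [m [p [cA p0 HA]]]] : sharp_nbhs (S x) B by [].
move: x nB HB HA => [[a0 b0] h0]; rewrite -[a0]reprK -[b0]reprK -[h0]reprK.
move: (repr a0) (repr b0) (repr h0) => {a0 b0 h0} a b h nB HB HA.
have [u [uE uS]] := solution_net a b h.
have Su : S (pi 1 a, pi 1 b, pi 2 h) = pi 2 u by exact: wave_problem_unique (SP _ _ _) uS.
pose small n d (w : 'rV[R]_d -> K) (e : eps01 R) := forall s, (size s <= n)%N ->
  forall x, `|x| <= n%:R -> `|coord_derive s w x| <= val e `^ n%:R.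
pose bad (e : eps01 R) (w : 'rV[R]_2 -> K) := exists s, (size s <= m)%N /\
  exists2 x, A x & val e `^ p < `|coord_derive s (w - u e) x|.
(* The parameter is below [n.+1%:R^-1] and below the three thresholds where the [n]-th perturbation
   becomes small, yet the effect on the solution exceeds the [p]-th power there. *)
have step n : exists q : moderate_net 1 K * moderate_net 1 K * moderate_net 2 K * eps01 R,
  let: (a', b', h', e) := q in
  [/\ val e < n.+1%:R^-1, small n _ (a' e) e, small n _ (b' e) e, small n _ (h' e) e &
    bad e (sol (a e + a' e) (b e + b' e) (h e + h' e))].
  have [Wa [Wb [Wh []]]] := sharp_nbhs_counterexample n nB.
  move=> /sharp_ball_bound[a' [-> [ta ta0 Ha]]] /sharp_ball_bound[b' [-> [tb tb0 Hb]]].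
  move=> /sharp_ball_bound[h' [-> [th th0 Hh]]] nBS.
  have [v [vE vS]] := solution_net (a + a') (b + b') (h + h').
  have nV : ~ sharp_V A m p (pi 2 (v - u)).
    move=> /HA; rewrite Su -pi_netD => BS; apply: nBS; rewrite -!pi_netD.
    rewrite (wave_problem_unique (SP _ _ _) vS); move: BS.
    by rewrite [u + _]addrC subrK.
  have [s sm /sup_bigO_not Hs] : exists2 s, (size s <= m)%N &
      ~ sup_bigO A (fun e => coord_derive s (net_val (v - u) e)) p.
    apply: contrapT => H; apply: nV; exists (v - u) => // s sm.
    by apply: contrapT => ns; apply: H; exists s.
  have [e [ee [x Ax ex]]] := Hs (Num.min (Num.min ta tb) (Num.min th n.+1%:R^-1))
    ltac:(by rewrite !lt_min ta0 tb0 th0 invr_gt0 ltr0Sn).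
  move: ee; rewrite !lt_min => /andP[/andP[ea eb] /andP[eh en]].
  exists (a', b', h', e); split=> //.
  - by move=> s' sn y yn; exact: Ha.
  - by move=> s' sn y yn; exact: Hb.
  - by move=> s' sn y yn; exact: Hh.
  - exists s; split=> //; exists x => //.
    by have -> : sol (a e + a' e) (b e + b' e) (h e + h' e) = v e by rewrite vE.
have [q Hq] := choice step.
pose a' n := (q n).1.1.1; pose b' n := (q n).1.1.2; pose h' n := (q n).1.2.
pose en n := (q n).2.
have {}Hq n : [/\ val (en n) < n.+1%:R^-1, small n _ (a' n (en n)) (en n),
    small n _ (b' n (en n)) (en n), small n _ (h' n (en n)) (en n) &
    bad (en n) (sol (a (en n) + a' n (en n)) (b (en n) + b' n (en n)) (h (en n) + h' n (en n)))].
  by move: (Hq n); rewrite /en /a' /b' /h'; case: (q n) => [[[? ?] ?] ?].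
(* [en] may repeat values, so one index is selected for each parameter; it need not be the index
   that one started from. *)
have [N [HN1 HN2]] : exists N : eps01 R -> option nat,
    (forall e n, N e = Some n -> en n = e) /\ (forall n, exists n', N (en n) = Some n').
  have /choice[N HN] : forall e, exists o : option nat,
      (forall n, o = Some n -> en n = e) /\ (forall n, en n = e -> exists n', o = Some n').
    move=> e; have [[n ne]|H] := pselect (exists n, en n = e).
      by exists (Some n); split=> [_ [<-]|]//; exists n.
    by exists None; split=> // n ne; exfalso; apply: H; exists n.
  by exists N; split=> [e n|n]; [exact: (HN e).1|exact: (HN (en n)).2].
pose dg d (w : nat -> moderate_net d K) (e : eps01 R) : 'rV[R]_d -> K :=
  if N e is Some n then w n e else 0.
have dnull d (w : nat -> moderate_net d K) :
    (forall n, small n d (w n (en n)) (en n)) -> null (dg d w).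
  move=> Hw; apply: (@null_diagonal R d K (fun n => net_val (w n)) en) => //.
    by move=> n e; exact: (net_moderate (w n)).1.
  by move=> n s x sn xn; exact: Hw.
have na : null (dg 1%N a') by apply: dnull => n; have [] := Hq n.
have nb : null (dg 1%N b') by apply: dnull => n; have [] := Hq n.
have nh : null (dg 2%N h') by apply: dnull => n; have [] := Hq n.
have netE d (w : eps01 R -> 'rV[R]_d -> K) (nw : null w) :
    exists2 W : moderate_net d K, net_val W = w & pi d W = 0.
  have mw : w \in @moderate_pred R d K by apply/asboolP; exact: null_moderate.
  exists (ModerateNet mw) => //; rewrite -pi_net0; apply/colombeau_eqP.
  have -> // : ModerateNet mw - 0 = ModerateNet mw by rewrite subr0.
have [Da DaE Da0] := netE _ _ na; have [Db DbE Db0] := netE _ _ nb.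
have [Dh DhE Dh0] := netE _ _ nh.
have [v [vE vS]] := solution_net (a + Da) (b + Db) (h + Dh).
have nvu : null (net_val (v - u)).
  apply/colombeau_eqP; move: vS; rewrite !pi_netD Da0 Db0 Dh0 !addr0 => vS.
  exact: wave_problem_unique vS uS.
have [eta eta0 Heta] : exists2 eta, 0 < eta & forall s, (size s <= m)%N ->
    forall e : eps01 R, val e < eta -> forall x, A x ->
    `|coord_derive s (net_val (v - u) e) x| <= val e `^ p.
  apply: (@words_uniform R 2 m (fun s eta => forall e : eps01 R, val e < eta ->
      forall x, A x -> `|coord_derive s (net_val (v - u) e) x| <= val e `^ p)).
    by move=> s x y xy H e ex; apply: H; exact: lt_le_trans ex xy.
  move=> s _; apply: sup_bigO_power; apply: nvu.2 => //; exact: addr_ge0.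
(* The parameter [en n0] lies below [eta], but the perturbation glued there has index [n']; its
   violation occurs at this same parameter. *)
pose n0 := Num.truncn eta^-1; have [n' Nn'] := HN2 n0.
have een' := HN1 _ _ Nn'.
have [en0 _ _ _ _] := Hq n0; have [_ _ _ _ [s [sm [x Ax]]]] := Hq n'.
rewrite een' ltNge => /negP; apply.
have lt_eta : val (en n0) < eta.
  rewrite (lt_trans en0)// -[eta]invrK ltf_pV2 ?posrE ?invr_gt0 ?ltr0Sn//.
  exact: truncnS_gt.
have := Heta s sm (en n0) lt_eta x Ax.
(* At this parameter the glued data are those perturbed with index [n'], and [sol] depends on
   nothing else. *)
suff -> : net_val (v - u) (en n0) = sol (a (en n0) + a' n' (en n0))
   (b (en n0) + b' n' (en n0)) (h (en n0) + h' n' (en n0)) - u (en n0) by [].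
rewrite -[LHS]/(v (en n0) - u (en n0)) vE; congr (_ - _).
have E d (w : moderate_net d K) (W : nat -> moderate_net d K) (D : moderate_net d K) :
    net_val D = dg d W -> (w + D) (en n0) = w (en n0) + W n' (en n0).
  by move=> DE; rewrite -[LHS]/(w (en n0) + net_val D (en n0)) DE /dg Nn'.
by rewrite (E _ a a' Da DaE) (E _ b b' Db DbE) (E _ h h' Dh DhE).
Qed.

End WaveProblemSolution.

From mathcomp Require Import Rstruct Rstruct_topology.

(** By existence and uniqueness exactly one map [S] meets the hypothesis of the second conjunct, so
    quantifying over [S] expresses continuity of the solution map, for the product of the sharp
    topologies. *)
Theorem proposition3 (k : scalars)
    (f : scalar_field Rdefinitions.R k -> scalar_field Rdefinitions.R k)
    (f_tempered : tempered f) (f_lipschitz : lipschitz f) (f0 : f 0 = 0) :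
  (forall (a b : colombeau 1 (scalar_field Rdefinitions.R k))
          (h : colombeau 2 (scalar_field Rdefinitions.R k)),
     exists! u : colombeau 2 (scalar_field Rdefinitions.R k),
       wave_problem f_tempered a b h u) /\
  (forall S : colombeau 1 (scalar_field Rdefinitions.R k) *
              colombeau 1 (scalar_field Rdefinitions.R k) *
              colombeau 2 (scalar_field Rdefinitions.R k) ->
              colombeau 2 (scalar_field Rdefinitions.R k),
     (forall a b h, wave_problem f_tempered a b h (S (a, b, h))) ->
     continuous S).
Proof.
have [sol solP] := solution_operator f_tempered f_lipschitz.
split=> [a b h|S SP]; last exact: (solution_continuous f_lipschitz f0 solP).
rewrite -[a]reprK -[b]reprK -[h]reprK.
have [u [_ uS]] := solution_net f_tempered f_lipschitz f0 solP (repr a) (repr b) (repr h).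
exists (\pi_(colombeau 2 (scalar_field Rdefinitions.R k))%qT u); split=> // v vS.
exact: (wave_problem_unique f_lipschitz uS vS).
Qed.
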